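(* For any two distinct functors $F,G$ among the four functors $SC(-,-)$, $AC(-,-)$, $CSC(-,-)$ and $CAC(-,-)$, there exists a path-connected compact Hausdorff space $X$ with a base point $x\in X$ such that $F(X,x)$ and $G(X,x)$ are not homotopy equivalent.
   Context: Let $\mathbb{I}=[0,1]$ and $\mathbb{N}=\{1,2,3,\dots\}$; a point of the plane with coordinates $a,b$ is written $(a;b)$. Piecewise linear Topologist sine curve: let $A=(0;0)$, $B=(0;1)$, $A_n=(1/n;0)$, $B_n=(1/n;1)$ for $n\in\mathbb{N}$; let $L=[A,B]$, $L_{2n-1}=[A_n,B_n]$, $L_{2n}=[B_n,A_{n+1}]$ be linear segments, and $\mathcal{T}=L\cup\bigcup_{n\in\mathbb{N}}L_n\subset\mathbb{I}^2\subset\mathbb{R}^2$. For a compact pointed space $(X,x)$: (SC) The Snake cone $SC(X,x)$ is the quotient space of the topological sum $(X\times\mathcal{T})\sqcup\mathbb{I}^2$ obtained by identifying $(x,t)\in X\times\mathcal{T}$ with $t\in\mathbb{I}^2$ for each $t\in\mathcal{T}\setminus L$, and identifying the whole set $X\times\{t\}$ with the point $t\in\mathbb{I}^2$ for each $t\in L$. (AC) Let $Y=X\times\{0\}\times\mathbb{I}\ \cup\ \bigcup_{n\in\mathbb{N}}X\times\{1/n\}\times\mathbb{I}\ \cup\ \{x\}\times\mathbb{I}\times\mathbb{I}\subset X\times\mathbb{I}^2$ (subspace topology). The Alternating cone $AC(X,x)$ is the quotient space of $Y$ obtained by collapsing, each to one point, the sets $X\times\{0\}\times\{y\}$ for every $y\in\mathbb{I}$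 (to the point $(0;y)$), $X\times\{1/(2n-1)\}\times\{0\}$ (to $A_{2n-1}$) and $X\times\{1/(2n)\}\times\{1\}$ (to $B_{2n}$) for every $n\in\mathbb{N}$. The square $\{x\}\times\mathbb{I}\times\mathbb{I}$ is identified with $\mathbb{I}^2\subset AC(X,x)$. (CSC, CAC) The Collapsed snake cone $CSC(X,x)$ and the Collapsed alternating cone $CAC(X,x)$ are the quotient spaces of $SC(X,x)$ and $AC(X,x)$, respectively, obtained by identifying each point $(a;b)\in\mathbb{I}^2$ with $(0;b)$, for all $a,b\in\mathbb{I}$. *)

(* Defs.v *)
From HB Require Import structures.
From mathcomp Require Import all_boot all_order all_algebra generic_quotient.
From mathcomp Require Import all_classical all_reals all_analysis.
From mathcomp Require Import lra.
From Stdlib Require Import Relation_Operators.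

Set Implicit Arguments.
Unset Strict Implicit.
Unset Printing Implicit Defensive.

Import Order.TTheory GRing.Theory Num.Theory numFieldNormedType.Exports.

Local Open Scope classical_set_scope.
Local Open Scope ring_scope.
Local Open Scope quotient_scope.

Section quotient_generated.
Variables (T : topologicalType) (r : T -> T -> Prop).

Let gen (a b : T) : bool := `[< clos_refl_sym_trans T r a b >].

Let gen_refl : reflexive gen.
Proof. by move=> a; apply/asboolP; exact: rst_refl. Qed.

Let gen_sym : symmetric gen.
Proof.
by move=> a b; apply/asboolP/asboolP => ab; exact: rst_sym.
Qed.

Let gen_trans : transitive gen.
Proof.
by move=> b a c /asboolP ab /asboolP bc; apply/asboolP; exact: rst_trans ab bc.
Qed.

Definition gen_equiv : equiv_rel T := EquivRel gen gen_refl gen_sym gen_trans.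

Definition quotient_space : topologicalType :=
  quotient_topology {eq_quot gen_equiv}.

Definition quotient_map (a : T) : quotient_space :=
  \pi_(quotient_topology {eq_quot gen_equiv}) a.

Lemma quotient_mapP (a b : T) :
  quotient_map a = quotient_map b <-> clos_refl_sym_trans T r a b.
Proof.
split => [/eqquotP/asboolP //|ab]; apply/eqquotP; exact/asboolP.
Qed.

End quotient_generated.

Section topological_sum.
Variables A B : topologicalType.

Definition topsum : topologicalType :=
  {b : bool & (if b then A else B : topologicalType)}.

Definition topinl (a : A) : topsum :=
  existT (fun b : bool => (if b then A else B : topologicalType) : Type) true a.

Definition topinr (b : B) : topsum :=
  existT (fun b : bool => (if b then A else B : topologicalType) : Type) false b.

End topological_sum.
Arguments topinl {A B} a.
Arguments topinr {A B} b.

Section plane.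
Variable R : realType.

Definition unit_square : set (R * R) := `[0, 1] `*` `[0, 1].

Definition segment (P Q : R * R) : set (R * R) :=
  [set (1 - t) *: P + t *: Q | t in `[0, 1]].

Definition Apt (n : nat) : R * R := (n%:R^-1, 0).
Definition Bpt (n : nat) : R * R := (n%:R^-1, 1).

Definition limit_segment : set (R * R) := segment (0, 0) (0, 1).

Definition sine_curve : set (R * R) :=
  limit_segment `|`
  \bigcup_(n in [set n | (0 < n)%N])
    (segment (Apt n) (Bpt n) `|` segment (Bpt n) (Apt n.+1)).

Lemma segment_sub_square (P Q : R * R) :
  unit_square P -> unit_square Q -> segment P Q `<=` unit_square.
Proof.
case: P Q => [p1 p2] [q1 q2] [/= + +] [/= + +] _ [t /= + <-].
rewrite /= !in_itv /= => /andP[? ?] /andP[? ?] /andP[? ?] /andP[? ?] /andP[? ?].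
split; rewrite /= in_itv /=; apply/andP; split; rewrite /GRing.scale /=; nra.
Qed.

Lemma sine_curve_sub_square : sine_curve `<=` unit_square.
Proof.
have inv01 n : (0 < n)%N -> `[0, 1]%classic (n%:R^-1 : R).
  move=> n0; rewrite /= in_itv /= invr_ge0 ler0n /= invf_le1 ?ltr0n //.
  by rewrite ler1n.
have z01 : `[0, 1]%classic (0 : R) by rewrite /= in_itv /= lexx ler01.
have o01 : `[0, 1]%classic (1 : R) by rewrite /= in_itv /= lexx ler01.
move=> z [|[n /= n0 []]]; apply: segment_sub_square; split => //; exact: inv01.
Qed.

End plane.
Arguments unit_square : clear implicits.
Arguments limit_segment : clear implicits.
Arguments sine_curve : clear implicits.

Section cones.
Variables (R : realType) (X : topologicalType) (x : X).

Let square : topologicalType := unit_square R.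
Let sine : topologicalType := sine_curve R.

(* By sine_curve_sub_square, every point t of the sine curve is equal, as a
   point of the plane, to exactly one point s of the square. *)
Variant SC_glue : topsum (X * sine)%type square ->
                  topsum (X * sine)%type square -> Prop :=
| SC_glue_base (t : sine) (s : square) :
    set_val t = set_val s -> ~ limit_segment R (set_val t) ->
    SC_glue (topinl (x, t)) (topinr s)
| SC_glue_fiber (y : X) (t : sine) (s : square) :
    set_val t = set_val s -> limit_segment R (set_val t) ->
    SC_glue (topinl (y, t)) (topinr s).

Definition snake_cone : topologicalType := quotient_space SC_glue.

Definition SC_square (s : square) : snake_cone :=
  quotient_map SC_glue (topinr s).

Definition AC_pre : set (X * (R * R)) :=
  [set p | [/\ unit_square R p.2
             & [\/ p.2.1 = 0,
                   exists2 n : nat, (0 < n)%N & p.2.1 = n%:R^-1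
                 | p.1 = x]]].

(* The fibres X * {c} that are collapsed to a point. *)
Definition AC_apex : set (R * R) :=
  [set c | [\/ c.1 = 0 /\ 0 <= c.2 <= 1,
               exists2 n : nat, (0 < n)%N & c = Apt R (2 * n - 1)
             | exists2 n : nat, (0 < n)%N & c = Bpt R (2 * n)]].

Definition AC_glue (p q : AC_pre) : Prop :=
  (set_val p).2 = (set_val q).2 /\ AC_apex (set_val p).2.

Definition alternating_cone : topologicalType := quotient_space AC_glue.

Lemma AC_square_subproof (s : square) : (x, set_val s) \in AC_pre.
Proof. by apply/mem_set; split; [exact: set_valP|exact: Or33]. Qed.

Definition AC_square (s : square) : alternating_cone :=
  quotient_map AC_glue (exist _ (x, set_val s) (AC_square_subproof s)).

Variant collapse (Z : topologicalType) (i : square -> Z) : Z -> Z -> Prop :=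
| Collapse (s s0 : square) :
    (set_val s0).1 = 0 -> (set_val s0).2 = (set_val s).2 ->
    collapse i (i s) (i s0).

Definition collapsed_snake_cone : topologicalType :=
  quotient_space (collapse SC_square).
Definition collapsed_alternating_cone : topologicalType :=
  quotient_space (collapse AC_square).

End cones.

(* Names for the four functors; only their action on objects is needed. *)
Variant cone_functor := SCf | ACf | CSCf | CACf.

Definition cone (R : realType) (F : cone_functor) :
    forall X : topologicalType, X -> topologicalType :=
  match F with
  | SCf => @snake_cone R
  | ACf => @alternating_cone R
  | CSCf => @collapsed_snake_cone R
  | CACf => @collapsed_alternating_cone R
  end.

Section homotopy.
Variable R : realType.

Definition path_connected (X : topologicalType) : Prop :=
  forall y z : X, exists gamma : R -> X,
    [/\ {within `[0, 1], continuous gamma}, gamma 0 = y & gamma 1 = z].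

Definition homotopic (A B : topologicalType) (f g : A -> B) : Prop :=
  exists H : A * R -> B,
    [/\ {within setT `*` `[0, 1], continuous H},
        forall a, H (a, 0) = f a
      & forall a, H (a, 1) = g a].

Definition homotopy_equivalent (A B : topologicalType) : Prop :=
  exists (f : A -> B) (g : B -> A),
    [/\ continuous f, continuous g,
        homotopic (g \o f) idfun & homotopic (f \o g) idfun].

End homotopy.

(* Main.v *)
Require Import Defs.
From mathcomp Require Import all_boot all_order all_algebra.
From mathcomp Require Import all_classical all_reals all_analysis.
From mathcomp Require Import ring lra zify.
From Stdlib Require Import Relation_Operators.

Set Implicit Arguments.
Unset Strict Implicit.
Unset Printing Implicit Defensive.

Import Order.TTheory GRing.Theory Num.Theory numFieldNormedType.Exports.

Local Open Scope classical_set_scope.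
Local Open Scope ring_scope.

(** The comb consists of a horizontal bar at height [1] and of vertical teeth
    below it, one over [0] and one over each [1/k]; its base point is the foot of
    the tooth over [0]. The comb is contractible, but a contraction has to move
    the base point: the feet of the other teeth converge to it, and they can
    leave their teeth only through the bar. The double comb is the union of the
    comb and of its reflection at the base point; here the base point cannot move
    at all, because the feet on either side would force it in opposite
    directions. A cone of [X] contains a square or an interval, the spine, to
    which the fibres are attached along the base point, so the difficulty can
    be circumvented where the spine offers enough room or where a fibre is
    collapsed to an apex.

    The first invariant is the property [sequences_contract]: every convergent
    sequence can be deformed, together with its limit, into a constant one. It
    passes from a space to the spaces that it dominates
    ([homotopy_equivalent_sequences]). Both alternating cones have it for all
    compact path-connected Hausdorff spaces ([AC_sequences], [CAC_sequences]):
    a sequence in a tube is pushed to the apex of the tube and then moved in the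
    spine. The snake cone of the comb has it as well ([SC_sequences]): contract
    the comb, drag the sequence back along the trace of the base point, and
    use the square.

    It fails in the collapsed snake cone of the comb ([csc_comb_sequences]).
    Consider the feet of the teeth, placed over the snake in such a way that each of
    its segments is visited infinitely often, and call the lower halves of the teeth
    in the fibres leaves. Terms of large index stay near the trace of the limit, hence
    near each other. Such a term can leave its leaf only through the middle of its
    tooth, far from the foot of the fibre over its position; a term in a leaf over
    a distant position cannot follow it there. So two terms over distant segments
    keep each other in their leaves. They can move along the snake, but each
    change of segment requires the height to run through [[0, 1]], and the height
    is uniformly close to that of the limit, which can do so only finitely often
    ([two_leaves_no_track]). Hence the two terms never meet. In the snake cone of
    the double comb the two terms may be chosen over the same segment on opposite
    sides of the base point ([sc_double_comb_sequences]).

    There remain the two alternating cones. That of the comb is contractible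
    ([AC_contractible]): near each tube the square can be squeezed onto the tube,
    and is then carried along by a contraction of the comb. The collapsed one is
    not ([CAC_not_contractible]). The odd tubes have their apices at height
    [0], the even ones at height [1]. As above, two leaves over two odd tubes
    remain leaves as long as the spine stays away from height [0], and two
    leaves over even tubes as long as it stays away from height [1]. For a
    contraction, consider the square of the pairs [(b, t)] of an initial height
    and a time. At each place one of the two states is locally constant, and the
    values on the boundary of the square make this impossible, by a parity
    argument on a fine grid ([grid_parity]). *)

(** * Continuity of explicit formulas *)

Section real_continuity.
Variables (R : realType).

Lemma cvg_maxr (T : Type) (F : set_system T) (FF : Filter F) (f g : T -> R) a b :
  f x @[x --> F] --> a -> g x @[x --> F] --> b ->
  Num.max (f x) (g x) @[x --> F] --> Num.max a b.
Proof.
move=> fa gb; apply: (@continuous2_cvg _ R R R F _ f g Num.max) => //.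
exact: (@max_continuous _ R (a, b)).
Qed.

Lemma cvg_minr (T : Type) (F : set_system T) (FF : Filter F) (f g : T -> R) a b :
  f x @[x --> F] --> a -> g x @[x --> F] --> b ->
  Num.min (f x) (g x) @[x --> F] --> Num.min a b.
Proof.
move=> fa gb; apply: (@continuous2_cvg _ R R R F _ f g Num.min) => //.
exact: (@min_continuous _ R (a, b)).
Qed.

Definition clamp (t : R) : R := Num.max 0 (Num.min 1 t).

Lemma clamp_ge0 t : 0 <= clamp t.
Proof. by rewrite /clamp le_max lexx. Qed.

Lemma clamp_le1 t : clamp t <= 1.
Proof. by rewrite /clamp ge_max ler01 ge_min lexx. Qed.

Lemma clamp_id t : 0 <= t <= 1 -> clamp t = t.
Proof. by move=> /andP[t0 t1]; rewrite /clamp (min_idPr t1) (max_idPr t0). Qed.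

Lemma clamp_le0 t : t <= 0 -> clamp t = 0.
Proof.
move=> t0; rewrite /clamp; apply/max_idPl; rewrite ge_min t0 orbT//.
Qed.

Lemma clamp_ge1 t : 1 <= t -> clamp t = 1.
Proof. by move=> t1; rewrite /clamp (min_idPl t1); apply/max_idPr/ler01. Qed.

Lemma cvg_clamp (T : Type) (F : set_system T) (FF : Filter F) (f : T -> R) a :
  f x @[x --> F] --> a -> clamp (f x) @[x --> F] --> clamp a.
Proof.
by move=> fa; apply: cvg_maxr; [exact: cvg_cst|apply: cvg_minr => //; exact: cvg_cst].
Qed.

End real_continuity.

Definition cont_at (T B : topologicalType) (f : T -> B) (x : T) : Prop :=
  f y @[y --> x] --> f x.

Section cont_at.
Variables (R : realType) (T : topologicalType).
Implicit Types (f g : T -> R) (x : T).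

Lemma cont_at_id x : cont_at (fun y => y) x.
Proof. exact: cvg_id. Qed.

Lemma cont_at_cst (B : topologicalType) (b : B) x : cont_at (fun=> b) x.
Proof. exact: cvg_cst. Qed.

Lemma cont_atD f g x : cont_at f x -> cont_at g x -> cont_at (fun y => f y + g y) x.
Proof. by move=> fx gx; apply: cvgD. Qed.

Lemma cont_atN f x : cont_at f x -> cont_at (fun y => - f y) x.
Proof. by move=> fx; apply: cvgN. Qed.

Lemma cont_atM f g x : cont_at f x -> cont_at g x -> cont_at (fun y => f y * g y) x.
Proof. by move=> fx gx; apply: cvgM. Qed.

Lemma cont_at_clamp f x : cont_at f x -> cont_at (fun y => clamp (f y)) x.
Proof. by move=> fx; apply: cvg_clamp. Qed.

Lemma cont_at_max f g x :
  cont_at f x -> cont_at g x -> cont_at (fun y => Num.max (f y) (g y)) x.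
Proof. by move=> fx gx; apply: cvg_maxr. Qed.

Lemma cont_at_min f g x :
  cont_at f x -> cont_at g x -> cont_at (fun y => Num.min (f y) (g y)) x.
Proof. by move=> fx gx; apply: cvg_minr. Qed.

Lemma cont_at_norm f x : cont_at f x -> cont_at (fun y => `|f y|) x.
Proof. by move=> fx; apply: cvg_norm. Qed.

Lemma cont_at_inv f x : f x != 0 -> cont_at f x -> cont_at (fun y => (f y)^-1) x.
Proof. by move=> fx0 fx; apply: cvgV. Qed.

Lemma cont_at_fst (B C : topologicalType) (f : T -> B * C) x :
  cont_at f x -> cont_at (fun y => (f y).1) x.
Proof. by move=> fx; apply: (cvg_comp _ _ fx); exact: cvg_fst. Qed.

Lemma cont_at_snd (B C : topologicalType) (f : T -> B * C) x :
  cont_at f x -> cont_at (fun y => (f y).2) x.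
Proof. by move=> fx; apply: (cvg_comp _ _ fx); exact: cvg_snd. Qed.

Lemma cont_at_pair (B C : topologicalType) (f : T -> B) (g : T -> C) x :
  cont_at f x -> cont_at g x -> cont_at (fun y => (f y, g y)) x.
Proof. by move=> fx gx; apply: cvg_pair. Qed.

Lemma cont_at_set_val (B : topologicalType) (A : set B) (f : T -> A) x :
  cont_at f x -> cont_at (fun y => set_val (f y)) x.
Proof. by move=> fx; apply: (cvg_comp _ _ fx); exact: initial_continuous. Qed.

Lemma cont_at_comp (B C : topologicalType) (f : T -> B) (g : B -> C) x :
  continuous g -> cont_at f x -> cont_at (fun y => g (f y)) x.
Proof. by move=> cg fx; apply: (cvg_comp _ _ fx); exact: cg. Qed.

Lemma cont_at_near (B : topologicalType) (f g : T -> B) x :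
  (\forall y \near x, g y = f y) -> cont_at f x -> cont_at g x.
Proof.
move=> fg fx; rewrite /cont_at (nbhs_singleton fg).
apply: cvg_trans fx; apply: near_eq_cvg.
by apply: filterS fg => y ->.
Qed.

Lemma continuousE (B : topologicalType) (f : T -> B) :
  (forall x, cont_at f x) -> continuous f.
Proof. by []. Qed.

End cont_at.

(** Structural descent through an expression; leaves the atoms it does not know. *)
Ltac ccont :=
  lazymatch goal with
  | H : continuous ?f |- continuous ?f => exact: H
  | |- continuous ?f => apply: (@continuousE _ _ f); let x := fresh "x" in move=> x; ccont
  | |- cont_at (fun y => y) _ => exact: cont_at_id
  | |- cont_at (fun=> ?a) _ => exact: cont_at_cst
  | H : cont_at ?f ?x |- cont_at ?f ?x => exact: H
  | H : cont_at ?f ?x |- cont_at (fun y => ?f y) ?x => exact: H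
  | |- cont_at (fun y => (@?f y, @?g y)) _ => apply: (@cont_at_pair _ _ _ f g); ccont
  | |- cont_at (fun y => (@?f y).1) _ => apply: (@cont_at_fst _ _ _ f); ccont
  | |- cont_at (fun y => (@?f y).2) _ => apply: (@cont_at_snd _ _ _ f); ccont
  | |- cont_at (fun y => @?f y + @?g y) _ => apply: (@cont_atD _ _ f g); ccont
  | |- cont_at (fun y => @?f y * @?g y) _ => apply: (@cont_atM _ _ f g); ccont
  | |- cont_at (fun y => - @?f y) _ => apply: (@cont_atN _ _ f); ccont
  | |- cont_at (fun y => clamp (@?f y)) _ => apply: (@cont_at_clamp _ _ f); ccont
  | |- cont_at (fun y => Num.max (@?f y) (@?g y)) _ => apply: (@cont_at_max _ _ f g); ccont
  | |- cont_at (fun y => Num.min (@?f y) (@?g y)) _ => apply: (@cont_at_min _ _ f g); ccont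
  | |- cont_at (fun y => `|@?f y|) _ => apply: (@cont_at_norm _ _ f); ccont
  | |- cont_at (fun y => set_val (@?f y)) _ => apply: (@cont_at_set_val _ _ _ f); ccont
  | H : continuous ?f |- cont_at ?f ?x => exact: (H x)
  | |- cont_at (fun y => ?g (@?f y)) _ => apply: (@cont_at_comp _ _ _ f g); [try assumption|ccont]
  | _ => idtac
  end.

(** * Maps out of a quotient space *)

Section quotients.
Variables (R : realType) (T : topologicalType) (r : T -> T -> Prop).

Lemma quotient_map_continuous : continuous (@quotient_map T r).
Proof. exact: pi_continuous. Qed.

Lemma quotient_map_surj (z : quotient_space r) : exists a, quotient_map r a = z.
Proof. by exists (repr z); rewrite /quotient_map reprK. Qed.

Lemma quotient_openP (O : set (quotient_space r)) :
  open (quotient_map r @^-1` O) -> open O.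
Proof. by []. Qed.

Lemma quotient_map_rel a b : r a b -> quotient_map r a = quotient_map r b.
Proof. by move=> rab; apply/quotient_mapP; exact: rst_step. Qed.

Lemma quotient_lift (B : Type) (f : T -> B) :
  (forall a b, r a b -> f a = f b) ->
  exists F : quotient_space r -> B, forall a, F (quotient_map r a) = f a.
Proof.
move=> fr; exists (f \o repr) => a /=.
have : quotient_map r (repr (quotient_map r a)) = quotient_map r a.
  by rewrite /quotient_map reprK.
move/quotient_mapP; move: (repr _) => b; by elim=> [x y /fr//|//|x y _ ->//|x y z _ -> _ ->].
Qed.

Lemma quotient_lift_continuous (B : topologicalType) (f : T -> B) :
  continuous f -> (forall a b, r a b -> f a = f b) ->
  exists2 F : quotient_space r -> B,
    continuous F & forall a, F (quotient_map r a) = f a.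
Proof.
move=> cf /quotient_lift[F Ff]; exists F => //.
apply/quotient_continuous.
by rewrite (_ : _ \o _ = f)//; apply/funext => a; exact: Ff.
Qed.

(** A product of a quotient map with the identity of a locally compact space is a
    quotient map; for the real line, closed intervals serve as compact
    neighbourhoods. *)
Lemma quotient_lift_homotopy (B : topologicalType) (f : T * R -> B) :
  continuous f -> (forall a b t, r a b -> f (a, t) = f (b, t)) ->
  exists2 F : quotient_space r * R -> B,
    continuous F & forall a t, F (quotient_map r a, t) = f (a, t).
Proof.
move=> cf fr.
have [G Gf] := @quotient_lift (R -> B) (fun a t => f (a, t))
  (fun a b rab => funext (fun t => fr a b t rab)).
exists (fun p => G p.1 p.2); last by move=> a t /=; rewrite Gf.
move=> [z0 t0] O /=; rewrite nbhsE => -[Q [oQ Q0] QO].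
apply: (@filterS _ _ _ ((fun p => G p.1 p.2) @^-1` Q)).
  by move=> p /= /QO.
have [a0 a0z] := quotient_map_surj z0.
have Qf : Q (f (a0, t0)) by rewrite -[f _]/((fun t => f (a0, t)) t0) -Gf a0z.
have /cf : nbhs (f (a0, t0)) Q by apply: open_nbhs_nbhs.
move=> -[[/= U V] [Ua Vt] UVO].
have [e /= e0 eV] : nbhs_ball t0 V by exact/nbhs_ballP.
pose N := `[t0 - e / 2, t0 + e / 2]%classic.
have NV : N `<=` V.
  move=> t; rewrite /N /= in_itv /= => /andP[t1 t2]; apply: eV.
  by rewrite /ball /= ltr_norml; lra.
have cN : compact N by exact: segment_compact.
pose W := [set z | forall t, N t -> Q (G z t)].
have oW : open W.
  apply: quotient_openP; rewrite openE => a aW.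
  have /compact_near_coveringP cN' := cN.
  apply: (cN' T (nbhs a) (fun a t => Q (G (quotient_map r a) t))) => t Nt.
  have /cf : nbhs (f (a, t)) Q.
    by apply: open_nbhs_nbhs; split => //; rewrite -[f _]/((fun t => f (a, t)) t) -Gf; exact: aW.
  move=> [[/= U1 V1] [U1a V1t] UV1]; exists (V1, U1) => //= -[t' a'] /= [V1t' U1a'].
  by rewrite Gf; apply: (UV1 (a', t')).
exists (W, N); last by move=> [z t] /= [Wz Nt]; exact: Wz.
split => /=.
  suff Wz : W z0 by exact: (open_nbhs_nbhs (conj oW Wz)).
  move=> t Nt; rewrite -a0z Gf; apply: (UVO (a0, t)).
  by split => /=; [exact: nbhs_singleton|exact: NV].
apply/nbhs_ballP; exists (e / 2); first by rewrite /= divr_gt0.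
by move=> t /=; rewrite /ball /= ltr_norml /N /= in_itv /=; lra.
Qed.

End quotients.

(** * Sequences that contract *)

Lemma within_continuous_comp_in (A B C : topologicalType) (D : set B)
    (f : A -> B) (g : B -> C) :
  continuous f -> (forall a, D (f a)) -> {within D, continuous g} ->
  continuous (g \o f).
Proof.
move=> cf fD /subspace_continuousP cg a.
apply: (@cvg_comp _ _ _ f g (nbhs a) (within D (nbhs (f a)))); last exact/cg/fD.
move=> U /cf; rewrite /nbhs /=; apply: filterS => a' /=; apply; exact: fD.
Qed.

Section fcvg.
Variables (R : realType).

(** Convergence of a family of maps towards [c], locally uniform in the
    parameter: the joint limit is what survives reparametrisation and pasting. *)
Definition fcvg (I : Type) (T Z : topologicalType) (F : set_system I)
    (f : I -> T -> Z) (c : T -> Z) : Prop :=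
  forall t, f p.1 p.2 @[p --> (F, nbhs t)] --> c t.

Lemma continuous_fcvg (T Z : topologicalType) (c : T -> Z) :
  continuous c <-> fcvg (globally [set tt]) (fun=> c) c.
Proof.
split=> [cc t|cc t].
  move=> U /cc Ut; exists ([set tt], c @^-1` U) => /=; first by split.
  by move=> [i x] /= [_].
move=> U /cc [[A V] /= [At Vt] AVU]; apply: filterS Vt => x Vx.
by apply: (AVU (tt, x)); split => //; exact: At.
Qed.

Lemma fcvg_comp (I : Type) (T T' Z : topologicalType) (F : set_system I)
    {FF : Filter F} (f : I -> T -> Z) c (g : T' -> T) :
  continuous g -> fcvg F f c -> fcvg F (fun i t => f i (g t)) (c \o g).
Proof.
move=> cg fc t U Ut; have [[A V] /= [FA Vt] AVU] := fc (g t) U Ut.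
exists (A, g @^-1` V) => /=; last by move=> [i s] /= [Ai Vs]; exact: (AVU (i, g s)).
by split => //; exact: cg.
Qed.

Lemma fcvg_map (I : Type) (T Z Z' : topologicalType) (F : set_system I)
    (f : I -> T -> Z) c (g : Z -> Z') :
  continuous g -> fcvg F f c -> fcvg F (fun i t => g (f i t)) (g \o c).
Proof. by move=> cg fc t; apply: cvg_comp (fc t) _; exact: cg. Qed.

(** With a filter in place of a point, this covers the pasting of homotopies as
    well as that of convergent families of paths. *)
Lemma fcvg_paste (I : Type) (Z : topologicalType) (F : set_system I)
    {FF : Filter F} (f g : I -> R -> Z) c d s :
  fcvg F f c -> fcvg F g d -> c s = d s ->
  fcvg F (fun i t => if t <= s then f i t else g i t)
         (fun t => if t <= s then c t else d t).
Proof.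
move=> fc gd cds t U; case: ltgtP => [ts|st|->{t}] Ut.
- have [[A V] /= [FA Vt] AVU] := fc t U Ut.
  exists (A, V `&` [set x | x < s]) => /=.
    by split => //; apply: filterI => //; exact: lt_nbhsl.
  by move=> [i x] /= [Ai [Vx xs]]; rewrite (ltW xs); exact: (AVU (i, x)).
- have [[A V] /= [FA Vt] AVU] := gd t U Ut.
  exists (A, V `&` [set x | s < x]) => /=.
    by split => //; apply: filterI => //; exact: lt_nbhsr.
  by move=> [i x] /= [Ai [Vx xs]]; rewrite leNgt xs /=; exact: (AVU (i, x)).
- have [[A V] /= [FA Vt] AVU] := fc s U Ut.
  rewrite cds in Ut.
  have [[A' V'] /= [FA' Vt'] AVU'] := gd s U Ut.
  exists (A `&` A', V `&` V') => /=; first by split; exact: filterI.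
  move=> [i x] /= [[Ai Ai'] [Vx Vx']]; case: ifP => _.
    exact: (AVU (i, x)).
  exact: (AVU' (i, x)).
Qed.

Lemma continuous_paste (Z : topologicalType) (f g : R -> Z) s :
  continuous f -> continuous g -> f s = g s ->
  continuous (fun t => if t <= s then f t else g t).
Proof.
move=> /continuous_fcvg cf /continuous_fcvg cg fgs; apply/continuous_fcvg.
exact: fcvg_paste.
Qed.

Lemma fcvg_unif (I : Type) (T : topologicalType) (F : set_system I)
    {FF : Filter F} (f : I -> T -> R) c (K : set T) e :
  fcvg F f c -> continuous c -> compact K -> 0 < e ->
  \forall i \near F, forall t, K t -> `|f i t - c t| < e.
Proof.
move=> fc cc /compact_near_coveringP cK e0.
apply: (cK I F (fun i t => `|f i t - c t| < e)) => t Kt.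
have e20 : 0 < e / 2 by rewrite divr_gt0.
have /= := fc t _ (nbhsx_ballx _ _ e20).
move=> [[A V] /= [FA Vt] AVU].
have cV : nbhs t (c @^-1` ball (c t) (e / 2)) by apply: cc; exact: nbhsx_ballx.
exists (V `&` c @^-1` ball (c t) (e / 2), A) => /=; first by split => //; exact: filterI.
move=> [t' i] /= [[Vt' ct'] Ai].
have := AVU (i, t') (conj Ai Vt'); rewrite /= /ball /= => h1.
move: ct'; rewrite /ball /= => h2.
rewrite (_ : f i t' - c t' = - (c t - f i t') + (c t - c t')); last by ring.
by rewrite (le_lt_trans (ler_normD _ _))// normrN [e]splitr ltrD.
Qed.

End fcvg.

Section homotopy.
Variable R : realType.

Lemma homotopic_clamp (A B : topologicalType) (f g : A -> B) :
  homotopic R f g ->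
  exists H : A * R -> B, [/\ continuous H,
    forall a, H (a, 0) = f a & forall a, H (a, 1) = g a].
Proof.
move=> [H [cH H0 H1]].
exists (H \o (fun p : A * R => (p.1, clamp p.2))); split.
- apply: within_continuous_comp_in cH; first by ccont.
  by move=> [a t]; split => //=; rewrite in_itv /= clamp_ge0 clamp_le1.
- by move=> a /=; rewrite clamp_le0.
- by move=> a /=; rewrite clamp_ge1.
Qed.

Lemma path_clamp (X : topologicalType) (x y : X) :
  path_connected R X ->
  exists2 g : R -> X, continuous g & g 0 = x /\ g 1 = y.
Proof.
move=> /(_ x y)[g [cg g0 g1]]; exists (g \o (fun t => clamp t)).
  apply: within_continuous_comp_in cg; first by ccont.
  by move=> t; rewrite /= in_itv /= clamp_ge0 clamp_le1.
by rewrite /= clamp_le0// clamp_ge1.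
Qed.

Lemma star_path_connected (X : topologicalType) (x : X) :
  (forall y, exists2 g : R -> X, continuous g & g 0 = y /\ g 1 = x) ->
  path_connected R X.
Proof.
move=> px y z; have [g cg [g0 g1]] := px y; have [h ch [h0 h1]] := px z.
exists (fun t => if t <= 1 / 2 then g (2 * t) else h (2 - 2 * t)); split.
- apply: continuous_subspaceT; apply: continuous_paste.
  + by ccont.
  + by ccont.
  + by rewrite (_ : 2 * _ = 1) ?g1; [rewrite (_ : 2 - 1 = 1)// ?h1//; ring|field].
- by rewrite ifT ?mulr0//; lra.
- by rewrite ifF ?mulr1 ?subrr//; lra.
Qed.

Lemma homotopy_equivalent_sym (A B : topologicalType) :
  homotopy_equivalent R A B -> homotopy_equivalent R B A.
Proof. by move=> [f [g [cf cg fg gf]]]; exists g, f; split. Qed.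

End homotopy.

Section tracks.
Variable R : realType.

(** Deformation of a convergent sequence [z --> z0] to another one [w --> w0]:
    a homotopy of maps from the one-point compactification of the natural
    numbers, where finitely many terms are disregarded. *)
Definition track (Z : topologicalType) (z : nat -> Z) z0 (w : nat -> Z) w0 : Prop :=
  exists (f : nat -> R -> Z) (c : R -> Z),
  [/\ \forall k \near \oo, [/\ continuous (f k), f k 0 = z k & f k 1 = w k],
      continuous c, c 0 = z0, c 1 = w0 & fcvg \oo f c].

(** Homotopy invariant that separates most of the cones. *)
Definition sequences_contract (Z : topologicalType) : Prop :=
  forall (z : nat -> Z) z0, z k @[k --> \oo] --> z0 ->
  exists w0, track z z0 (fun=> w0) w0.

Lemma track_trans (Z : topologicalType) (z w v : nat -> Z) z0 w0 v0 :
  track z z0 w w0 -> track w w0 v v0 -> track z z0 v v0.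
Proof.
move=> [f [c [fzw cc c0 c1 fc]]] [g [d [gwv cd d0 d1 gd]]].
exists (fun k t => if t <= 1 / 2 then f k (2 * t) else g k (2 * t - 1)).
exists (fun t => if t <= 1 / 2 then c (2 * t) else d (2 * t - 1)).
have e1 : 2 * (1 / 2) = 1 :> R by field.
have e2 : 2 * (1 / 2) - 1 = 0 :> R by field.
have e3 : 2 * 1 - 1 = 1 :> R by ring.
have r0 : (0 <= 1 / 2 :> R) = true by lra.
have r1 : (1 <= 1 / 2 :> R) = false by lra.
split.
- apply: filterS2 fzw gwv => k [fk1 fk2 fk3] [gk1 gk2 gk3].
  rewrite r0 r1 mulr0 e3 fk2 gk3; split => //.
  apply: continuous_paste; [by ccont|by ccont|].
  by rewrite e2 e1 fk3 gk2.
- apply: continuous_paste; [by ccont|by ccont|].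
  by rewrite e2 e1 c1 d0.
- by rewrite r0 mulr0.
- by rewrite r1 e3.
- apply: (@fcvg_paste _ _ _ _ _ _ _ (fun t => c (2 * t)) (fun t => d (2 * t - 1))).
  + by apply: (@fcvg_comp _ _ R _ _ _ _ _ (fun t => 2 * t)) fc; ccont.
  + by apply: (@fcvg_comp _ _ R _ _ _ _ _ (fun t => 2 * t - 1)) gd; ccont.
  + by rewrite e2 e1 c1 d0.
Qed.

Lemma track_eq (Z : topologicalType) (z z' w w' : nat -> Z) z0 w0 :
  (\forall k \near \oo, z k = z' k) -> (\forall k \near \oo, w k = w' k) ->
  track z z0 w w0 -> track z' z0 w' w0.
Proof.
move=> zz' ww' [f [c [fzw cc c0 c1 fc]]]; exists f, c; split => //.
near=> k.
have <- : z k = z' k by near: k.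
have <- : w k = w' k by near: k.
by near: k.
Unshelve. all: by end_near. Qed.

Lemma track_map (Z Z' : topologicalType) (g : Z -> Z') (z w : nat -> Z) z0 w0 :
  continuous g -> track z z0 w w0 -> track (g \o z) (g z0) (g \o w) (g w0).
Proof.
move=> cg [f [c [fzw cc c0 c1 fc]]]; exists (fun k t => g (f k t)), (g \o c).
split; last exact: fcvg_map; last 2 first.
- by rewrite /= c0.
- by rewrite /= c1.
- apply: filterS fzw => k [ck k0 k1]; split; last 2 first.
  + by rewrite k0.
  + by rewrite k1.
  + by ccont.
- by apply: continuousE => x; apply: cont_at_comp cg _; exact: cc.
Qed.

Lemma fcvg_flow (A Z : topologicalType) (H : A * R -> Z) (a : nat -> A) a0 :
  continuous H -> a k @[k --> \oo] --> a0 ->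
  fcvg \oo (fun k t => H (a k, t)) (fun t => H (a0, t)).
Proof.
move=> cH aa0 t U /cH [[V W] /= [Va Wt] VWU].
exists (a @^-1` V, W) => /=; first by split => //; exact: aa0.
by move=> [k s] /= [Vk Ws]; exact: (VWU (a k, s)).
Qed.

Lemma track_flow (A Z : topologicalType) (H : A * R -> Z) (a : nat -> A) a0 :
  continuous H -> a k @[k --> \oo] --> a0 ->
  track (fun k => H (a k, 0)) (H (a0, 0)) (fun k => H (a k, 1)) (H (a0, 1)).
Proof.
move=> cH aa0; exists (fun k t => H (a k, t)), (fun t => H (a0, t)).
have cHx b : continuous (fun t => H (b, t)) by ccont.
split => //; last exact: fcvg_flow.
by apply: nearW.
Qed.

(** Two families of indices may be moved by different recipes, provided the
    limit point runs through the same path. *)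
Lemma fcvg_if (Z : topologicalType) (b : nat -> bool) (f g : nat -> R -> Z) c :
  fcvg \oo f c -> fcvg \oo g c -> fcvg \oo (fun k => if b k then f k else g k) c.
Proof.
move=> fc gc t U Ut.
have [[A V] /= [FA Vt] AVU] := fc t U Ut.
have [[A' V'] /= [FA' Vt'] AVU'] := gc t U Ut.
exists (A `&` A', V `&` V') => /=; first by split; exact: filterI.
move=> [i x] /= [[Ai Ai'] [Vx Vx']]; case: ifP => _.
  exact: (AVU (i, x)).
exact: (AVU' (i, x)).
Qed.

Lemma track_cvg (Z : topologicalType) (z w : nat -> Z) z0 w0 :
  track z z0 w w0 -> w k @[k --> \oo] --> w0.
Proof.
move=> [f [c [fzw cc c0 c1 fc]]] U.
rewrite -c1 => /fc [[A V] /= [FA Vt] AVU].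
suff : \forall k \near \oo, U (w k) by [].
apply: filterS2 fzw FA => k [_ _ <-] Ak; apply: (AVU (k, 1)); split => //=.
exact: nbhs_singleton.
Qed.

(** The image of the deformation in the dominating space, preceded by the
    homotopy from the identity. *)
Lemma sequences_contract_dominated (A B : topologicalType) (f : A -> B) (g : B -> A) :
  continuous f -> continuous g -> homotopic R (g \o f) idfun ->
  sequences_contract B -> sequences_contract A.
Proof.
move=> cf cg /homotopic_clamp[H [cH H0 H1]] cB z z0 zz0.
have [w0 tw] := cB (f \o z) (f z0) (cvg_comp _ _ zz0 (cf z0)).
exists (g w0); apply: track_trans (track_map cg tw).
have cH' : continuous (fun p : A * R => H (p.1, 1 - p.2)) by ccont.
have := track_flow cH' zz0.
rewrite /= subr0 subrr H0 H1; apply: track_eq; apply: nearW => k /=.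
  by rewrite H1.
by rewrite H0.
Qed.

Lemma homotopy_equivalent_sequences (A B : topologicalType) :
  homotopy_equivalent R A B -> sequences_contract B -> sequences_contract A.
Proof. by move=> [f [g [cf cg gf _]]]; exact: sequences_contract_dominated gf. Qed.

End tracks.

(** * The comb and the double comb *)

Section subtypes.

Lemma nbhs_set_val (T : topologicalType) (A : set T) (a : A) (V : set T) :
  nbhs (set_val a) V -> nbhs a (set_val @^-1` V).
Proof. exact: initial_continuous. Qed.

Lemma nbhs_subtypeP (T : topologicalType) (A : set T) (a : A) (U : set A) :
  nbhs a U -> exists2 V, nbhs (set_val a) V & set_val @^-1` V `<=` U.
Proof.
move=> [_ [[V oV <-] Va VU]]; exists V => //.
exact: open_nbhs_nbhs.
Qed.

Lemma cvg_subtype (I : Type) (T : topologicalType) (A : set T) (F : set_system I)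
    {FF : Filter F} (f : I -> A) (a : A) :
  set_val (f x) @[x --> F] --> set_val a -> f x @[x --> F] --> a.
Proof.
move=> fa U /nbhs_subtypeP[V Va VU].
suff : F (f @^-1` U) by [].
apply: (@filterS _ F _ (fun x => V (set_val (f x)))); last exact: fa.
by move=> x; exact: VU.
Qed.

Lemma compact_subtype (T : topologicalType) (A : set T) :
  compact A -> compact [set: A].
Proof.
move=> /compact_near_coveringP cA; apply/compact_near_coveringP.
move=> I F P FF cover.
have : \near F, A `<=` (fun i t => forall a : A, set_val a = t -> P i a) F.
  apply: cA => t At.
  have [[/= U G] [Ua FG] UGP] := cover (exist _ t (mem_set At)) Logic.I.
  have [V Vt VU] := nbhs_subtypeP Ua.
  exists (V, G) => //= -[t' i] /= [Vt' Gi] a ata.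
  by apply: (UGP (a, i)); split => //; apply: VU; rewrite /= ata.
by apply: filterS => i Ai a _; apply: (Ai (set_val a)) => //; exact: set_valP.
Qed.

Lemma hausdorff_subtype (T : topologicalType) (A : set T) :
  hausdorff_space T -> hausdorff_space A.
Proof.
move=> hT a b ab; apply: val_inj; apply: hT => U V Ua Vb.
have [c [Uc Vc]] := ab _ _ (nbhs_set_val Ua) (nbhs_set_val Vb).
by exists (set_val c).
Qed.

End subtypes.

Section combs.
Variable R : realType.

(** The closed set [{0} `|` {1/k | k > 0}] seen from its gaps; this form is
    stable under limits and yields at once that a tooth is isolated. *)
Definition teeth (p : R) : Prop :=
  forall n : nat, n.+1%:R * p <= 1 \/ 1 <= n%:R * p.

Definition comb_set : set (R * R) :=
  [set z | [/\ 0 <= z.1 <= 1, 0 <= z.2 <= 1 & z.2 = 1 \/ teeth z.1]].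

Definition double_comb_set : set (R * R) :=
  comb_set `|` [set z | comb_set (- z.1, - z.2)].

Definition comb : topologicalType := comb_set.
Definition double_comb : topologicalType := double_comb_set.

Lemma teeth0 : teeth 0.
Proof. by move=> n; left; rewrite mulr0 ler01. Qed.

Lemma teethV n : teeth n.+1%:R^-1.
Proof.
move=> m; have [mn|nm] := leqP m n; [left|right].
  by rewrite ler_pdivrMr ?ltr0n// mul1r ler_nat.
by rewrite ler_pdivlMr ?ltr0n// mul1r ler_nat.
Qed.

Lemma comb_origin : comb_set (0, 0).
Proof. by split; rewrite ?lexx ?ler01//; right; exact: teeth0. Qed.

Lemma closed_le_cont (T : topologicalType) (f g : T -> R) :
  continuous f -> continuous g -> closed [set z | f z <= g z].
Proof.
move=> cf cg.
rewrite (_ : [set _ | _] = (fun z => g z - f z) @^-1` [set x | 0 <= x]).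
  apply: preimage_closed; last exact: closed_ge.
  by move=> z _; apply: cvgB; [exact: cg|exact: cf].
by apply/seteqP; split => z /=; rewrite subr_ge0.
Qed.

Lemma open_lt_cont (T : topologicalType) (f g : T -> R) :
  continuous f -> continuous g -> open [set z | f z < g z].
Proof.
move=> cf cg; rewrite -[X in open X]setCK openC.
rewrite (_ : ~` _ = [set z | g z <= f z]); first exact: closed_le_cont.
by apply/seteqP; split => z /=; rewrite leNgt => /negP.
Qed.

Lemma closed_comb : closed comb_set.
Proof.
have c1 : continuous (fun z : R * R => z.1) by ccont.
have c2 : continuous (fun z : R * R => z.2) by ccont.
rewrite (_ : comb_set = [set z | 0 <= z.1] `&` [set z | z.1 <= 1] `&`
  ([set z | 0 <= z.2] `&` [set z | z.2 <= 1]) `&` ([set z | 1 <= z.2] `|`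
  \bigcap_(n in [set: nat]) ([set z | n.+1%:R * z.1 <= 1] `|` [set z | 1 <= n%:R * z.1]))).
  apply: closedI; first by apply: closedI; apply: closedI; apply: closed_le_cont => //; ccont.
  apply: closedU; first by apply: closed_le_cont => //; ccont.
  by apply: closed_bigI => n _; apply: closedU; apply: closed_le_cont; ccont.
apply/seteqP; split => z.
  move=> [/andP[? ?] /andP[? ?] z1]; split; first by [].
  case: z1 => [z21|tz]; first by left; rewrite /= z21.
  by right => n _; exact: tz.
move=> [[[/= a b] [/= c d]] z1]; split; rewrite ?a ?c//.
case: z1 => /= [z1|z1]; [left|right => n; exact: z1].
by apply/eqP; rewrite eq_le d.
Qed.

Lemma compact_comb : compact [set: comb].
Proof.
apply: compact_subtype; apply: subclosed_compact closed_comb _ _.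
  exact: compact_setX (@segment_compact R 0 1) (@segment_compact R 0 1).
by move=> z [a b _]; split; rewrite /= in_itv.
Qed.

Lemma hausdorff_comb : hausdorff_space comb.
Proof. apply: hausdorff_subtype; exact: norm_hausdorff. Qed.

Lemma compact_double_comb : compact [set: double_comb].
Proof.
apply: compact_subtype.
have -> : double_comb_set = double_comb_set `&` (`[-1, 1] `*` `[-1, 1]).
  apply/seteqP; split => [z cz|z []//]; split => //.
  case: cz => -[/= /andP[a b] /andP[c d] _]; split; rewrite /= in_itv /=; lra.
apply: subclosed_compact (@subIsetr _ _ _); last first.
  exact: compact_setX (@segment_compact R (-1) 1) (@segment_compact R (-1) 1).
apply: closedI; last first.
  by apply: compact_closed; [exact: norm_hausdorff|apply: compact_setX; exact: segment_compact].
apply: closedU; first exact: closed_comb.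
apply: (@preimage_closed _ _ (fun z : R * R => (- z.1, - z.2))); last exact: closed_comb.
by move=> z _; suff : continuous (fun z : R * R => (- z.1, - z.2)) by []; ccont.
Qed.

Lemma hausdorff_double_comb : hausdorff_space double_comb.
Proof. apply: hausdorff_subtype; exact: norm_hausdorff. Qed.

(** Up the tooth, along the bar and down the limit tooth. *)
Definition comb_path (z : R * R) (t : R) : R * R :=
  (z.1 * clamp (2 - 3 * t), clamp (Num.min (z.2 + 3 * clamp t) (3 - 3 * t))).

Lemma comb_path_in z t : comb_set z -> comb_set (comb_path z t).
Proof.
move=> [/andP[a b] /andP[c d] zc]; split => /=.
- by rewrite mulr_ge0 ?clamp_ge0//= mulr_ile1 ?clamp_ge0 ?clamp_le1.
- by rewrite clamp_ge0 clamp_le1.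
- have [t1|t1] := lerP t (1 / 3).
    rewrite (clamp_ge1 (_ : 1 <= 2 - 3 * t)) ?mulr1; last lra.
    case: zc => [->|]; [left|by right].
    apply: clamp_ge1; rewrite le_min; have := clamp_ge0 t; lra.
  have [t2|t2] := lerP t (2 / 3).
    left; rewrite (@clamp_id _ t); last lra.
    apply: clamp_ge1; rewrite le_min; lra.
  by right; rewrite clamp_le0 ?mulr0; [exact: teeth0|lra].
Qed.

Lemma comb_path0 z : comb_set z -> comb_path z 0 = z.
Proof.
move=> [/andP[a b] /andP[c d] zc]; rewrite /comb_path.
rewrite clamp_ge1; last lra.
rewrite (clamp_le0 (lexx 0)) !mulr0 mulr1 subr0 addr0 min_l; last lra.
by rewrite clamp_id ?c//; case: z {a b c d zc}.
Qed.

Lemma comb_path1 z : comb_path z 1 = (0, 0).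
Proof.
rewrite /comb_path clamp_le0; last lra.
rewrite mulr0 clamp_le0// ge_min; apply/orP; right; lra.
Qed.

Lemma comb_path_continuous z : continuous (comb_path z).
Proof. by rewrite /comb_path; ccont. Qed.

End combs.

(** * Functions on the snake cones *)

Section snake_lift.
Variables (R : realType) (X : topologicalType) (x : X).

Definition sineT : topologicalType := sine_curve R.
Definition squareT : topologicalType := unit_square R.

Definition sc_tube (y : X) (t : sineT) : snake_cone R x :=
  quotient_map (@SC_glue R X x) (topinl (y, t)).

Definition sc_square (s : squareT) : snake_cone R x := SC_square x s.

Lemma sc_cases (z : snake_cone R x) :
  (exists y t, z = sc_tube y t) \/ (exists s, z = sc_square s).
Proof.
have [[[|] p] <-] := quotient_map_surj z; last by right; exists p.
by left; case: p => y t; exists y, t.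
Qed.

Lemma limit_segmentP (t : R * R) :
  limit_segment R t <-> t.1 = 0 /\ 0 <= t.2 <= 1.
Proof.
split.
  by move=> [u /=]; rewrite in_itv /= => u01 <- /=; rewrite /GRing.scale /= !mulr0 mulr1 !add0r.
case: t => a b /= [-> b01]; exists b => /=; first by rewrite in_itv.
by congr (_, _); rewrite /= /GRing.scale /= !mulr0 ?mulr1 ?add0r.
Qed.

Lemma square_snd (s : R * R) : unit_square R s -> 0 <= s.1 <= 1 /\ 0 <= s.2 <= 1.
Proof. by move=> [/=]; rewrite !in_itv. Qed.

Lemma sine_square (t : sineT) : unit_square R (set_val t).
Proof. by apply: sine_curve_sub_square; exact: set_valP. Qed.

Definition sine_to_square (t : sineT) : squareT :=
  exist _ (set_val t) (mem_set (sine_square t)).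

Lemma sc_tube_base (t : sineT) : sc_tube x t = sc_square (sine_to_square t).
Proof.
apply: quotient_map_rel.
by have [tL|tL] := pselect (limit_segment R (set_val t)); constructor.
Qed.

Lemma sc_tube_limit (y : X) (t : sineT) :
  limit_segment R (set_val t) -> sc_tube y t = sc_square (sine_to_square t).
Proof. by move=> tL; apply: quotient_map_rel; constructor. Qed.

Lemma sc_tube_continuous : continuous (fun p : X * sineT => sc_tube p.1 p.2).
Proof.
rewrite (_ : (fun _ => _) = quotient_map (@SC_glue R X x) \o @topinl (X * sineT)%type squareT).
  move=> p; apply: continuous_comp; last exact: quotient_map_continuous.
  exact: (@existT_continuous bool
    (fun b : bool => if b then ((X * sineT)%type : topologicalType) else squareT) true).
by apply/funext => -[].
Qed.

Lemma sc_square_continuous : continuous sc_square.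
Proof.
move=> s; apply: (@continuous_comp _ _ _ (@topinr (X * sineT)%type squareT)
  (quotient_map (@SC_glue R X x))); last exact: quotient_map_continuous.
exact: (@existT_continuous bool
  (fun b : bool => if b then ((X * sineT)%type : topologicalType) else squareT) false).
Qed.

Lemma SC_lift (B : topologicalType) (g : X * (R * R) -> B) :
  continuous g -> (forall y b, g (y, (0, b)) = g (x, (0, b))) ->
  exists2 G : snake_cone R x -> B, continuous G &
    (forall y t, G (sc_tube y t) = g (y, set_val t)) /\
    (forall s, G (sc_square s) = g (x, set_val s)).
Proof.
move=> cg g0.
pose f (b : bool) : (if b then ((X * sineT)%type : topologicalType) else squareT) -> B :=
  match b return (if b then ((X * sineT)%type : topologicalType) else squareT) -> B with
  | true => fun p => g (p.1, set_val p.2) | false => fun s => g (x, set_val s) end.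
have [||G cG GE] := @quotient_lift_continuous _ (@SC_glue R X x) B (fun a => f (projT1 a) (projT2 a)).
- by apply: (@sigT_continuous _ _ _ f) => -[] /=; ccont.
- move=> a b [t s /= -> //|y t s /= ts /limit_segmentP[t1 _]] /=.
  by rewrite -ts [set_val t]surjective_pairing t1 g0.
exists G => //; split => [y t|s].
  exact: (GE (topinl (y, t))).
exact: (GE (topinr s)).
Qed.

Definition csc_tube (y : X) (t : sineT) : collapsed_snake_cone R x :=
  quotient_map (collapse (@SC_square R X x)) (sc_tube y t).

Definition csc_square (s : squareT) : collapsed_snake_cone R x :=
  quotient_map (collapse (@SC_square R X x)) (sc_square s).

Lemma csc_cases (z : collapsed_snake_cone R x) :
  (exists y t, z = csc_tube y t) \/ (exists s, z = csc_square s).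
Proof.
have [w <-] := quotient_map_surj z.
by have [[y [t ->]]|[s ->]] := sc_cases w; [left; exists y, t|right; exists s].
Qed.

Lemma CSC_lift (B : topologicalType) (g : X * (R * R) -> B) :
  continuous g -> (forall y b, g (y, (0, b)) = g (x, (0, b))) ->
  (forall a b, g (x, (a, b)) = g (x, (0, b))) ->
  exists2 G : collapsed_snake_cone R x -> B, continuous G &
    (forall y t, G (csc_tube y t) = g (y, set_val t)) /\
    (forall s, G (csc_square s) = g (x, set_val s)).
Proof.
move=> cg g0 g1; have [G cG [Gt Gs]] := SC_lift cg g0.
have [|F cF FE] := @quotient_lift_continuous _ (collapse (@SC_square R X x)) B G cG.
  move=> _ _ [s s0 s00 s02]; rewrite !Gs [set_val s]surjective_pairing.
  by rewrite [set_val s0]surjective_pairing s00 s02 g1.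
by exists F => //; split => [y t|s]; rewrite FE.
Qed.

Lemma csc_height : exists2 h : collapsed_snake_cone R x -> R, continuous h &
  (forall y t, h (csc_tube y t) = (set_val t).2) /\
  (forall s, h (csc_square s) = (set_val s).2).
Proof. by have := @CSC_lift R (fun p => p.2.2); apply => //; ccont. Qed.

(** The products vanish on the spine, so that the collapse of the square is no
    obstruction: these functions see the fibres and the position at once. *)
Lemma csc_weighted (phi : R -> R) (f : X -> R) :
  continuous phi -> continuous f -> phi 0 = 0 -> f x = 0 ->
  exists2 G : collapsed_snake_cone R x -> R, continuous G &
  (forall y t, G (csc_tube y t) = phi (set_val t).1 * f y) /\
  (forall s, G (csc_square s) = 0).
Proof.
move=> cphi cf phi0 fx.
have cg : continuous (fun p : X * (R * R) => phi p.2.1 * f p.1).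
  by ccont.
have [|a b /=|G cG [G1 G2]] := CSC_lift cg; last 1 first.
- by exists G => //; split => // s; rewrite G2 fx mulr0.
- by move=> y b /=; rewrite phi0 !mul0r.
- by rewrite fx !mulr0.
Qed.

End snake_lift.

Section sine_gaps.
Variable R : realType.
Implicit Types (t : R * R) (n : nat).

Lemma sine_curveP t : sine_curve R t ->
  [/\ 0 <= t.2 <= 1 & t.1 = 0 \/ exists2 m, (0 < m)%N &
     t.1 = m%:R^-1 \/ t.1 = t.2 / m%:R + (1 - t.2) / m.+1%:R].
Proof.
have sc (u v : R) : u *: (v : R^o) = u * v by [].
move=> [/limit_segmentP[-> ->]|[m /= m0 [|]]]; first by split => //; left.
- move=> [u /=]; rewrite in_itv /= => /andP[u0 u1] <-.
  rewrite /GRing.scale /= !sc !mulr0 !mulr1 add0r; split; first by rewrite u0.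
  by right; exists m => //; left; ring.
- move=> [u /=]; rewrite in_itv /= => /andP[u0 u1] <-.
  rewrite /GRing.scale /= !sc !mulr0 !mulr1 addr0; split; first lra.
  by right; exists m => //; right; ring.
Qed.

Let natV_le m n : (0 < m)%N -> (m <= n)%N -> n%:R^-1 <= m%:R^-1 :> R.
Proof.
by move=> m0 mn; rewrite lef_pV2 ?posrE ?ltr0n// ?ler_nat//; exact: leq_trans mn.
Qed.

Let natV_ge1 m n : (0 < m)%N -> (m <= n)%N -> 1 <= n%:R * m%:R^-1 :> R.
Proof. by move=> m0 mn; rewrite ler_pdivlMr ?ltr0n// mul1r ler_nat. Qed.

Let natV_le1 m n : (0 < m)%N -> (n <= m)%N -> n%:R * m%:R^-1 <= 1 :> R.
Proof. by move=> m0 mn; rewrite ler_pdivrMr ?ltr0n// mul1r ler_nat. Qed.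

Let segE (n m m' b : R) : n * (b / m + (1 - b) / m') = b * (n / m) + (1 - b) * (n / m').
Proof. by rewrite mulrDr !mulrA ![n * _]mulrC. Qed.

Let cvx_le (b P Q c d : R) : 0 <= b -> b <= 1 -> P <= c -> Q <= d ->
  b * P + (1 - b) * Q <= b * c + (1 - b) * d.
Proof. by move=> *; nra. Qed.

(** The segment on the left of [1/n] reaches the abscissa [1/n] at height [1] only. *)
Lemma sine_gap_low t n : sine_curve R t -> n%:R * t.1 < 1 ->
  n%:R * t.1 <= 1 - (1 - t.2) / n.+1%:R.
Proof.
move=> /sine_curveP[]; case: t => a b /= /andP[b0 b1] ab na.
have [q qE] : exists q : R, q = n.+1%:R^-1 by eexists.
have q0 : 0 < q by rewrite qE invr_gt0 ltr0n.
have q1 : q <= 1 by rewrite qE invf_le1 ?ltr0n// ler1n.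
have qn : n%:R * q = 1 - q.
  have : n.+1%:R * q = 1 by rewrite qE mulfV// pnatr_eq0.
  rewrite -natr1 mulrDl mul1r; lra.
rewrite -qE; have bq : (1 - b) * q <= 1.
  by apply: mulr_ile1 => //; lra.
case: ab na => [->|[m m0 ab]] na; first by rewrite mulr0; lra.
have nm : (n <= m)%N.
  rewrite leqNgt; apply/negP => mn.
  have := natV_ge1 (ltn0Sn m) mn; have := natV_ge1 m0 (ltnW mn).
  case: ab na => ->; first lra.
  rewrite segE; move: (n%:R / _) (n%:R / _) => P Q h1 h2 h3.
  by have := cvx_le b0 b1 h2 h3; lra.
have : n%:R * m.+1%:R^-1 <= n%:R * q.
  by rewrite qE ler_wpM2l ?ler0n// natV_le.
rewrite qn; case: ab na => -> na.
  move=> _; have [nm'|mn] := ltnP n m; last by have := natV_ge1 m0 mn; lra.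
  have : n%:R * m%:R^-1 <= n%:R * q.
    by rewrite qE ler_wpM2l ?ler0n// natV_le.
  have := mulr_ge0 b0 (ltW q0); rewrite qn; move: (n%:R / _) => P; lra.
have := natV_le1 m0 nm.
rewrite segE; move: (n%:R / _) (n%:R / _) => P Q h1 h2.
by have := cvx_le b0 b1 h1 h2; lra.
Qed.

(** The segment on the right of [1/n] reaches the abscissa [1/n] at height [0] only. *)
Lemma sine_gap_high t n : sine_curve R t -> 1 < n%:R * t.1 ->
  1 + t.2 / n.+1%:R <= n%:R * t.1.
Proof.
move=> /sine_curveP[]; case: t => a b /= /andP[b0 b1] ab.
have [q qE] : exists q : R, q = n.+1%:R^-1 by eexists.
have q0 : 0 < q by rewrite qE invr_gt0 ltr0n.
case: ab => [->|[m m0 ab]]; first by rewrite mulr0 ltr10.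
rewrite -qE; have [mn|nm] := ltnP m n; last first.
  have := natV_le1 m0 nm; have := natV_le1 (ltn0Sn m) (leqW nm).
  case: ab => ->; first lra.
  rewrite segE; move: (n%:R / _) (n%:R / _) => P Q h1 h2.
  by have := cvx_le b0 b1 h2 h1; lra.
have := natV_ge1 (ltn0Sn m) mn.
have : 1 + q <= n%:R * m%:R^-1.
  rewrite ler_pdivlMr ?ltr0n// mulrDl mul1r qE.
  have := natV_le1 (ltn0Sn n) (leqW (ltnW mn)); rewrite mulrC.
  have : m%:R + 1 <= n%:R :> R by rewrite natr1 ler_nat.
  move: (n.+1%:R^-1 * _) => P; lra.
have h3 : b * q <= q by rewrite ler_piMl// ltW.
case: ab => ->; first by move: (n%:R / _) => P; lra.
rewrite segE; move: (n%:R / _) (n%:R / _) => P Q h1 h2.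
by have := cvx_le b0 b1 h1 h2; lra.
Qed.

End sine_gaps.

(** * Two leaves block each other *)

Section uniform.
Variable R : realType.

Lemma unif_cont (T : pseudoMetricType R) (f : T -> R) (K : set T) e :
  continuous f -> compact K -> 0 < e ->
  \forall M \near \oo, forall t, K t -> forall t',
    ball t (M.+1%:R^-1) t' -> `|f t - f t'| < e.
Proof.
move=> cf /compact_near_coveringP cK e0.
apply: (cK _ _ (fun M t => forall t', ball t (M.+1%:R^-1) t' -> `|f t - f t'| < e)).
move=> t0 Kt0; have e20 : 0 < e / 2 by rewrite divr_gt0.
have /nbhs_ballP[d /= d0 dU] := cf t0 _ (nbhsx_ballx (f t0) _ e20).
have d20 : 0 < d / 2 by rewrite divr_gt0.
exists (ball t0 (d / 2), [set M | M.+1%:R^-1 < d / 2]) => /=.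
  split; first exact: nbhsx_ballx.
  exact: near_infty_natSinv_lt (PosNum d20).
move=> [t M] /= [t0t Md] t' tt'.
have h1 : `|f t0 - f t| < e / 2.
  by apply: (dU t); apply: le_ball t0t; lra.
have h2 : `|f t0 - f t'| < e / 2.
  apply: (dU t'); rewrite [d]splitr; apply: ball_triangle t0t _.
  by apply: le_ball tt'; exact: ltW.
rewrite (_ : f t - f t' = - (f t0 - f t) + (f t0 - f t')); last by ring.
by rewrite (le_lt_trans (ler_normD _ _))// normrN [e]splitr ltrD.
Qed.

Lemma connected_clopen (T : topologicalType) (K C O : set T) t0 :
  connected K -> closed C -> open O ->
  (forall t, K t -> C t -> O t) -> (forall t, K t -> O t -> C t) ->
  K t0 -> O t0 -> forall t, K t -> O t.
Proof.
move=> cK cC oO CO OC Kt0 Ot0 t Kt.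
have : K `&` O = K.
  apply: cK; [by exists t0|by exists O|exists C => //].
  by apply/seteqP; split => s [Ks ?]; split => //; [exact: OC|exact: CO].
by move=> /seteqP[_ /(_ t Kt)[]].
Qed.

End uniform.

Section leaves.
Variable R : realType.

(** The state of a point in a leaf: its abscissa [A] along the snake lies
    between [1/J] and [1/I], and [K / A], its height in the fibre, below [1/2]. *)
Definition in_leaf (J I : nat) (A K : R) : Prop :=
  [/\ 2 * K < A, 1 <= J%:R * A & I%:R * A <= 1].

Definition in_closed_leaf (J I : nat) (A K : R) : Prop :=
  [/\ 2 * K <= A, 1 <= J%:R * A & I%:R * A <= 1].

Definition on_sine (A K h : R) : Prop :=
  0 < A -> 2 * K <= A -> sine_curve R (A, h).

(** Below height [1] there is a gap of the snake before each [1/n], above height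
    [0] there is one after it. Cutting within the gaps describes the states by
    closed conditions as well as by open ones. *)
Let lowC J I (A K h : R) := [/\ 2 * K <= A, 1 <= J%:R * A &
  I.-1%:R * A <= 1 - (1 - h) / I.-1.+1%:R].
Let lowO J I (A K h : R) := [/\ 2 * K < A, 0 < A, 1 - (1 - h) / J.+1%:R < J%:R * A &
  I.-1%:R * A < 1].
Let highC J I (A K h : R) := [/\ 2 * K <= A, 1 + h / J.+2%:R <= J.+1%:R * A &
  I%:R * A <= 1].
Let highO J I (A K h : R) := [/\ 2 * K < A, 0 < A, 1 < J.+1%:R * A &
  I%:R * A < 1 + h / I.+1%:R].

Let pos_of_ge (J : nat) (A r : R) : 0 < r -> r <= J%:R * A -> 0 < A.
Proof.
move=> r0 rJ; rewrite ltNge; apply/negP => A0.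
have : J%:R * A <= 0 by rewrite mulr_ge0_le0.
lra.
Qed.

Lemma in_closed_leaf_gt0 (J I : nat) (A K : R) : in_closed_leaf J I A K -> 0 < A.
Proof. by move=> [_ h _]; exact: pos_of_ge h. Qed.

Let frac_pos (n : nat) (r : R) : 0 < r -> 0 < r / n.+1%:R.
Proof. by move=> r0; rewrite divr_gt0. Qed.

Let predn_le (I : nat) (A : R) : 0 < A -> I%:R * A <= 1 -> I.-1%:R * A <= 1.
Proof.
move=> A0; apply: le_trans; apply: ler_wpM2r; first exact: ltW.
by rewrite ler_nat leq_pred.
Qed.

Let lowC_O J I A K h : h < 1 -> 2 * K < A -> lowC J I A K h -> lowO J I A K h.
Proof.
move=> h1 KA [_ c2 c3].
have p1 := frac_pos J (_ : 0 < 1 - h); have p2 := frac_pos I.-1 (_ : 0 < 1 - h).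
split => //; first exact: pos_of_ge c2.
  by rewrite (lt_le_trans _ c2)// ltrBlDr ltrDl p1// subr_gt0.
by rewrite (le_lt_trans c3)// ltrBlDr ltrDl p2// subr_gt0.
Qed.

Let lowO_C J I A K h : h < 1 -> on_sine A K h -> lowO J I A K h -> lowC J I A K h.
Proof.
move=> h1 T [KA A0 o1 o2]; have {}T := T A0 (ltW KA); split; first exact: ltW.
  rewrite leNgt; apply/negP => JA.
  by have /= := sine_gap_low T JA; rewrite leNgt o1.
exact: (sine_gap_low T).
Qed.

Let highC_O J I A K h : 0 < h -> 2 * K < A -> highC J I A K h -> highO J I A K h.
Proof.
move=> h1 KA [_ c2 c3].
have p1 := frac_pos J.+1 h1; have p2 := frac_pos I h1.
split => //; last by rewrite (le_lt_trans c3)// ltrDl.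
  by apply: pos_of_ge c2; rewrite addr_gt0.
by rewrite (lt_le_trans _ c2)// ltrDl.
Qed.

Let highO_C J I A K h : 0 < h -> on_sine A K h -> highO J I A K h -> highC J I A K h.
Proof.
move=> h1 T [KA A0 o1 o2]; have {}T := T A0 (ltW KA); split; first exact: ltW.
  exact: (sine_gap_high T).
rewrite leNgt; apply/negP => IA.
by have /= := sine_gap_high T IA; rewrite leNgt o2.
Qed.

Let low_closed J I A K h : h < 1 -> lowC J I A K h -> in_closed_leaf J.+1 I.-1 A K.
Proof.
move=> h1 [c1 c2 c3]; have A0 := pos_of_ge ltr01 c2; split => //.
  by rewrite -natr1 mulrDl mul1r; lra.
have p2 := frac_pos I.-1 (_ : 0 < 1 - h).
by rewrite (le_trans c3)// gerBl ltW// p2// subr_gt0.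
Qed.

Let high_closed J I A K h : 0 < h -> highC J I A K h -> in_closed_leaf J.+1 I.-1 A K.
Proof.
move=> h1 [c1 c2 c3].
have p1 := frac_pos J.+1 h1.
have c2' : 1 <= J.+1%:R * A by rewrite (le_trans _ c2)// lerDl ltW.
by split => //; apply: predn_le => //; exact: pos_of_ge c2'.
Qed.

Let leaf_low J I A K h : h < 1 -> in_leaf J I A K -> lowO J I A K h.
Proof.
move=> h1 [c1 c2 c3]; have A0 := pos_of_ge ltr01 c2; split => //.
  have p1 := frac_pos J (_ : 0 < 1 - h).
  by rewrite (lt_le_trans _ c2)// ltrBlDr ltrDl p1// subr_gt0.
case: I c3 => [|I] /= c3; first by rewrite mul0r.
by rewrite (lt_le_trans _ c3)// -natr1 mulrDl mul1r ltrDl.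
Qed.

Let leaf_high J I A K h : 0 < h -> in_leaf J I A K -> highO J I A K h.
Proof.
move=> h1 [c1 c2 c3]; have A0 := pos_of_ge ltr01 c2; split => //.
  by rewrite (le_lt_trans c2)// -natr1 mulrDl mul1r ltrDl.
by rewrite (le_lt_trans c3)// ltrDl frac_pos.
Qed.

Let leaf_continuity (J I : nat) (A K h : R -> R) :
  continuous A -> continuous K -> continuous h ->
  [/\ closed [set t | lowC J I (A t) (K t) (h t)], open [set t | lowO J I (A t) (K t) (h t)],
      closed [set t | highC J I (A t) (K t) (h t)] &
      open [set t | highO J I (A t) (K t) (h t)]].
Proof.
move=> cA cK ch; split.
- rewrite (_ : [set _ | _] = [set t | 2 * K t <= A t] `&` [set t | 1 <= J%:R * A t] `&`
    [set t | I.-1%:R * A t <= 1 - (1 - h t) / I.-1.+1%:R]); last first.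
    by apply/seteqP; split => t; [move=> [? ? ?]; split; [split|]|move=> [[? ?] ?]; split].
  by apply: closedI; [apply: closedI|]; apply: closed_le_cont; ccont.
- rewrite (_ : [set _ | _] = [set t | 2 * K t < A t] `&` [set t | 0 < A t] `&`
    ([set t | 1 - (1 - h t) / J.+1%:R < J%:R * A t] `&` [set t | I.-1%:R * A t < 1])); last first.
    by apply/seteqP; split => t; [move=> [? ? ? ?]; split; split|move=> [[? ?] [? ?]]; split].
  by apply: openI; apply: openI; apply: open_lt_cont; ccont.
- rewrite (_ : [set _ | _] = [set t | 2 * K t <= A t] `&`
    [set t | 1 + h t / J.+2%:R <= J.+1%:R * A t] `&` [set t | I%:R * A t <= 1]); last first.
    by apply/seteqP; split => t; [move=> [? ? ?]; split; [split|]|move=> [[? ?] ?]; split].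
  by apply: closedI; [apply: closedI|]; apply: closed_le_cont; ccont.
- rewrite (_ : [set _ | _] = [set t | 2 * K t < A t] `&` [set t | 0 < A t] `&`
    ([set t | 1 < J.+1%:R * A t] `&` [set t | I%:R * A t < 1 + h t / I.+1%:R])); last first.
    by apply/seteqP; split => t; [move=> [? ? ? ?]; split; split|move=> [[? ?] [? ?]]; split].
  by apply: openI; apply: openI; apply: open_lt_cont; ccont.
Qed.

(** While the height avoids one of its extreme values, the snake can be left
    towards a neighbouring segment at one end only; hence [J] grows and [I]
    decreases by at most one. Each of the two leaves keeps the other one from
    being left through the fibre. *)
Lemma two_leaves_step (J1 I1 J2 I2 : nat) (A1 K1 h1 A2 K2 h2 : R -> R) s0 s1 :
  continuous A1 -> continuous K1 -> continuous h1 ->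
  continuous A2 -> continuous K2 -> continuous h2 ->
  (forall t, on_sine (A1 t) (K1 t) (h1 t)) ->
  (forall t, on_sine (A2 t) (K2 t) (h2 t)) ->
  s0 <= s1 ->
  (forall t, s0 <= t <= s1 -> in_closed_leaf J1.+1 I1.-1 (A1 t) (K1 t) ->
     in_closed_leaf J2.+1 I2.-1 (A2 t) (K2 t) ->
     2 * K1 t < A1 t /\ 2 * K2 t < A2 t) ->
  (forall t, s0 <= t <= s1 -> h1 t < 1 /\ h2 t < 1) \/
  (forall t, s0 <= t <= s1 -> 0 < h1 t /\ 0 < h2 t) ->
  in_leaf J1 I1 (A1 s0) (K1 s0) -> in_leaf J2 I2 (A2 s0) (K2 s0) ->
  in_leaf J1.+1 I1.-1 (A1 s1) (K1 s1) /\ in_leaf J2.+1 I2.-1 (A2 s1) (K2 s1).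
Proof.
move=> cA1 cK1 ch1 cA2 cK2 ch2 T1 T2 s01 block hh L1 L2.
have [C1 O1 C1' O1'] := leaf_continuity J1 I1 cA1 cK1 ch1.
have [C2 O2 C2' O2'] := leaf_continuity J2 I2 cA2 cK2 ch2.
have cI : connected `[s0, s1] by exact: segment_connected.
have II t : `[s0, s1]%classic t -> s0 <= t <= s1 by rewrite /= in_itv.
have Is0 : `[s0, s1]%classic s0 by rewrite /= in_itv /= lexx.
have Is1 : `[s0, s1]%classic s1 by rewrite /= in_itv /= s01 lexx.
suff : [/\ 2 * K1 s1 < A1 s1, 2 * K2 s1 < A2 s1,
    in_closed_leaf J1.+1 I1.-1 (A1 s1) (K1 s1) &
    in_closed_leaf J2.+1 I2.-1 (A2 s1) (K2 s1)].
  by move=> [k1 k2 [_ a1 b1] [_ a2 b2]].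
case: hh => hh.
- have CO t : `[s0, s1]%classic t ->
      lowC J1 I1 (A1 t) (K1 t) (h1 t) /\ lowC J2 I2 (A2 t) (K2 t) (h2 t) ->
      lowO J1 I1 (A1 t) (K1 t) (h1 t) /\ lowO J2 I2 (A2 t) (K2 t) (h2 t).
    move=> /II tI [l1 l2]; have [hh1 hh2] := hh t tI.
    have [k1 k2] := block t tI (low_closed hh1 l1) (low_closed hh2 l2).
    by split; exact: lowC_O.
  have OC t : `[s0, s1]%classic t ->
      lowO J1 I1 (A1 t) (K1 t) (h1 t) /\ lowO J2 I2 (A2 t) (K2 t) (h2 t) ->
      lowC J1 I1 (A1 t) (K1 t) (h1 t) /\ lowC J2 I2 (A2 t) (K2 t) (h2 t).
    by move=> /II tI [l1 l2]; have [hh1 hh2] := hh t tI; split; exact: lowO_C.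
  have [hh1 hh2] := hh s1 (II _ Is1).
  have [|o1 o2] := connected_clopen cI (closedI C1 C2) (openI O1 O2) CO OC Is0 _ Is1.
    by have [? ?] := hh s0 (II _ Is0); split; exact: leaf_low.
  have [c1 c2] := OC _ Is1 (conj o1 o2).
  by split; [case: o1|case: o2|exact: low_closed c1|exact: low_closed c2].
- have CO t : `[s0, s1]%classic t ->
      highC J1 I1 (A1 t) (K1 t) (h1 t) /\ highC J2 I2 (A2 t) (K2 t) (h2 t) ->
      highO J1 I1 (A1 t) (K1 t) (h1 t) /\ highO J2 I2 (A2 t) (K2 t) (h2 t).
    move=> /II tI [l1 l2]; have [hh1 hh2] := hh t tI.
    have [k1 k2] := block t tI (high_closed hh1 l1) (high_closed hh2 l2).
    by split; exact: highC_O.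
  have OC t : `[s0, s1]%classic t ->
      highO J1 I1 (A1 t) (K1 t) (h1 t) /\ highO J2 I2 (A2 t) (K2 t) (h2 t) ->
      highC J1 I1 (A1 t) (K1 t) (h1 t) /\ highC J2 I2 (A2 t) (K2 t) (h2 t).
    by move=> /II tI [l1 l2]; have [hh1 hh2] := hh t tI; split; exact: highO_C.
  have [hh1 hh2] := hh s1 (II _ Is1).
  have [|o1 o2] := connected_clopen cI (closedI C1' C2') (openI O1' O2') CO OC Is0 _ Is1.
    by have [? ?] := hh s0 (II _ Is0); split; exact: leaf_high.
  have [c1 c2] := OC _ Is1 (conj o1 o2).
  by split; [case: o1|case: o2|exact: high_closed c1|exact: high_closed c2].
Qed.

Let closed_leaf_mono (J I J' I' : nat) (A K : R) : (J <= J')%N -> (I' <= I)%N ->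
  in_closed_leaf J I A K -> in_closed_leaf J' I' A K.
Proof.
move=> JJ II [c1 c2 c3]; have A0 := pos_of_ge ltr01 c2; split => //.
  by rewrite (le_trans c2)// ler_wpM2r ?(ltW A0)// ler_nat.
by rewrite (le_trans _ c3)// ler_wpM2r ?(ltW A0)// ler_nat.
Qed.

Lemma two_leaves_steps (M J1 I1 J2 I2 : nat) (A1 K1 h1 A2 K2 h2 : R -> R) :
  (0 < M)%N ->
  continuous A1 -> continuous K1 -> continuous h1 ->
  continuous A2 -> continuous K2 -> continuous h2 ->
  (forall t, on_sine (A1 t) (K1 t) (h1 t)) ->
  (forall t, on_sine (A2 t) (K2 t) (h2 t)) ->
  (forall t, 0 <= t <= 1 -> in_closed_leaf (J1 + M) (I1 - M) (A1 t) (K1 t) ->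
     in_closed_leaf (J2 + M) (I2 - M) (A2 t) (K2 t) ->
     2 * K1 t < A1 t /\ 2 * K2 t < A2 t) ->
  (forall i, (i < M)%N ->
    (forall t, i%:R / M%:R <= t <= i.+1%:R / M%:R -> h1 t < 1 /\ h2 t < 1) \/
    (forall t, i%:R / M%:R <= t <= i.+1%:R / M%:R -> 0 < h1 t /\ 0 < h2 t)) ->
  in_leaf J1 I1 (A1 0) (K1 0) -> in_leaf J2 I2 (A2 0) (K2 0) ->
  in_leaf (J1 + M) (I1 - M) (A1 1) (K1 1) /\ in_leaf (J2 + M) (I2 - M) (A2 1) (K2 1).
Proof.
move=> M0 cA1 cK1 ch1 cA2 cK2 ch2 T1 T2 block hh L1 L2.
have MR : 0 < M%:R :> R by rewrite ltr0n.
suff H i : (i <= M)%N ->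
    in_leaf (J1 + i) (I1 - i) (A1 (i%:R / M%:R)) (K1 (i%:R / M%:R)) /\
    in_leaf (J2 + i) (I2 - i) (A2 (i%:R / M%:R)) (K2 (i%:R / M%:R)).
  by have := H M (leqnn M); rewrite divff// gt_eqF.
elim: i => [_|i IH iM]; first by rewrite mul0r !addn0 !subn0.
have [l1 l2] := IH (ltnW iM).
rewrite !addnS !subnS; apply: two_leaves_step (hh i iM) l1 l2 => //.
  by rewrite ler_wpM2r ?invr_ge0 ?ler0n// ler_nat.
move=> t /andP[t0 t1] c1 c2; apply: block.
- apply/andP; split; first by apply: le_trans t0; rewrite divr_ge0 ?ler0n.
  by apply: (le_trans t1); rewrite ler_pdivrMr// mul1r ler_nat.
- by apply: closed_leaf_mono c1; rewrite -?addnS ?leq_add2l// -subnS leq_sub2l.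
- by apply: closed_leaf_mono c2; rewrite -?addnS ?leq_add2l// -subnS leq_sub2l.
Qed.

(** The time is cut into steps on which the height of the limit path, hence of
    all terms but finitely many, varies by less than its whole range. The number
    of steps depends on the limit path only, so the leaves and the functions
    that keep them apart can be chosen afterwards. *)
Lemma two_leaves_no_track (Z : topologicalType) (h K1 K2 : Z -> R)
    (z : nat -> Z) z0 w0 :
  continuous h -> continuous K1 -> continuous K2 ->
  (forall M, exists (J1 I1 J2 I2 : nat) (g1 g2 : Z -> R) (e : R),
    [/\ continuous g1, continuous g2, 0 < e &
     forall N, exists (k1 k2 : nat) (A1 A2 : Z -> R), [/\ (N <= k1)%N /\ (N <= k2)%N,
       continuous A1 /\ continuous A2,
       (forall u, on_sine (A1 u) (K1 u) (h u)) /\ (forall u, on_sine (A2 u) (K2 u) (h u)),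
       in_leaf J1 I1 (A1 (z k1)) (K1 (z k1)) /\ in_leaf J2 I2 (A2 (z k2)) (K2 (z k2)) &
       forall u v, in_closed_leaf (J1 + M) (I1 - M) (A1 u) (K1 u) ->
         in_closed_leaf (J2 + M) (I2 - M) (A2 v) (K2 v) ->
         `|g1 u - g1 v| < e -> `|g2 u - g2 v| < e ->
         [/\ u <> v, 2 * K1 u < A1 u & 2 * K2 v < A2 v]]]) ->
  ~ track R z z0 (fun=> w0) w0.
Proof.
move=> ch cK1 cK2 leaves [f [c [fzw cc c0 c1 fc]]].
have cI : compact `[0, 1 : R] by exact: segment_compact.
have chc : continuous (h \o c) by move=> t; apply: continuous_comp; [exact: cc|exact: ch].
have e4 : 0 < 1 / 4 :> R by lra.
have [N1 _ HN1] := unif_cont chc cI e4.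
pose M := N1.+2; have M0 : (0 < M)%N by [].
have hM t t' : 0 <= t <= 1 -> `|t - t'| <= M%:R^-1 -> `|h (c t) - h (c t')| < 1 / 4.
  move=> tI tt'; have /= := HN1 N1 (leqnn N1) t; rewrite in_itv /=; apply => //.
  by apply: (le_lt_trans tt'); rewrite ltf_pV2 ?posrE ?ltr0n// ltr_nat.
have [J1 [I1 [J2 [I2 [g1 [g2 [e [cg1 cg2 e0 H]]]]]]]] := leaves M.
have e20 : 0 < e / 2 by rewrite divr_gt0.
have e8 : 0 < 1 / 8 :> R by lra.
have cgc (g : Z -> R) : continuous g -> continuous (fun t => g (c t)) by move=> cg; ccont.
have close (g : Z -> R) d : continuous g -> 0 < d ->
    \forall k \near \oo, forall t, 0 <= t <= 1 -> `|g (f k t) - g (c t)| < d.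
  move=> cg d0; have Hg := fcvg_unif (fcvg_map cg fc) (cgc g cg) cI d0.
  by apply: filterS (Hg _) => k Hk t tI; apply: Hk; rewrite /= in_itv.
have [N2 _ HN2] := fzw.
have [N3 _ HN3] := close h _ ch e8.
have [N4 _ HN4] := close g1 _ cg1 e20.
have [N5 _ HN5] := close g2 _ cg2 e20.
have [k1 [k2 [A1 [A2 [[kN1 kN2] [cA1 cA2] [T1 T2] [L1 L2] block]]]]] :=
  H (N2 + N3 + (N4 + N5))%N.
have kN k : (N2 + N3 + (N4 + N5) <= k)%N -> [/\ (N2 <= k)%N, (N3 <= k)%N, (N4 <= k)%N & (N5 <= k)%N].
  by move=> Hk; split; apply: leq_trans Hk; lia.
have [k12 k13 k14 k15] := kN _ kN1; have [k22 k23 k24 k25] := kN _ kN2.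
have [cf1 f10 f11] := HN2 _ k12; have [cf2 f20 f21] := HN2 _ k22.
have close2 (g : Z -> R) t : `|g (f k1 t) - g (c t)| < e / 2 ->
    `|g (f k2 t) - g (c t)| < e / 2 -> `|g (f k1 t) - g (f k2 t)| < e.
  move=> a b; rewrite (_ : g (f k1 t) - g (f k2 t) =
    (g (f k1 t) - g (c t)) - (g (f k2 t) - g (c t))); last by ring.
  by rewrite (le_lt_trans (ler_normB _ _))// [e]splitr ltrD.
have cmp (g : Z -> R) (F : R -> Z) :
    continuous g -> continuous F -> continuous (fun t => g (F t)) by move=> cg cF; ccont.
have block' t : 0 <= t <= 1 ->
    in_closed_leaf (J1 + M) (I1 - M) (A1 (f k1 t)) (K1 (f k1 t)) ->
    in_closed_leaf (J2 + M) (I2 - M) (A2 (f k2 t)) (K2 (f k2 t)) ->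
    [/\ f k1 t <> f k2 t, 2 * K1 (f k1 t) < A1 (f k1 t) & 2 * K2 (f k2 t) < A2 (f k2 t)].
  by move=> tI l1 l2; apply: block => //; apply: close2;
    [exact: HN4|exact: HN4|exact: HN5|exact: HN5].
have [l1 l2] : in_leaf (J1 + M) (I1 - M) (A1 (f k1 1)) (K1 (f k1 1)) /\
    in_leaf (J2 + M) (I2 - M) (A2 (f k2 1)) (K2 (f k2 1)).
  apply: (two_leaves_steps (h1 := fun t => h (f k1 t)) (h2 := fun t => h (f k2 t))
      (A1 := fun t => A1 (f k1 t)) (A2 := fun t => A2 (f k2 t))
      (K1 := fun t => K1 (f k1 t)) (K2 := fun t => K2 (f k2 t)) M0);
    rewrite ?f10 ?f20 //; try exact: cmp.
    by move=> t tI a b; have [] := block' t tI a b.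
  move=> i iM.
  have MR : 0 < M%:R :> R by rewrite ltr0n.
  have i0 : 0 <= (i%:R / M%:R : R) <= 1.
    by rewrite divr_ge0 ?ler0n//= ler_pdivrMr// mul1r ler_nat ltnW.
  have hh t : i%:R / M%:R <= t <= i.+1%:R / M%:R ->
      [/\ `|h (c (i%:R / M%:R)) - h (c t)| < 1 / 4, `|h (f k1 t) - h (c t)| < 1 / 8 &
          `|h (f k2 t) - h (c t)| < 1 / 8].
    move=> /andP[ti0 ti1].
    have tI : 0 <= t <= 1.
      rewrite (le_trans _ ti0) ?divr_ge0 ?ler0n//=.
      by rewrite (le_trans ti1)// ler_pdivrMr// mul1r ler_nat.
    split; [|exact: HN3|exact: HN3].
    apply: hM => //; rewrite ler_norml; apply/andP; split; last first.
      by rewrite (le_trans (_ : _ <= 0)) ?subr_le0 ?invr_ge0 ?ler0n.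
    by rewrite lerBrDr -lerBrDl opprK; apply: (le_trans ti1); rewrite -natr1 mulrDl mul1r.
  have [hi|hi] := lerP (h (c (i%:R / M%:R))) (1 / 2); [left|right] => t tI;
    have [] := hh t tI; rewrite !ltr_norml; lra.
have [] := block' 1 _ _ _.
- by rewrite ler01 lexx.
- by case: l1 => a b d; split => //; exact: ltW.
- by case: l2 => a b d; split => //; exact: ltW.
by rewrite f11 f21.
Qed.

End leaves.

(** * Snake cones in which some sequence does not contract *)

Section tooth_indicator.
Variable R : realType.

(** Separates the first [n] teeth from the remaining ones. *)
Definition tooth_cut (n : nat) (p : R) : R := clamp ((n.+1%:R * p - 1) * n%:R).

Lemma tooth_cut01 n p : teeth p -> (0 < n)%N -> tooth_cut n p = 0 \/ tooth_cut n p = 1.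
Proof.
move=> /(_ n)[h|h] n0.
  by left; apply: clamp_le0; rewrite mulr_le0_ge0 ?subr_le0.
right; apply: clamp_ge1; move: h; rewrite -natr1.
have : 1 <= n%:R :> R by rewrite ler1n.
move: (n%:R : R) => r; nra.
Qed.

Lemma tooth_cut_gt0 n p : 0 < tooth_cut n p -> 0 < p.
Proof.
move=> h; rewrite ltNge; apply/negP => p0; move: h; rewrite /tooth_cut clamp_le0 ?ltxx//.
rewrite mulr_le0_ge0// subr_le0 (le_trans _ ler01)// mulr_ge0_le0//.
Qed.

Lemma tooth_cut0 n : tooth_cut n 0 = 0.
Proof. by apply: clamp_le0; rewrite mulr0 sub0r mulN1r oppr_le0. Qed.

Lemma tooth_cutV n : tooth_cut n.+1 n.+1%:R^-1 = 1.
Proof.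
have e : n.+2%:R * n.+1%:R^-1 = 1 + n.+1%:R^-1 :> R.
  by rewrite -[n.+2%:R]natr1 mulrDl mul1r mulfV ?pnatr_eq0.
by apply: clamp_ge1; rewrite e [1 + _]addrC addrK mulVf ?pnatr_eq0.
Qed.

End tooth_indicator.

Section csc_leaves.
Variables (R : realType) (X : topologicalType) (x : X) (p q : X -> R) (n : nat).

(** In the lower half of a tooth the cut takes the values [0] and [1] only, so
    that the weighted indicator [A] of the first teeth is the abscissa. *)
Lemma csc_leaf (h K : collapsed_snake_cone R x -> R) :
  continuous p -> continuous q -> p x = 0 ->
  (forall y, 0 < p y -> q y < 1 -> teeth (p y)) ->
  (0 < n)%N ->
  (forall y t, h (csc_tube x y t) = (set_val t).2) ->
  (forall y t, K (csc_tube x y t) = (set_val t).1 * q y) ->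
  exists A : collapsed_snake_cone R x -> R, [/\ continuous A,
    (forall y t, A (csc_tube x y t) = (set_val t).1 * tooth_cut n (p y)),
    (forall u, on_sine (A u) (K u) (h u)) &
    forall u, 0 < A u -> 2 * K u <= A u -> (exists y t, u = csc_tube x y t) /\
      forall y t, u = csc_tube x y t -> A u = (set_val t).1 /\ 0 < p y].
Proof.
move=> cp cq px pq n0 hE KE.
have [|||A cA [A1 A2]] :=
    @csc_weighted R X x (fun a => a) (fun y => tooth_cut n (p y)) _ _ erefl.
- by ccont.
- by rewrite /tooth_cut; ccont.
- by rewrite px tooth_cut0.
have H u : 0 < A u -> 2 * K u <= A u -> (exists y t, u = csc_tube x y t) /\
      forall y t, u = csc_tube x y t -> A u = (set_val t).1 /\ 0 < p y.
  move=> A0 KA; split.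
    have [[y [t ->]]|[s us]] := csc_cases u; first by exists y, t.
    by move: A0; rewrite us A2 ltxx.
  move=> y t uE; move: A0 KA; rewrite uE A1 KE => A0 KA.
  have [/andP[a0 _] _] := square_snd (sine_square t).
  have t0 : 0 < (set_val t).1.
    by rewrite lt_neqAle a0 andbT; apply/eqP => t0; move: A0; rewrite -t0 mul0r ltxx.
  have c0 : 0 < tooth_cut n (p y) by move: A0; rewrite pmulr_rgt0.
  have p0 := tooth_cut_gt0 c0.
  have q1 : q y < 1.
    have : 2 * q y <= tooth_cut n (p y) by rewrite -(ler_pM2l t0) mulrCA.
    have := clamp_le1 ((n.+1%:R * p y - 1) * n%:R); rewrite -/(tooth_cut n (p y)); lra.
  split => //.
  have [c|->] := tooth_cut01 (pq y p0 q1) n0; last by rewrite mulr1.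
  by move: c0; rewrite c ltxx.
exists A; split => //.
move=> u A0 KA; have [[y [t uE]] /(_ y t uE)[AE _]] := H u A0 KA.
by rewrite AE uE hE -surjective_pairing; exact: set_valP.
Qed.

End csc_leaves.

Section nontrivial_sequences.
Variable R : realType.

Lemma sine_A (n : nat) : (0 < n)%N -> sine_curve R (Apt R n).
Proof.
move=> n0; right; exists n => //; left; exists 0; first by rewrite /= in_itv /= lexx ler01.
by rewrite subr0 scale1r scale0r addr0.
Qed.

Definition sineA (n : nat) : sineT R := exist _ (Apt R n.+1) (mem_set (sine_A (ltn0Sn n))).

Lemma csc_tube_continuous (X : topologicalType) (x : X) :
  continuous (fun p : X * sineT R => csc_tube x p.1 p.2).
Proof.
move=> p; apply: (@continuous_comp _ _ _ (fun p : X * sineT R => sc_tube x p.1 p.2)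
  (quotient_map (collapse (@SC_square R X x)))).
  exact: sc_tube_continuous.
exact: quotient_map_continuous.
Qed.

Lemma csc_square_eq (X : topologicalType) (x : X) (s s' : squareT R) :
  (set_val s).2 = (set_val s').2 -> csc_square x s = csc_square x s'.
Proof.
move=> ss.
have s0 : unit_square R (0, (set_val s).2).
  by have [_ h] := square_snd (set_valP s); split; rewrite /= in_itv //= lexx ler01.
pose o : squareT R := exist _ (0, (set_val s).2) (mem_set s0).
transitivity (csc_square x o); first by apply: quotient_map_rel; constructor.
by apply/esym/quotient_map_rel; constructor => //=; rewrite ss.
Qed.

Definition comb_base : comb R := exist _ (0, 0) (mem_set (@comb_origin R)).

Lemma comb_tooth (k : nat) : comb_set (k.+1%:R^-1 : R, 0).
Proof.
split => /=; last by right; exact: teethV.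
  by rewrite invr_ge0 ler0n invf_le1 ?ltr0n// ler1n.
by rewrite lexx ler01.
Qed.

Definition comb_tip (k : nat) : comb R := exist _ (k.+1%:R^-1, 0) (mem_set (comb_tooth k)).

Lemma cvg_natV : (k.+1%:R^-1 : R) @[k --> \oo] --> (0 : R).
Proof. exact: cvg_harmonic. Qed.

Lemma cvg_axis : ((k.+1%:R^-1, 0) : R * R) @[k --> \oo] --> ((0, 0) : R * R).
Proof.
apply: (@cvg_pair _ _ _ \oo (nbhs (0 : R)) (nbhs (0 : R)) _ _ _
  (fun k => k.+1%:R^-1) (fun=> 0)); first exact: cvg_natV.
exact: cvg_cst.
Qed.

Lemma comb_tip_cvg : comb_tip k @[k --> \oo] --> comb_base.
Proof.
by apply: cvg_subtype; exact: cvg_axis.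
Qed.

(** Takes every value infinitely often. *)
Definition val2 (n : nat) : nat := logn 2 n.+1.

Lemma val2_often (m N : nat) : exists2 k, (N <= k)%N & val2 k = m.
Proof.
exists (2 ^ m * N.*2.+1).-1; last first.
  rewrite /val2 prednK ?muln_gt0 ?expn_gt0// lognM ?expn_gt0// pfactorK//.
  by rewrite logn_coprime ?addn0// prime_coprime// dvdn2 /= odd_double.
rewrite -ltnS prednK ?muln_gt0 ?expn_gt0//.
by rewrite (@leq_trans N.*2.+1)// ?ltnS -?addnn ?leq_addr// leq_pmull// expn_gt0.
Qed.

Lemma near_bounded (P : nat -> nat -> Prop) (M : nat) :
  (forall n, \forall k \near \oo, P n k) ->
  \forall k \near \oo, forall n, (n < M)%N -> P n k.
Proof.
move=> HP; elim: M => [|M IH]; first by apply: nearW.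
apply: filterS2 IH (HP M) => k h1 h2 n; rewrite ltnS leq_eqVlt => /orP[/eqP->//|].
exact: h1.
Qed.

Let csc_seq (k : nat) := csc_tube comb_base (comb_tip k) (sineA (val2 k)).
Let csc_lim := csc_tube comb_base comb_base (sineA 0).

Let csc_seq_cvg : csc_seq k @[k --> \oo] --> csc_lim.
Proof.
move=> U Ulim; suff : \forall k \near \oo, U (csc_seq k) by [].
have baseE (t : sineT R) : (set_val t).2 = 0 -> csc_tube comb_base comb_base t = csc_lim.
  move=> t0; rewrite /csc_lim /csc_tube !sc_tube_base.
  exact: (@csc_square_eq _ comb_base).
have o01 : sine_curve R (0, 0).
  by left; apply/limit_segmentP; rewrite lexx ler01.
pose o : sineT R := exist _ (0, 0) (mem_set o01).
have Ub t : (set_val t).2 = 0 -> nbhs (comb_base, t)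
    [set p : comb R * sineT R | U (csc_tube comb_base p.1 p.2)].
  by move=> t0; apply: (@csc_tube_continuous _ comb_base (comb_base, t)); rewrite /= baseE.
have [[V W] /= [Vb Wo] VW] := Ub o erefl.
have [W' W'o W'W] := nbhs_subtypeP Wo.
have : \forall n \near \oo, W' (Apt R n.+1).
  exact: cvg_axis.
move=> [M _ HM].
have HP n : \forall k \near \oo, U (csc_tube comb_base (comb_tip k) (sineA n)).
  have [[V' W1] /= [Vb' Wn] VW'] := Ub (sineA n) erefl.
  have HV : \forall k \near \oo, V' (comb_tip k) by exact: comb_tip_cvg Vb'.
  apply: filterS HV => k Vk; apply: (VW' (comb_tip k, sineA n)).
  by split => //=; exact: nbhs_singleton.
have HV : \forall k \near \oo, V (comb_tip k) by exact: comb_tip_cvg Vb.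
apply: filterS2 (near_bounded M HP) HV => k h1 h2.
have [vM|Mv] := ltnP (val2 k) M; first exact: h1.
by apply: (VW (comb_tip k, sineA (val2 k))); split => //=; apply/W'W/HM.
Qed.

Let comb_chart (y : comb R) : 0 < (set_val y).1 -> (set_val y).2 < 1 -> teeth (set_val y).1.
Proof. by have [_ _ [->|]] := set_valP y; rewrite ?ltxx. Qed.

Let ltV (m n : nat) : (0 < m < n)%N -> n%:R^-1 < m%:R^-1 :> R.
Proof.
by move=> /andP[m0 mn]; rewrite ltf_pV2 ?posrE ?ltr0n ?ltr_nat// (ltn_trans m0).
Qed.

(** The sequence visits every segment of the snake infinitely often. A leaf over
    the first segment and a leaf over a sufficiently remote one cannot meet,
    and the spine cannot move into the fibres over both of them at once. *)
Lemma csc_comb_sequences : ~ sequences_contract R (collapsed_snake_cone R comb_base).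
Proof.
move=> /(_ _ _ csc_seq_cvg)[w0].
pose p (y : comb R) := (set_val y).1; pose q (y : comb R) := (set_val y).2.
have cp : continuous p by rewrite /p; ccont.
have cq : continuous q by rewrite /q; ccont.
have p0 : p comb_base = 0 by [].
have [h ch [hE _]] := csc_height R comb_base.
have cid : continuous (fun a : R => a) by ccont.
have [K cK [KE _]] := @csc_weighted R (comb R) comb_base _ q cid cq erefl erefl.
apply: (two_leaves_no_track ch cK cK) => M.
(* The first leaf starts at abscissa [1] and stays above [1/(M+1)], the second
   one starts at [1/(2M+3)] and stays below [1/(M+3)]. The functions [phi1] and
   [phi2], supported on either side of [1/(M+2)], detect when the spine enters
   the fibre of the first or of the second leaf. *)
have n1 : (M.+3 <= 2 * M + 3 - M)%N by lia.
have n2 : (2 * M + 3 + M <= 3 * M + 3)%N by lia.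
have n3 : (0 < 3 * M + 3)%N by lia.
pose a1 : R := M.+1%:R^-1; pose a2 : R := M.+2%:R^-1; pose a3 : R := M.+3%:R^-1.
pose a4 : R := (3 * M + 3)%N%:R^-1.
have a21 : a2 < a1 by apply: ltV; lia.
have a32 : a3 < a2 by apply: ltV; lia.
have a40 : 0 < a4 by rewrite invr_gt0 ltr0n; lia.
have a20 : 0 < a2 by rewrite invr_gt0 ltr0n; lia.
pose phi1 (a : R) : R := Num.max 0 (a - a2).
pose phi2 (a : R) : R := Num.max 0 (Num.min a (a2 - a)).
have [||g1 cg1 [g1E _]] := @csc_weighted R (comb R) comb_base phi1 q _ cq _ erefl.
- by rewrite /phi1; ccont.
- by rewrite /phi1; apply/max_idPl; lra.
have [||g2 cg2 [g2E _]] := @csc_weighted R (comb R) comb_base phi2 q _ cq _ erefl.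
- by rewrite /phi2; ccont.
- by rewrite /phi2; apply/max_idPl; rewrite ge_min lexx.
pose d2 : R := Num.min a4 (a2 - a3).
have d20 : 0 < d2 by rewrite lt_min a40 subr_gt0.
pose e : R := Num.min ((a1 - a2) / 2) (d2 / 2).
have e1 : e <= (a1 - a2) / 2 by rewrite ge_min lexx.
have e2 : e <= d2 / 2 by rewrite ge_min lexx orbT.
exists 1%N, 1%N, (2 * M + 3)%N, (2 * M + 3)%N, g1, g2, e; split => //.
  by rewrite lt_min; apply/andP; split; lra.
move=> N; have [k1 Nk1 vk1] := val2_often 0 N; have [k2 Nk2 vk2] := val2_often (2 * M + 2) N.
have [A1 [cA1 A1E T1 L1]] := csc_leaf cp cq p0 comb_chart (ltn0Sn k1) hE KE.
have [A2 [cA2 A2E T2 L2]] := csc_leaf cp cq p0 comb_chart (ltn0Sn k2) hE KE.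
exists k1, k2, A1, A2; split => //.
  have K0 k : K (csc_seq k) = 0 by rewrite KE /q /= mulr0.
  have A1k : A1 (csc_seq k1) = 1 by rewrite A1E vk1 /p /= tooth_cutV invr1 mulr1.
  have A2k : A2 (csc_seq k2) = (2 * M + 3)%N%:R^-1.
    by rewrite A2E vk2 /p /= tooth_cutV mulr1; congr (_%:R^-1); lia.
  have nz : (2 * M + 3)%N%:R != 0 :> R by rewrite pnatr_eq0; lia.
  split; split; rewrite ?K0 ?A1k ?A2k ?mulr0 ?mulr1 ?ltr01 ?mulfV ?lexx//.
move=> u v lu lv; have u0 := in_closed_leaf_gt0 lu; have v0 := in_closed_leaf_gt0 lv.
case: lu lv => Ku uJ _ [Kv vJ vI].
have [[y [t uE]] Lu] := L1 _ u0 Ku; have [[y' [t' vE]] Lv] := L2 _ v0 Kv.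
have [uA _] := Lu y t uE; have [vA _] := Lv y' t' vE.
have ua : a1 <= (set_val t).1 by rewrite -uA /a1 -[_^-1]mul1r ler_pdivrMr ?ltr0n// mulrC.
have va : (set_val t').1 <= a3.
  rewrite -vA /a3 -[_^-1]mul1r ler_pdivlMr ?ltr0n// mulrC.
  by apply: le_trans vI; rewrite ler_wpM2r ?(ltW v0)// ler_nat.
have va' : a4 <= (set_val t').1.
  rewrite -vA /a4 -[_^-1]mul1r ler_pdivrMr ?ltr0n//.
  by rewrite mulrC; apply: (le_trans vJ); rewrite ler_wpM2r ?(ltW v0)// ler_nat.
rewrite uE vE !g1E !g2E => h1 h2.
have p1u : phi1 (set_val t).1 = (set_val t).1 - a2 by apply/max_idPr; lra.
have p1v : phi1 (set_val t').1 = 0 by apply/max_idPl; lra.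
have p2u : phi2 (set_val t).1 = 0 by apply/max_idPl; rewrite ge_min; apply/orP; right; lra.
have p2v : d2 <= phi2 (set_val t').1.
  rewrite le_max /d2; apply/orP; right; rewrite le_min !ge_min va'/=.
  by apply/orP; right; lra.
have qK z (s : sineT R) : 2 * ((set_val s).1 * q z) = (set_val s).1 * (2 * q z) by ring.
split.
- rewrite -uE -vE => uv; have [uA' _] := Lu y' t' (etrans uv vE); lra.
- rewrite -uE lt_neqAle Ku andbT; apply/eqP.
  rewrite uA uE KE qK => /eqP; rewrite -subr_eq0 -{2}[(set_val t).1]mulr1 -mulrBr mulf_eq0.
  move=> /orP[|] /eqP qq; first lra.
  move: h1; rewrite p1u p1v mul0r subr0 ltr_norml; nra.
- rewrite -vE lt_neqAle Kv andbT; apply/eqP.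
  rewrite vA vE KE qK => /eqP; rewrite -subr_eq0 -{2}[(set_val t').1]mulr1 -mulrBr mulf_eq0.
  move=> /orP[|] /eqP qq; first lra.
  move: h2; rewrite p2u mul0r sub0r normrN ltr_norml; nra.
Qed.

Lemma double_comb_origin : double_comb_set (0 : R, 0).
Proof. by left; exact: comb_origin. Qed.

Definition double_comb_base : double_comb R :=
  exist _ (0, 0) (mem_set double_comb_origin).

Definition alternating_sign (k : nat) : R := if odd k then -1 else 1.

Lemma double_comb_tooth (k : nat) :
  double_comb_set (alternating_sign k * k.+1%:R^-1, 0).
Proof.
rewrite /alternating_sign; case: ifP => _; [right|left].
  by rewrite /= mulN1r opprK oppr0; exact: comb_tooth.
by rewrite mul1r; exact: comb_tooth.
Qed.

Definition double_comb_tip (k : nat) : double_comb R :=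
  exist _ (alternating_sign k * k.+1%:R^-1, 0) (mem_set (double_comb_tooth k)).

Lemma double_comb_tip_cvg : double_comb_tip k @[k --> \oo] --> double_comb_base.
Proof.
apply: cvg_subtype.
apply: (@cvg_pair _ _ _ \oo (nbhs (0 : R)) (nbhs (0 : R)) _ _ _
  (fun k => alternating_sign k * k.+1%:R^-1) (fun=> 0)); last exact: cvg_cst.
apply/cvgrPdist_lt => e e0.
have := near_infty_natSinv_lt (PosNum e0); apply: filterS => k /=.
rewrite sub0r normrN normrM /alternating_sign.
by case: ifP => _; rewrite ?normrN normr1 mul1r ger0_norm// invr_ge0.
Qed.

(** The two leaves lie on opposite sides of the base point, over one and the
    same segment, so that already the snake cone detects the sequence. *)
Lemma csc_double_comb_no_track w0 :
  ~ track R (fun k => csc_tube double_comb_base (double_comb_tip k) (sineA 0))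
      (csc_tube double_comb_base double_comb_base (sineA 0)) (fun=> w0) w0.
Proof.
pose p1 (y : double_comb R) := (set_val y).1.
pose p2 (y : double_comb R) := - (set_val y).1.
pose q1 (y : double_comb R) := Num.max (set_val y).2 0.
pose q2 (y : double_comb R) := Num.max (- (set_val y).2) 0.
have cp1 : continuous p1 by rewrite /p1; ccont.
have cp2 : continuous p2 by rewrite /p2; ccont.
have cq1 : continuous q1 by rewrite /q1; ccont.
have cq2 : continuous q2 by rewrite /q2; ccont.
have p10 : p1 double_comb_base = 0 by [].
have p20 : p2 double_comb_base = 0 by rewrite /p2 oppr0.
have q10 : q1 double_comb_base = 0 by rewrite /q1 maxxx.
have q20 : q2 double_comb_base = 0 by rewrite /q2 oppr0 maxxx.
have chart1 y : 0 < p1 y -> q2 y = 0 /\ (q1 y < 1 -> teeth (p1 y)).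
  move=> py; case: (set_valP y) => -[/andP[a b] /andP[c d] h]; last first.
    by move: a; rewrite /= oppr_ge0 leNgt py.
  split; first by apply/max_idPr; rewrite oppr_le0.
  by rewrite /q1 (max_idPl c); case: h => [->|//]; rewrite ltxx.
have chart2 y : 0 < p2 y -> q1 y = 0 /\ (q2 y < 1 -> teeth (p2 y)).
  move=> py; case: (set_valP y) => -[/andP[a b] /andP[c d] h].
    by move: py; rewrite oppr_gt0 ltNge a.
  rewrite /= in a b c d h; split; first by apply/max_idPr; rewrite -oppr_ge0.
  by rewrite /q2 (max_idPl c); case: h => [->|//]; rewrite ltxx.
have [h ch [hE _]] := csc_height R double_comb_base.
have cid : continuous (fun a : R => a) by ccont.
have [K1 cK1 [K1E _]] := @csc_weighted R _ double_comb_base _ q1 cid cq1 erefl q10.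
have [K2 cK2 [K2E _]] := @csc_weighted R _ double_comb_base _ q2 cid cq2 erefl q20.
apply: (two_leaves_no_track ch cK1 cK2) => M.
pose e : R := (2 * M.+1%:R)^-1.
exists 1%N, 1%N, 1%N, 1%N, K1, K2, e; split => //.
  by rewrite invr_gt0 mulr_gt0 ?ltr0n.
move=> N; exists N.*2, N.*2.+1.
have [A1 [cA1 A1E T1 L1]] :=
  csc_leaf cp1 cq1 p10 (fun y py => (chart1 y py).2) (ltn0Sn N.*2) hE K1E.
have [A2 [cA2 A2E T2 L2]] :=
  csc_leaf cp2 cq2 p20 (fun y py => (chart2 y py).2) (ltn0Sn N.*2.+1) hE K2E.
exists A1, A2; split => //.
- by have N2 : (N <= N.*2)%N; [rewrite -addnn leq_addr|split; last exact: leqW].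
- have A1k : A1 (csc_tube double_comb_base (double_comb_tip N.*2) (sineA 0)) = 1.
    by rewrite A1E /p1 /= /alternating_sign odd_double invr1 !mul1r tooth_cutV.
  have A2k : A2 (csc_tube double_comb_base (double_comb_tip N.*2.+1) (sineA 0)) = 1.
    by rewrite A2E /p2 /= /alternating_sign /= odd_double invr1 mulN1r opprK mul1r tooth_cutV.
  rewrite A1k A2k K1E K2E /q1 /q2 /= oppr0 maxxx !mulr0.
  by split; split; rewrite ?mulr0 ?mulr1 ?ltr01.
move=> u v lu lv; have u0 := in_closed_leaf_gt0 lu; have v0 := in_closed_leaf_gt0 lv.
case: lu lv => Ku uJ _ [Kv vJ _].
have [[y [t uE]] Lu] := L1 _ u0 Ku; have [[y' [t' vE]] Lv] := L2 _ v0 Kv.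
have [uA py] := Lu y t uE; have [vA py'] := Lv y' t' vE.
have K1v : K1 v = 0 by rewrite vE K1E (chart2 y' py').1 mulr0.
have K2u : K2 u = 0 by rewrite uE K2E (chart1 y py).1 mulr0.
have big a : 1 <= (1 + M)%:R * a -> e <= a / 2.
  move=> Ma; rewrite /e invfM mulrC ler_pM2r ?invr_gt0// -[_^-1]mul1r.
  by rewrite ler_pdivrMr ?ltr0n// mulrC.
rewrite K1v K2u subr0 sub0r normrN => h1 h2.
split.
- move=> uv; have [_ py2] := Lu y' t' (etrans uv vE).
  by move: py'; rewrite oppr_gt0 ltNge ltW.
- rewrite lt_neqAle Ku andbT; apply/eqP => KA.
  have := big _ uJ; rewrite -KA; move: h1; rewrite ltr_norml; lra.
- rewrite lt_neqAle Kv andbT; apply/eqP => KA.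
  have := big _ vJ; rewrite -KA; move: h2; rewrite ltr_norml; lra.
Qed.

Lemma sc_double_comb_sequences : ~ sequences_contract R (snake_cone R double_comb_base).
Proof.
move=> contr.
pose base := double_comb_base.
have ct : continuous (fun y : double_comb R => sc_tube base y (sineA 0)).
  move=> y; apply: (@cont_at_comp _ _ _ (fun y : double_comb R => (y, sineA 0))
    (fun p : double_comb R * sineT R => sc_tube base p.1 p.2)).
    exact: sc_tube_continuous.
  ccont.
have [w0 tw] := contr _ _ (cvg_comp _ _ double_comb_tip_cvg (ct base)).
apply: csc_double_comb_no_track.
exact: track_map (quotient_map_continuous (r := collapse (@SC_square R _ base))) tw.
Qed.
End nontrivial_sequences.

(** * The inverses of the natural numbers *)

Section inverse_integers.
Variable R : realType.
Implicit Types (m n : nat) (a : R).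

Lemma natV_inj m n : (m%:R^-1 : R) = n%:R^-1 -> m = n.
Proof. by move/invr_inj/eqP; rewrite eqr_nat => /eqP. Qed.

(** The open strip around [1/n] that meets no other [1/m]. *)
Definition strip n a : Prop := 1 < n.+1%:R * a /\ n.-1%:R * a < 1.

Lemma strip_unique m n : (0 < m)%N -> strip n (m%:R^-1) -> m = n.
Proof.
move=> m0 [h1 h2]; move: h1 h2.
rewrite ltr_pdivlMr ?ltr_pdivrMr ?ltr0n// ?mul1r ?mulr1 !ltr_nat => h1 h2.
case: n h1 h2 => [|n] /= h1 h2; last by apply/eqP; rewrite eqn_leq h2 andbT -ltnS.
by apply/eqP; rewrite eqn_leq -ltnS h1.
Qed.

Lemma strip_exists a : 0 < a -> a <= 1 -> exists2 n, (0 < n)%N & strip n a.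
Proof.
move=> a0 a1; pose n := Num.truncn a^-1.
have /andP[n1 n2] : n%:R <= a^-1 < n.+1%:R.
  by apply: truncn_itv; rewrite invr_ge0 ltW.
have n0 : (0 < n)%N by rewrite -ltnS -(ltr_nat R) (le_lt_trans _ n2)// invf_ge1.
exists n => //; split.
  by rewrite -ltr_pdivrMr// mul1r.
apply: (@lt_le_trans _ _ (n%:R * a)); last by rewrite -ler_pdivlMr// mul1r.
by rewrite ltr_pM2r// ltr_nat prednK.
Qed.

Lemma strip_open (T : topologicalType) (f : T -> R) (n : nat) t :
  cont_at f t -> strip n (f t) -> \forall s \near t, strip n (f s).
Proof.
move=> ft [h1 h2].
have c1 : cont_at (fun s => n.+1%:R * f s) t by ccont.
have c2 : cont_at (fun s => n.-1%:R * f s) t by ccont.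
have n1 : \forall s \near t, 1 < n.+1%:R * f s by exact: c1 _ (lt_nbhsr h1).
have n2 : \forall s \near t, n.-1%:R * f s < 1 by exact: c2 _ (lt_nbhsl h2).
by apply: filterS2 n1 n2 => s ? ?; split.
Qed.

Definition tent n a : R := clamp (1 - `|a - n%:R^-1| * (n%:R * n.+1%:R)).

Lemma tent_self n : tent n n%:R^-1 = 1.
Proof. by rewrite /tent subrr normr0 mul0r subr0 clamp_ge1. Qed.

Lemma tent_other m n : (0 < m)%N -> (0 < n)%N -> m != n -> tent n m%:R^-1 = 0.
Proof.
move=> m0 n0 mn; apply: clamp_le0; rewrite subr_le0.
have mR : 0 < m%:R :> R by rewrite ltr0n.
have nR : 0 < n%:R :> R by rewrite ltr0n.
have -> : m%:R^-1 - n%:R^-1 = (n%:R - m%:R) / (m%:R * n%:R) :> R.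
  by field; rewrite !gt_eqF.
rewrite normrM normfV [`|_ * _|]gtr0_norm ?mulr_gt0//.
have -> : `|n%:R - m%:R| / (m%:R * n%:R) * (n%:R * n.+1%:R) =
    `|n%:R - m%:R| * n.+1%:R / m%:R :> R by field; rewrite !gt_eqF.
rewrite ler_pdivlMr// mul1r.
case: (ltnP m n) => [mn'|nm].
  have h : 1 <= `|n%:R - m%:R| :> R.
    by rewrite -natrB ?(ltnW mn')// normr_nat ler1n subn_gt0.
  rewrite (@le_trans _ _ (1 * n.+1%:R))//; first by rewrite mul1r ler_nat ltnW// ltnW.
  by rewrite ler_wpM2r.
have -> : `|n%:R - m%:R| = (m - n)%N%:R :> R.
  by rewrite distrC -natrB// normr_nat.
rewrite -natrM ler_nat.
have : (n < m)%N by rewrite ltn_neqAle eq_sym mn.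
nia.
Qed.

Lemma tent0 n : (0 < n)%N -> tent n 0 = 0.
Proof.
move=> n0; apply: clamp_le0; rewrite sub0r normrN ger0_norm// mulrA mulVf ?pnatr_eq0 -?lt0n//.
Qed.

End inverse_integers.

(** * Coordinates on the alternating cones *)

Section straight_line.
Variables (R : realType) (Z : topologicalType).

Lemma square_contract (f : R * R -> Z) (c : nat -> R * R) c0 :
  continuous f -> c k @[k --> \oo] --> c0 ->
  track R (f \o c) (f c0) (fun=> f (0, 0)) (f (0, 0)).
Proof.
move=> cf cc0.
have cH : continuous (fun p : (R * R) * R => f ((1 - p.2) * p.1.1, (1 - p.2) * p.1.2)).
  by ccont.
have := track_flow cH cc0; rewrite /= !subr0 !subrr !mul1r !mul0r -surjective_pairing.
by apply: track_eq; apply: nearW => k /=; rewrite ?mul1r ?mul0r -?surjective_pairing.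
Qed.

End straight_line.

Section alternating.
Variables (R : realType) (X : topologicalType) (x : X).

Definition acT : topologicalType := @AC_pre R X x.

Definition mk_ac (y : X) (c : R * R) (h : AC_pre x (y, c)) : acT :=
  exist _ (y, c) (mem_set h).

Definition fibre (p : acT) : X := (set_val p).1.
Definition pos (p : acT) : R * R := (set_val p).2.

Lemma acT_eq (p q : acT) : fibre p = fibre q -> pos p = pos q -> p = q.
Proof.
rewrite /fibre /pos => h1 h2; apply: val_inj; move: h1 h2.
by case: p q => [[? ?] ?] [[? ?] ?] /= -> ->.
Qed.

Lemma acT_inP (p : acT) : AC_pre x (fibre p, pos p).
Proof. by rewrite -surjective_pairing; exact: set_valP. Qed.

Lemma pos_square (p : acT) : 0 <= (pos p).1 <= 1 /\ 0 <= (pos p).2 <= 1.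
Proof. by have [h _] := acT_inP p; exact: square_snd h. Qed.

Definition apex_height (n : nat) : R := if odd n then 0 else 1.

Lemma apex_height01 n : 0 <= apex_height n <= 1.
Proof. by rewrite /apex_height; case: ifP; rewrite ?lexx ?ler01. Qed.

Lemma AC_apexP (c : R * R) : AC_apex c <-> (c.1 = 0 /\ 0 <= c.2 <= 1) \/
  exists2 n, (0 < n)%N & c = (n%:R^-1, apex_height n).
Proof.
split.
  case=> [?|[n n0 ->]|[n n0 ->]]; [by left|right|right].
    exists (2 * n - 1)%N; first lia.
    by rewrite /apex_height /Apt oddB ?oddM//; lia.
  by exists (2 * n)%N; [lia|rewrite /apex_height oddM].
case=> [?|[n n0 ->]]; first exact: Or31.
rewrite /apex_height; case: ifP => on.
  by apply: Or32; exists n.+1./2; [lia|rewrite /Apt; congr (_%:R^-1, _); lia].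
by apply: Or33; exists n./2; [lia|rewrite /Bpt; congr (_%:R^-1, _); lia].
Qed.

Definition ac (p : acT) : alternating_cone R x := quotient_map (@AC_glue R X x) p.

Definition cac (p : acT) : collapsed_alternating_cone R x :=
  quotient_map (collapse (@AC_square R X x)) (ac p).

Lemma ac_continuous : continuous ac.
Proof. exact: quotient_map_continuous. Qed.

Lemma cac_continuous : continuous cac.
Proof.
move=> p; apply: (@continuous_comp _ _ _ ac (quotient_map (collapse (@AC_square R X x)))).
  exact: ac_continuous.
exact: quotient_map_continuous.
Qed.

Lemma ac_surj z : exists p, ac p = z.
Proof. exact: quotient_map_surj. Qed.

Lemma cac_surj z : exists p, cac p = z.
Proof. by have [w <-] := quotient_map_surj z; have [p <-] := ac_surj w; exists p. Qed.

Lemma ac_apex p q : pos p = pos q -> AC_apex (pos p) -> ac p = ac q.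
Proof. by move=> h1 h2; apply: quotient_map_rel. Qed.

Lemma ac_limit p q : pos p = pos q -> (pos p).1 = 0 -> ac p = ac q.
Proof.
by move=> h1 h2; apply: ac_apex => //; apply/AC_apexP; left; have [_ ?] := pos_square p.
Qed.

Lemma cac_limit p q : pos p = pos q -> (pos p).1 = 0 -> cac p = cac q.
Proof. by move=> h1 h2; rewrite /cac (ac_limit h1). Qed.

Lemma clamp_square (c : R * R) : unit_square R (clamp c.1, clamp c.2).
Proof. by split; rewrite /= in_itv /= clamp_ge0 clamp_le1. Qed.

Lemma ac_base_in (c : R * R) : AC_pre x (x, (clamp c.1, clamp c.2)).
Proof. by split; [exact: clamp_square|exact: Or33]. Qed.

Definition ac_base (c : R * R) : acT := mk_ac (ac_base_in c).

Lemma ac_base_continuous : continuous ac_base.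
Proof.
move=> c; apply: cvg_subtype.
suff : continuous (fun c : R * R => (x, (clamp c.1, clamp c.2))) by apply.
by ccont.
Qed.

Lemma pos_base (c : R * R) : pos (ac_base c) = (clamp c.1, clamp c.2).
Proof. by []. Qed.

Lemma pos_base_pos (p : acT) : pos (ac_base (pos p)) = pos p.
Proof.
by have [h1 h2] := pos_square p; rewrite pos_base !clamp_id// -surjective_pairing.
Qed.

Lemma ac_baseE p : fibre p = x -> p = ac_base (pos p).
Proof.
by move=> px; apply: acT_eq; rewrite ?pos_base_pos.
Qed.

Lemma AC_squareE (s : squareT R) : AC_square x s = ac (ac_base (set_val s)).
Proof.
congr quotient_map; apply: val_inj => /=; congr (_, _).
have [h1 h2] := square_snd (set_valP s).
by rewrite !clamp_id//; case: (set_val s).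
Qed.

Lemma cac_baseE (c d : R * R) : clamp c.2 = clamp d.2 -> cac (ac_base c) = cac (ac_base d).
Proof.
move=> cd.
have h0 : unit_square R (0, clamp c.2).
  by split; rewrite /= in_itv /= ?lexx ?ler01 ?clamp_ge0 ?clamp_le1.
pose o : squareT R := exist _ (0, clamp c.2) (mem_set h0).
have H (e : R * R) : clamp e.2 = clamp c.2 -> cac (ac_base e) =
    quotient_map (collapse (@AC_square R X x)) (AC_square x o).
  move=> ec; pose s : squareT R := exist _ (clamp e.1, clamp e.2) (mem_set (clamp_square e)).
  have -> : cac (ac_base e) = quotient_map (collapse (@AC_square R X x)) (AC_square x s).
    rewrite AC_squareE /cac; congr (quotient_map _ (ac _)); apply: acT_eq => //.
    rewrite !pos_base -[set_val s]/(clamp e.1, clamp e.2) /=.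
    by rewrite !(@clamp_id _ (clamp _)) ?clamp_ge0 ?clamp_le1.
  by apply: quotient_map_rel; constructor => //=; rewrite ec.
by rewrite !H.
Qed.

(** Compactness of [X]: a neighbourhood of a collapsed fibre contains all
    fibres over the nearby points of the square. *)
Lemma ac_fibre_nbhs (Z : topologicalType) (f : acT -> Z) (c0 : R * R) (U : set Z) :
  compact [set: X] -> continuous f -> (forall y, AC_pre x (y, c0)) ->
  (forall p, pos p = c0 -> nbhs (f p) U) ->
  \forall c \near c0, forall p, pos p = c -> U (f p).
Proof.
move=> /compact_near_coveringP cX cf in0 fU.
suff H : \forall c \near c0, [set: X] `<=` (fun y => forall p, fibre p = y -> pos p = c -> U (f p)).
  by apply: filterS H => c Hc p pc; exact: (Hc (fibre p) Logic.I p erefl pc).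
apply: (cX _ (nbhs c0) (fun c y => forall p, fibre p = y -> pos p = c -> U (f p))) => y _.
have [V Vy VU] := nbhs_subtypeP (cf (mk_ac (in0 y)) _ (fU (mk_ac (in0 y)) erefl)).
case: Vy => -[/= V1 V2] [/= V1y V2c] V12.
exists (V1, V2) => //= -[y' c] /= [V1y' V2c'] p py pc.
by apply: VU => /=; apply: V12; split; [move: V1y'; rewrite -py|move: V2c'; rewrite -pc].
Qed.

Lemma pos_continuous : continuous pos.
Proof. by rewrite /pos; ccont. Qed.

Lemma fibre_continuous : continuous fibre.
Proof. by rewrite /fibre; ccont. Qed.

Lemma limit_fibre_in y (b : R) : 0 <= b <= 1 -> AC_pre x (y, (0, b)).
Proof. by move=> b01; split; [split; rewrite /= in_itv /= ?lexx ?ler01|exact: Or31]. Qed.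

(** Away from the limit segment a deformation of the alternating tubes is
    continuous by inspection; at the limit segment only the planar coordinates
    matter. *)
Lemma ac_flow_continuous (Z : topologicalType) (f : acT -> Z) (m : acT * R -> acT) :
  compact [set: X] -> continuous f ->
  (forall p q, pos p = pos q -> (pos p).1 = 0 -> f p = f q) ->
  (forall p t, (pos p).1 != 0 -> cont_at m (p, t)) ->
  (forall p t, (pos p).1 = 0 -> cont_at (fun u => pos (m u)) (p, t) /\ (pos (m (p, t))).1 = 0) ->
  continuous (fun u => f (m u)).
Proof.
move=> cX cf f0 m1 m0 [p t]; have [a0|a0] := eqVneq (pos p).1 0; last first.
  by apply: (cvg_comp _ _ (m1 p t a0)); exact: cf.
have [cm ma0] := m0 p t a0 => U Ufm.
have [_ b01] := pos_square (m (p, t)).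
have H : \forall c \near pos (m (p, t)), forall q, pos q = c -> U (f q).
  apply: ac_fibre_nbhs => //.
    by move=> y; rewrite [pos _]surjective_pairing ma0; exact: limit_fibre_in.
  by move=> q qm; rewrite (f0 q (m (p, t)))// qm.
suff : \forall u \near (p, t), U (f (m u)) by [].
have HH : \forall u \near (p, t), forall q, pos q = pos (m u) -> U (f q) by exact: cm _ H.
by apply: filterS HH => u; exact.
Qed.

Lemma AC_lift_homotopy (B : topologicalType) (f : acT * R -> B) :
  continuous f ->
  (forall p q t, pos p = pos q -> AC_apex (pos p) -> f (p, t) = f (q, t)) ->
  exists2 F : alternating_cone R x * R -> B,
    continuous F & forall p t, F (ac p, t) = f (p, t).
Proof.
move=> cf fr; apply: quotient_lift_homotopy => // p q t [h1 h2]; exact: fr.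
Qed.

Lemma AC_lift (B : Type) (f : acT -> B) :
  (forall p q, pos p = pos q -> AC_apex (pos p) -> f p = f q) ->
  exists F : alternating_cone R x -> B, forall p, F (ac p) = f p.
Proof. by move=> fr; apply: quotient_lift => p q [h1 h2]; exact: fr. Qed.

Lemma CAC_lift_homotopy (B : topologicalType) (f : acT * R -> B) :
  continuous f ->
  (forall p q t, pos p = pos q -> AC_apex (pos p) -> f (p, t) = f (q, t)) ->
  (forall c d t, c.2 = d.2 -> f (ac_base c, t) = f (ac_base d, t)) ->
  exists2 F : collapsed_alternating_cone R x * R -> B,
    continuous F & forall p t, F (cac p, t) = f (p, t).
Proof.
move=> cf fr fc; have [F cF FE] := AC_lift_homotopy cf fr.
have [|G cG GE] := @quotient_lift_homotopy R _ (collapse (@AC_square R X x)) B F cF.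
  by move=> _ _ t [s s0 s00 ss]; rewrite !AC_squareE !FE; apply: fc.
by exists G => // p t; rewrite /cac GE FE.
Qed.

Lemma CAC_lift (B : Type) (f : acT -> B) :
  (forall p q, pos p = pos q -> AC_apex (pos p) -> f p = f q) ->
  (forall c d, c.2 = d.2 -> f (ac_base c) = f (ac_base d)) ->
  exists F : collapsed_alternating_cone R x -> B, forall p, F (cac p) = f p.
Proof.
move=> fr fc; have [F FE] := AC_lift fr.
have [|G GE] := @quotient_lift _ (collapse (@AC_square R X x)) B F.
  by move=> _ _ [s s0 s00 ss]; rewrite !AC_squareE !FE; apply: fc.
by exists G => p; rewrite /cac GE FE.
Qed.

Lemma CAC_lift_continuous (B : topologicalType) (f : acT -> B) :
  continuous f ->
  (forall p q, pos p = pos q -> AC_apex (pos p) -> f p = f q) ->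
  (forall c d, c.2 = d.2 -> f (ac_base c) = f (ac_base d)) ->
  exists2 F : collapsed_alternating_cone R x -> B,
    continuous F & forall p, F (cac p) = f p.
Proof.
move=> cf fr fc.
have [|||F cF FE] := @CAC_lift_homotopy B (fun u => f u.1).
- by ccont.
- by move=> p q t; exact: fr.
- by move=> c d t; exact: fc.
by exists (fun z => F (z, 0)) => [|p]; [ccont|exact: FE].
Qed.

End alternating.

(** * Sequences contract in the alternating cones *)

Section alternating_sequences.
Variables (R : realType) (X : topologicalType) (x : X).
Hypothesis pX : path_connected R X.
Hypothesis cX : compact [set: X].
Hypothesis hX : hausdorff_space X.

Let acT := @acT R X x.
Let ac := @ac R X x.
Let cac := @cac R X x.
Let base := @ac_base R X x.

Lemma ac_position : exists2 F : alternating_cone R x -> R * R,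
  continuous F & forall p, F (ac p) = pos p.
Proof.
have [F FE] := @AC_lift R X x _ (@pos R X x) (fun p q h _ => h).
exists F => //; apply/quotient_continuous.
by rewrite (_ : _ \o _ = @pos R X x); [exact: pos_continuous|apply/funext => p; exact: FE].
Qed.

Lemma tube_cases (p : acT) : [\/ (pos p).1 = 0,
  exists2 n, (0 < n)%N & (pos p).1 = n%:R^-1 | fibre p = x].
Proof. by have [_] := acT_inP p. Qed.

Lemma fibre_path (p : acT) : exists g : R -> acT,
  [/\ continuous g, g 0 = p, g 1 = base (pos p) & forall t, pos (g t) = pos p].
Proof.
have [px|px] := pselect (fibre p = x).
  by exists (fun=> p); split => //; [ccont|exact: ac_baseE].
have [g cg [g0 g1]] := @path_clamp R X (fibre p) x pX.
have gin t : AC_pre x (g t, pos p).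
  have [h] := acT_inP p; case=> [h1|h1|//]; split => //; [exact: Or31|exact: Or32].
exists (fun t => mk_ac (gin t)); split => //.
- move=> t; apply: cvg_subtype.
  suff : continuous (fun t => (g t, pos p)) by apply.
  by ccont.
- by apply: acT_eq; rewrite // /fibre /= g0.
- rewrite /base -[pos p]/(pos (mk_ac (gin 1))) -ac_baseE//.
Qed.

(** The terms are moved within their fibres onto the square. The limit is not
    affected, since the fibres near the limit segment are small. *)
Lemma AC_sequences_limit (z : nat -> alternating_cone R x) p0 :
  z k @[k --> \oo] --> ac p0 -> (pos p0).1 = 0 ->
  exists w0, track R z (ac p0) (fun=> w0) w0.
Proof.
move=> zp a0; have [F cF FE] := ac_position.
have /choice[p pz] : forall k, exists p, ac p = z k by move=> k; exact: ac_surj.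
have /choice[g gP] := fun k => fibre_path (p k).
have cpos : pos (p k) @[k --> \oo] --> pos p0.
  rewrite -FE (_ : (fun k => pos (p k)) = F \o z).
    by apply: cvg_comp zp _; exact: cF.
  by apply/funext => k /=; rewrite -pz FE.
exists (ac (base (0, 0))).
apply: (@track_trans R _ z (fun k => ac (base (pos (p k)))) _ _ (ac (base (pos p0)))).
  exists (fun k t => ac (g k t)), (fun=> ac p0); split => //.
  - apply: nearW => k; have [cg g0 g1 _] := gP k; rewrite g0 g1 pz; split => //.
    by move=> t; apply: (@continuous_comp _ _ _ (g k) ac); [exact: cg|exact: ac_continuous].
  - by ccont.
  - by apply: ac_limit; rewrite // /base pos_base_pos.
  move=> t U Up0.
  have H : \forall c \near pos p0, forall q, pos q = c -> U (ac q).
    apply: ac_fibre_nbhs => //; first exact: ac_continuous.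
      move=> y; rewrite [pos _]surjective_pairing a0; apply: limit_fibre_in.
      by have [_] := pos_square p0.
    by move=> q qp; rewrite /ac (ac_limit qp)// qp.
  have [N _ HN] : \forall k \near \oo, forall q, pos q = pos (p k) -> U (ac q) by exact: cpos _ H.
  exists ([set k | (N <= k)%N], setT); first by split; [exists N|exact: filterT].
  by move=> [k s] /= [Nk _]; apply: (HN k Nk); have [_ _ _ ->] := gP k.
apply: (@square_contract R _ (fun c => ac (base c))) cpos.
move=> c; apply: (@continuous_comp _ _ _ base ac); [exact: ac_base_continuous|exact: ac_continuous].
Qed.

Lemma to_apex_in (n : nat) (p : acT) (t : R) : AC_pre x (fibre p,
  ((pos p).1, (pos p).2 + clamp t * tent n (pos p).1 * (apex_height R n - (pos p).2))).
Proof.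
have [sq h] := acT_inP p; have [a01 b01] := pos_square p; split => //.
split; rewrite /= in_itv //=.
have := apex_height01 R n; move: b01.
have : 0 <= clamp t * tent n (pos p).1 <= 1.
  by rewrite mulr_ge0 ?clamp_ge0//= mulr_ile1 ?clamp_ge0 ?clamp_le1.
move: (clamp t * _) (pos p).2 (apex_height R n) => l b a; nra.
Qed.

Definition to_apex (n : nat) (u : acT * R) : acT := mk_ac (to_apex_in n u.1 u.2).

Lemma to_apex_continuous n : continuous (to_apex n).
Proof.
move=> u; apply: cvg_subtype.
suff : continuous (fun u : acT * R => (fibre u.1, ((pos u.1).1, (pos u.1).2 +
    clamp u.2 * tent n (pos u.1).1 * (apex_height R n - (pos u.1).2)))) by apply.
rewrite /tent; have := @pos_continuous R X x; have := @fibre_continuous R X x => cf cp.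
by ccont.
Qed.

(** The tube is pushed to its apex, where the fibre coordinate is lost; the square
    next to it follows, all other tubes stay in place. *)
Lemma AC_sequences_tube (z : nat -> alternating_cone R x) p0 :
  z k @[k --> \oo] --> ac p0 -> (pos p0).1 != 0 ->
  exists w0, track R z (ac p0) (fun=> w0) w0.
Proof.
move=> zp a0; have [Q cQ QE] := ac_position.
have [/andP[a00 a1] _] := pos_square p0.
have {}a0 : 0 < (pos p0).1 by rewrite lt_neqAle eq_sym a0.
have [n n0 sn] := strip_exists a0 a1.
have [||F cF FE] := @AC_lift_homotopy R X x _ (fun u => ac (to_apex n u)).
- move=> u; apply: (@continuous_comp _ _ _ (to_apex n) ac).
    exact: to_apex_continuous.
  exact: ac_continuous.
- move=> p q t pq ap.
  have e : pos (to_apex n (p, t)) = pos (to_apex n (q, t)) by rewrite /pos /= -/(pos p) -/(pos q) pq.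
  apply: ac_apex e _.
  case/AC_apexP: ap => [[a0' b01]|[m m0 am]].
    by apply/AC_apexP; left; rewrite /pos /= -/(pos p) a0' tent0// mulr0 mul0r addr0.
  apply/AC_apexP; right; exists m => //; rewrite /pos /= -/(pos p) am /=.
  have [->|mn] := eqVneq m n; first by rewrite subrr mulr0 addr0.
  by rewrite tent_other// mulr0 mul0r addr0.
have tr := track_flow cF zp.
have e0 p : F (ac p, 0) = ac p.
  rewrite FE; congr ac; apply: acT_eq => //.
  by rewrite /pos /= clamp_le0// !mul0r addr0 -surjective_pairing.
have /choice[p pz] : forall k, exists p, ac p = z k by move=> k; exact: ac_surj.
have e1 q : strip n (pos q).1 -> F (ac q, 1) = ac (base (pos (to_apex n (q, 1)))).
  move=> sq; rewrite FE.
  case: (tube_cases q) => [q0|[m m0 qm]|qx].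
  - by case: sq => + _; rewrite q0 mulr0 ltr10.
  - have mn : m = n by apply: (@strip_unique R) => //; rewrite -qm.
    have ap : pos (to_apex n (q, 1)) = (n%:R^-1, apex_height R n).
      rewrite /pos /= -/(pos q) qm mn tent_self clamp_ge1// !mul1r.
      by rewrite addrCA subrr addr0.
    apply: ac_apex; last by apply/AC_apexP; right; exists n.
    by rewrite /base pos_base_pos.
  - by congr ac; exact: ac_baseE.
have cpos : Q (F (z k, 1)) @[k --> \oo] --> Q (F (ac p0, 1)).
  have cg : continuous (fun z => Q (F (z, 1))) by ccont.
  exact: (cvg_comp _ _ zp (cg (ac p0))).
exists (ac (base (0, 0))).
apply: (@track_trans R _ z (fun k => F (z k, 1)) _ _ (F (ac p0, 1))).
  by move: tr; rewrite e0; apply: track_eq; apply: nearW => k //=; rewrite -pz e0.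
have cb : continuous (fun c => ac (base c)).
  by move=> c; apply: (@continuous_comp _ _ _ base ac); [exact: ac_base_continuous|exact: ac_continuous].
have := square_contract cb cpos.
have Qe q : strip n (pos q).1 -> ac (base (Q (F (ac q, 1)))) = F (ac q, 1).
  move=> sq; rewrite FE QE; rewrite -FE e1//.
rewrite Qe//; apply: track_eq; last by apply: nearW.
have cz : continuous (fun z => (Q z).1) by ccont.
have : \forall k \near \oo, strip n (Q (z k)).1.
  have H : \forall z \near ac p0, strip n (Q z).1 by apply: strip_open; [exact: cz|rewrite QE].
  exact: zp _ H.
by apply: filterS => k /=; rewrite -pz QE => sk; rewrite Qe.
Qed.

Lemma AC_sequences : sequences_contract R (alternating_cone R x).
Proof.
move=> z z0; have [p0 <-] := ac_surj z0 => zp.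
have [a0|a0] := eqVneq (pos p0).1 0; first exact: AC_sequences_limit.
exact: AC_sequences_tube.
Qed.

(** The tubes coned off at height [0] ([e = true]) or at height [1]. *)
Definition in_tube (e : bool) (p : acT) : Prop :=
  exists n, [/\ (0 < n)%N, odd n = e & (pos p).1 = n%:R^-1].

Definition sel (e : bool) (p : acT) : X := if `[< in_tube e p >] then fibre p else x.

Definition cone_height (e : bool) : R := if e then 0 else 1.

Lemma cone_height01 e : 0 <= cone_height e <= 1.
Proof. by case: e; rewrite /= ?lexx ?ler01. Qed.

Lemma sel_base e p : fibre p = x -> sel e p = x.
Proof. by rewrite /sel; case: ifP. Qed.

Lemma sel_in e p b : 0 <= b <= 1 -> AC_pre x (sel e p, ((pos p).1, b)).
Proof.
move=> b01; have [a01 _] := pos_square p; split; first by split; rewrite /= in_itv.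
rewrite /sel; case: asboolP => [[n [n0 _ pn]]|_]; last exact: Or33.
by apply: Or32; exists n.
Qed.

Lemma cac_spine (p q : acT) : (fibre p = x \/ AC_apex (pos p)) ->
  (fibre q = x \/ AC_apex (pos q)) -> (pos p).2 = (pos q).2 -> cac p = cac q.
Proof.
have H r : (fibre r = x \/ AC_apex (pos r)) -> cac r = cac (base (pos r)).
  case=> [rx|ra]; first by congr cac; exact: ac_baseE.
  by congr (quotient_map _ _); apply: ac_apex; rewrite // /base pos_base_pos.
by move=> /H -> /H -> pq; apply: cac_baseE; rewrite pq.
Qed.

Section moves.
Variables (e : bool) (f : R -> R -> R).
Hypothesis fc : continuous (fun u : R * R => f u.1 u.2).
Hypothesis f01 : forall b t, 0 <= b <= 1 -> 0 <= f b t <= 1.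
Hypothesis fe : forall t, f (cone_height e) t = cone_height e.

Let mv_in (p : acT) (t : R) : AC_pre x (sel e p, ((pos p).1, f (pos p).2 t)).
Proof. by apply: sel_in; apply: f01; have [] := pos_square p. Qed.

Definition mv (u : acT * R) : acT := mk_ac (mv_in u.1 u.2).

Let cmv_pos : continuous (fun u : acT * R => pos (mv u)).
Proof.
rewrite (_ : (fun _ => _) = (fun u : acT * R => ((pos u.1).1, f (pos u.1).2 u.2)))//.
have cp := @pos_continuous R X x; move=> u.
apply: (@cont_at_pair _ _ _ (fun u : acT * R => (pos u.1).1) (fun u => f (pos u.1).2 u.2)); first by ccont.
apply: (@cont_at_comp _ _ _ (fun u : acT * R => ((pos u.1).2, u.2)) (fun u : R * R => f u.1 u.2)) => //.
by ccont.
Qed.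

Let cmv (p : acT) (t : R) : (pos p).1 != 0 -> cont_at mv (p, t).
Proof.
move=> a0; have [/andP[a00 a1] _] := pos_square p.
have {}a0 : 0 < (pos p).1 by rewrite lt_neqAle eq_sym a0.
have [n n0 sn] := strip_exists a0 a1.
apply: cvg_subtype.
suff cs : cont_at (fun u : acT * R => sel e u.1) (p, t).
  have cu : cont_at (fun u => pos (mv u)) (p, t) by exact: cmv_pos.
  exact: (cont_at_pair cs cu).
have cp := @pos_continuous R X x; have cf := @fibre_continuous R X x.
have strip_n : \forall u \near (p, t), strip n (pos u.1).1.
  have ca : cont_at (fun u : acT * R => (pos u.1).1) (p, t) by ccont.
  exact: (strip_open ca).
have tube_n (q : acT) m : strip n (pos q).1 -> (0 < m)%N -> (pos q).1 = m%:R^-1 -> m = n.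
  by move=> sq m0 qm; apply: (@strip_unique R) => //; rewrite -qm.
have [on|on] := eqVneq (odd n) e.
  apply: (@cont_at_near _ _ (fun u : acT * R => fibre u.1)); last by ccont.
  apply: filterS strip_n => u su; rewrite /sel; case: asboolP => // nt.
  case: (tube_cases u.1) => [q0|[m m0 qm]|->//].
    by case: su => + _; rewrite q0 mulr0 ltr10.
  by exfalso; apply: nt; exists m; split => //; rewrite (tube_n _ _ su m0 qm).
apply: (@cont_at_near _ _ (fun=> x)); last exact: cont_at_cst.
apply: filterS strip_n => u su; rewrite /sel; case: asboolP => // -[m [m0 om qm]].
by move: on; rewrite -om (tube_n _ _ su m0 qm) eqxx.
Qed.

(** Tubes of the parity [e] are moved up and down, which is possible as long as
    their apex stays in place; the other tubes are pressed onto the spine. *)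
Lemma CAC_move : exists2 F : collapsed_alternating_cone R x * R -> collapsed_alternating_cone R x,
  continuous F & forall p t, F (cac p, t) = cac (mv (p, t)).
Proof.
apply: (@CAC_lift_homotopy R X x _ (fun u => cac (mv u))).
- apply: ac_flow_continuous => //.
  + exact: cac_continuous.
  + by move=> p q; exact: cac_limit.
  + by move=> p t p0; split; [exact: cmv_pos|].
- move=> p q t pq ap.
  have e1 : pos (mv (p, t)) = pos (mv (q, t)) by rewrite /pos /= -/(pos p) -/(pos q) pq.
  case/AC_apexP: ap => [[a0 b01]|[n n0 an]]; first exact: cac_limit.
  have [on|on] := eqVneq (odd n) e; last first.
    have nt r : pos r = pos p -> sel e r = x.
      move=> rp; rewrite /sel; case: asboolP => // -[m [m0 om rm]].
      by move: on; rewrite -om; move: rm; rewrite rp an => /natV_inj ->; rewrite eqxx.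
    congr cac; apply: acT_eq => //; rewrite /fibre /= (nt p)// (nt q)//.
  congr (quotient_map _ _); apply: ac_apex => //; apply/AC_apexP; right; exists n => //.
  rewrite /pos /= -/(pos p) an /=; congr (_, _).
  by have := fe t; rewrite /cone_height /apex_height on.
- move=> c d t cd; apply: cac_spine.
  + by left; exact: sel_base.
  + by left; exact: sel_base.
  + by rewrite /pos /= cd.
Qed.

End moves.

(** The points that stay in place when the tubes of the parity other than [e] are
    pressed onto the spine. *)
Definition fixed_by (e : bool) (z : collapsed_alternating_cone R x) : Prop :=
  exists2 p, z = cac p & sel e p = fibre p.

Lemma fixed_by_cases z : fixed_by true z \/ fixed_by false z.
Proof.
have [p <-] := cac_surj z; case: (tube_cases p) => [p0|[n n0 pn]|px].
- left; exists (base (pos p)); last by rewrite sel_base.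
  by apply: cac_limit; rewrite /base ?pos_base_pos.
- have : in_tube (odd n) p by exists n.
  by case: (odd n) => pt; [left|right]; exists p; rewrite // /sel asboolT.
- by left; exists p; rewrite // sel_base.
Qed.

Lemma fixed_by_spine e p : (fibre p = x \/ AC_apex (pos p)) -> fixed_by e (cac p).
Proof.
move=> ps; exists (base (pos p)); last by rewrite sel_base.
by apply: cac_spine => //; [left|rewrite /base pos_base_pos].
Qed.

(** The height measured from the apex of the tubes of parity [e]. *)
Definition from_apex (e : bool) (b : R) : R := if e then b else 1 - b.

Lemma from_apexK e : involutive (from_apex e).
Proof. by case: e => b //=; rewrite opprB addrC subrK. Qed.

Lemma from_apex01 e b : 0 <= b <= 1 -> 0 <= from_apex e b <= 1.
Proof. by case: e => //= b01; lra. Qed.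

Lemma from_apexE e : from_apex e (cone_height e) = 0.
Proof. by case: e; rewrite //= subrr. Qed.

Lemma from_apex_continuous e : continuous (from_apex e).
Proof. by case: e; rewrite /from_apex; ccont. Qed.

Definition press (e : bool) (b t : R) : R :=
  from_apex e ((1 - clamp t) * from_apex e b).

(** Follows the motion towards the other end from the height [b0] on, and leaves
    the apex in place. *)
Definition stretch (e : bool) (b0 b t : R) : R :=
  from_apex e (Num.min (1 - (1 - clamp t) * (1 - from_apex e b))
                       (from_apex e b / from_apex e b0)).

Lemma press_cont e : continuous (fun u : R * R => press e u.1 u.2).
Proof.
by have ca := @from_apex_continuous e; rewrite /press; ccont.
Qed.

Lemma press01 e b t : 0 <= b <= 1 -> 0 <= press e b t <= 1.
Proof.
move=> /(from_apex01 e)/andP[h1 h2]; apply: from_apex01.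
by rewrite mulr_ge0 ?subr_ge0 ?clamp_le1//= mulr_ile1 ?subr_ge0 ?clamp_le1// gerBl clamp_ge0.
Qed.

Lemma press_apex e t : press e (cone_height e) t = cone_height e.
Proof. by rewrite /press from_apexE mulr0 -(from_apexE e) from_apexK. Qed.

Lemma press0 e b : press e b 0 = b.
Proof. by rewrite /press clamp_le0// subr0 mul1r from_apexK. Qed.

Lemma press1 e b : press e b 1 = cone_height e.
Proof. by rewrite /press clamp_ge1// subrr mul0r -(from_apexE e) from_apexK. Qed.

Section stretch.
Variables (e : bool) (b0 : R).
Hypotheses (b001 : 0 <= b0 <= 1) (b0e : b0 <> cone_height e).

Let d0 : 0 < from_apex e b0.
Proof.
have /andP[h _] := from_apex01 e b001; rewrite lt_neqAle h andbT eq_sym.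
by apply/eqP => h0; apply: b0e; rewrite -[b0](from_apexK e) h0 -(from_apexE e) from_apexK.
Qed.

Lemma stretch_cont : continuous (fun u : R * R => stretch e b0 u.1 u.2).
Proof.
by have ca := @from_apex_continuous e; rewrite /stretch; ccont.
Qed.

Lemma stretch01 b t : 0 <= b <= 1 -> 0 <= stretch e b0 b t <= 1.
Proof.
move=> /(from_apex01 e)/andP[h1 h2]; apply: from_apex01.
have : 0 <= (1 - clamp t) * (1 - from_apex e b) <= 1.
  rewrite mulr_ge0 ?subr_ge0 ?clamp_le1//= mulr_ile1 ?subr_ge0 ?clamp_le1// gerBl//.
  exact: clamp_ge0.
by rewrite le_min ge_min divr_ge0 ?(ltW d0)// => /andP[? ?]; apply/andP; split; [lra|apply/orP; left; lra].
Qed.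

Lemma stretch_apex t : stretch e b0 (cone_height e) t = cone_height e.
Proof.
rewrite /stretch from_apexE mul0r min_r; first by rewrite -(from_apexE e) from_apexK.
by rewrite subr0 mulr1 opprB addrC subrK clamp_ge0.
Qed.

Lemma stretch0 b : 0 <= b <= 1 -> stretch e b0 b 0 = b.
Proof.
move=> /(from_apex01 e)/andP[h1 h2].
rewrite /stretch clamp_le0// subr0 mul1r opprB addrC subrK min_l ?from_apexK//.
by rewrite ler_pdivlMr// ler_piMr//; have /andP[] := from_apex01 e b001.
Qed.

(** This is why a limit at height [b0] follows one path under both motions. *)
Lemma stretch_limit t : stretch e b0 b0 t = press (~~ e) b0 t.
Proof.
rewrite /stretch divff ?gt_eqF// min_l; last first.
  have /andP[h1 h2] := from_apex01 e b001.
  by rewrite gerBl mulr_ge0// subr_ge0// clamp_le1.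
by rewrite /press; case: (e) => //=; ring.
Qed.

End stretch.

Lemma mv_apex e f f01 p : (forall b, f b 1 = cone_height e) ->
  cac (@mv e f f01 (p, 1)) = cac (base (0, cone_height e)).
Proof.
move=> f1; apply: cac_spine; last 2 first.
- by left.
- by rewrite /pos /= f1 clamp_id// cone_height01.
rewrite /fibre /= /sel; case: asboolP => [[n [n0 on pn]]|]; last by left.
right; apply/AC_apexP; right; exists n => //.
by rewrite /pos /= -/(pos p) pn f1 /apex_height /cone_height on.
Qed.

Lemma mv_fixed e f f01 p : sel e p = fibre p ->
  (forall b, 0 <= b <= 1 -> f b 0 = b) -> @mv e f f01 (p, 0) = p.
Proof.
move=> sp f0; apply: acT_eq; first by rewrite -sp.
rewrite /pos /= -/(pos p) f0; first by rewrite -surjective_pairing.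
by have [] := pos_square p.
Qed.

Lemma fixed_by_mv e f f01 u : fixed_by e (cac (@mv e f f01 u)).
Proof.
exists (@mv e f f01 u) => //; rewrite {1}/sel; case: asboolP => [//|pt].
by rewrite /fibre /= /sel asboolF.
Qed.

Lemma CAC_press e (z : nat -> collapsed_alternating_cone R x) z0 :
  (\forall k \near \oo, fixed_by e (z k)) -> fixed_by e z0 -> z k @[k --> \oo] --> z0 ->
  exists w0, track R z z0 (fun=> w0) w0.
Proof.
move=> zf z0f zz0.
have [F cF FE] := @CAC_move e (press e) (@press_cont e) (@press01 e) (@press_apex e).
have F0 y : fixed_by e y -> F (y, 0) = y.
  by move=> [p -> sp]; rewrite FE mv_fixed// => b _; exact: press0.
have F1 y : F (y, 1) = cac (base (0, cone_height e)).
  by have [p <-] := cac_surj y; rewrite FE mv_apex// => b; exact: press1.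
exists (cac (base (0, cone_height e))).
have := track_flow cF zz0; rewrite F0// F1; apply: track_eq.
  by apply: filterS zf => k; exact: F0.
by apply: nearW => k; exact: F1.
Qed.

(** Near a point of the spine there are terms in tubes of both parities, while a
    motion of the tubes of one parity presses the others onto the spine. So the
    terms are divided: those of parity [e] are stretched towards the apex of the
    other tubes, and the remaining ones are pressed to this apex. Both motions
    induce the same path of the limit. Afterwards all terms have parity [e]. *)
Lemma CAC_unmix e (z : nat -> collapsed_alternating_cone R x) p0 :
  (fibre p0 = x \/ AC_apex (pos p0)) -> (pos p0).2 <> cone_height e ->
  z k @[k --> \oo] --> cac p0 ->
  exists w w0, [/\ track R z (cac p0) w w0, forall k, fixed_by e (w k) & fixed_by e w0].
Proof.
move=> sp b0e zp.
have [_ b001] := pos_square p0.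
set b0 := (pos p0).2 in b0e b001.
have [F1 cF1 FE1] := @CAC_move e (stretch e b0) (@stretch_cont e b0)
  (stretch01 b001 b0e) (@stretch_apex e b0).
have [F2 cF2 FE2] := @CAC_move (~~ e) (press (~~ e)) (@press_cont (~~ e))
  (@press01 (~~ e)) (@press_apex (~~ e)).
have F10 y : fixed_by e y -> F1 (y, 0) = y.
  by move=> [p -> sp']; rewrite FE1 mv_fixed// => b; exact: stretch0.
have F20 y : fixed_by (~~ e) y -> F2 (y, 0) = y.
  by move=> [p -> sp']; rewrite FE2 mv_fixed// => b _; exact: press0.
have F21 y : F2 (y, 1) = cac (base (0, cone_height (~~ e))).
  by have [p <-] := cac_surj y; rewrite FE2 mv_apex// => b; exact: press1.
have p0E : cac p0 = cac (base (0, b0)).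
  by apply: cac_spine => //; [left|rewrite /pos /= clamp_id].
have FF t : F1 (cac p0, t) = F2 (cac p0, t).
  rewrite p0E FE1 FE2; congr cac; apply: acT_eq.
    by rewrite /fibre /= !sel_base.
  by rewrite /pos /= (@clamp_id _ b0)// stretch_limit.
pose b k := `[< fixed_by e (z k) >].
pose f k t := if b k then F1 (z k, t) else F2 (z k, t).
have fb y : fixed_by e (F1 (y, 1)).
  have [p <-] := cac_surj y; rewrite FE1; exact: fixed_by_mv.
exists (fun k => f k 1), (F1 (cac p0, 1)); split => //; last first.
  move=> k; rewrite /f; case: ifP => _; first exact: fb.
  by rewrite F21; apply: fixed_by_spine; left.
exists f, (fun t => F1 (cac p0, t)); split => //.
- apply: nearW => k; rewrite /f /b; case: asboolP => zk; split => //; try by ccont.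
    exact: F10.
  apply: F20; have := fixed_by_cases (z k).
  by case: (e) zk => zk [].
- by ccont.
- by rewrite F10// p0E; apply: fixed_by_spine; left.
rewrite (_ : f = fun k => if b k then fun t => F1 (z k, t) else fun t => F2 (z k, t)); last first.
  by apply/funext => k; apply/funext => t; rewrite /f; case: ifP.
apply: fcvg_if; first exact: fcvg_flow.
rewrite (_ : (fun t => F1 _) = fun t => F2 (cac p0, t)); first exact: fcvg_flow.
by apply/funext => t; exact: FF.
Qed.

Definition in_open_tube (e : bool) (p : acT) : Prop :=
  [/\ in_tube e p, fibre p <> x & (pos p).2 <> cone_height e].

Lemma open_tube_near e (z : nat -> collapsed_alternating_cone R x) p0 :
  in_open_tube e p0 -> z k @[k --> \oo] --> cac p0 ->
  \forall k \near \oo, fixed_by e (z k).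
Proof.
move=> p0t zp.
have [||P PE] := @CAC_lift R X x _ (in_open_tube e).
- move=> p q pq ap; suff H r : AC_apex (pos r) -> ~ in_open_tube e r.
    by apply/propext; split => h; exfalso; [exact: (H p)|apply: (H q) => //; rewrite -pq].
  case/AC_apexP => [[r0 _] [[n [n0 _ rn]] _ _]|[n n0 rn] [[m [m0 om rm]] _]].
    by move: rn; rewrite r0 => /eqP; rewrite eq_sym invr_eq0 pnatr_eq0 -leqn0 leqNgt n0.
  by move: rm; rewrite rn => /natV_inj nm; apply; rewrite /apex_height /cone_height nm om.
- by move=> c d _; apply/propext; split => -[_ []].
have oP : open [set z | P z].
  apply: quotient_openP; apply: quotient_openP; rewrite openE => p /=.
  rewrite -/(ac p) -/(cac p) PE => -[[n [n0 on pn]] px pe].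
  have cp := @pos_continuous R X x; have cf := @fibre_continuous R X x.
  have n1 : \forall q \near p, strip n (pos q).1.
    apply: strip_open; first by ccont.
    rewrite pn; split.
      by rewrite ltr_pdivlMr ?ltr0n// mul1r ltr_nat.
    by rewrite ltr_pdivrMr ?ltr0n// mul1r ltr_nat prednK.
  have n2 : \forall q \near p, fibre q <> x.
    have ox : open (~` [set x]) by apply: closed_openC; exact: accessible_closed_set1 (hausdorff_accessible hX) _.
    have nx : nbhs (fibre p) (~` [set x]) by apply: open_nbhs_nbhs.
    exact: cf p _ nx.
  have n3 : \forall q \near p, (pos q).2 <> cone_height e.
    have oh : open (~` [set cone_height e]).
      by apply: closed_openC; exact: accessible_closed_set1 (hausdorff_accessible (@norm_hausdorff R R)) _.
    have nh : nbhs (pos p).2 (~` [set cone_height e]) by apply: open_nbhs_nbhs.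
    have c2 : continuous (fun q : acT => (pos q).2) by ccont.
    exact: c2 p _ nh.
  apply: filterS3 n1 n2 n3 => q q1 q2 q3; rewrite /= -/(ac q) -/(cac q) PE; split => //.
  case: (tube_cases q) => [q0|[m m0 qm]|//].
    by case: q1 => + _; rewrite q0 mulr0 ltr10.
  exists m; split => //; rewrite -on; congr odd; apply: (@strip_unique R) => //.
  by rewrite -qm.
have : \forall k \near \oo, P (z k).
  have Pp : nbhs (cac p0) [set z | P z] by apply: (open_nbhs_nbhs (conj oP _)); rewrite /= PE.
  exact: zp _ Pp.
apply: filterS => k; have [p <-] := cac_surj (z k); rewrite PE => -[pt _ _].
by exists p; rewrite // /sel asboolT.
Qed.

Lemma CAC_sequences : sequences_contract R (collapsed_alternating_cone R x).
Proof.
move=> z z0; have [p0 <-] := cac_surj z0 => zp.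
have [h|h] := pselect (exists e, in_open_tube e p0).
  case: h => e he; apply: (CAC_press (e := e)) => //; first exact: open_tube_near zp.
  by case: he => pt _ _; exists p0; rewrite // /sel asboolT.
have sp : fibre p0 = x \/ AC_apex (pos p0).
  have [px|px] := pselect (fibre p0 = x); [by left|right].
  have [_ b01] := pos_square p0.
  case: (tube_cases p0) => [q0|[m m0 qm]|//]; apply/AC_apexP; [by left|right; exists m => //].
  have [pe|pe] := pselect ((pos p0).2 = cone_height (odd m)).
    by rewrite [pos p0]surjective_pairing qm pe.
  by exfalso; apply: h; exists (odd m); split => //; exists m.
have [e pe] : exists e, (pos p0).2 <> cone_height e.
  have [p1|p1] := pselect ((pos p0).2 = cone_height true); last by exists true.
  by exists false; rewrite p1 /=; apply/eqP; rewrite eq_sym oner_eq0.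
have [w [w0 [tw wf w0f]]] := CAC_unmix sp pe zp.
have wf' : \forall k \near \oo, fixed_by e (w k) by apply: nearW.
have [v0 tv] := CAC_press wf' w0f (track_cvg tw).
by exists v0; exact: track_trans tw tv.
Qed.

End alternating_sequences.

(** * Sequences contract in the snake cone of a contractible space *)

Section sine_closed.
Variable R : realType.

Let slant (n : nat) (b : R) : R := b / n%:R + (1 - b) / n.+1%:R.

(** The complement of the gaps between consecutive segments, as an intersection of
    closed sets. *)
Let gaps : set (R * R) := [set c | [/\ 0 <= c.1 <= 1, 0 <= c.2 <= 1 & forall n, (0 < n)%N ->
  (c.1 <= slant n c.2 \/ n%:R^-1 <= c.1) /\ (c.1 <= n.+1%:R^-1 \/ slant n c.2 <= c.1)]].

Let slant_bounds n b : (0 < n)%N -> 0 <= b <= 1 -> n.+1%:R^-1 <= slant n b <= n%:R^-1.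
Proof.
move=> n0 /andP[b0 b1].
have : n.+1%:R^-1 <= n%:R^-1 :> R by rewrite lef_pV2 ?posrE ?ltr0n// ler_nat.
rewrite /slant; move: (n%:R^-1) (n.+1%:R^-1) => P Q PQ; apply/andP; split; nra.
Qed.

Let sine_gaps : sine_curve R `<=` gaps.
Proof.
move=> c Tc; have [c1 c2] := square_snd (sine_curve_sub_square Tc).
split => // n n0; have /andP[s1 s2] := slant_bounds n0 c2.
have [_ [c0|[m m0 cm]]] := sine_curveP Tc.
  split; left; rewrite c0 ?invr_ge0 ?ler0n//.
  by apply: le_trans s1; rewrite invr_ge0 ler0n.
have cmm : m.+1%:R^-1 <= c.1 <= m%:R^-1.
  case: cm => ->; last exact: (slant_bounds m0 c2).
  by rewrite lexx andbT lef_pV2 ?posrE ?ltr0n// ler_nat.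
case/andP: cmm => cm1 cm2.
have le k l : (0 < k)%N -> (k <= l)%N -> l%:R^-1 <= k%:R^-1 :> R.
  by move=> k0 kl; rewrite lef_pV2 ?posrE ?ltr0n ?ler_nat//; exact: leq_trans kl.
case: (ltngtP n m) => [nm|mn|nm].
- have h : c.1 <= n.+1%:R^-1 by apply: (le_trans cm2); exact: le.
  by split; left => //; exact: le_trans h s1.
- have h : n%:R^-1 <= c.1 by apply: le_trans cm1; exact: le.
  by split; right => //; exact: le_trans s2 h.
- move: s1 s2; rewrite nm => s1 s2; case: cm => ->; first by split; right.
  by split; [left|right]; rewrite lexx.
Qed.

Let gaps_sine : gaps `<=` sine_curve R.
Proof.
move=> [a b] [/= /andP[a0 a1] b01 cn].
have [a00|an0] := eqVneq a 0; first by left; apply/limit_segmentP; rewrite a00.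
have {}a0 : 0 < a by rewrite lt_neqAle eq_sym an0.
right; pose n := Num.truncn a^-1.
have /andP[n1 n2] : n%:R <= a^-1 < n.+1%:R by apply: truncn_itv; rewrite invr_ge0 ltW.
have n0 : (0 < n)%N by rewrite -ltnS -(ltr_nat R) (le_lt_trans _ n2)// invf_ge1.
exists n => //.
have [g1 g2] := cn n n0.
have an : a <= n%:R^-1 by rewrite -[a]invrK lef_pV2 ?posrE ?invr_gt0 ?ltr0n.
have an' : n.+1%:R^-1 < a by rewrite -[ltRHS]invrK ltf_pV2 ?posrE ?invr_gt0 ?ltr0n.
have sc (u v : R) : u *: (v : R^o) = u * v by [].
have [na|na] := lerP n%:R^-1 a.
  left; have -> : a = n%:R^-1 by apply/eqP; rewrite eq_le an.
  exists b; first by rewrite /= in_itv.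
  by apply: injective_projections; rewrite /GRing.scale /= !sc; ring.
right; exists (1 - b); first by rewrite /= in_itv /=; lra.
have -> : a = slant n b.
  apply/eqP; rewrite eq_le; apply/andP; split.
    by case: g1 => // /(lt_le_trans na); rewrite ltxx.
  by case: g2 => // /(lt_le_trans an'); rewrite ltxx.
by apply: injective_projections; rewrite /GRing.scale /= !sc ?/slant; ring.
Qed.

Lemma sine_curve_closed : closed (sine_curve R).
Proof.
have -> : sine_curve R = gaps by apply/seteqP; split.
have c1 : continuous (fun z : R * R => z.1) by ccont.
have c2 : continuous (fun z : R * R => z.2) by ccont.
rewrite (_ : gaps = [set c | 0 <= c.1] `&` [set c | c.1 <= 1] `&`
  ([set c | 0 <= c.2] `&` [set c | c.2 <= 1]) `&`
  \bigcap_(n in [set n | (0 < n)%N])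
    (([set c | c.1 <= slant n c.2] `|` [set c | n%:R^-1 <= c.1]) `&`
     ([set c | c.1 <= n.+1%:R^-1] `|` [set c | slant n c.2 <= c.1]))).
  apply: closedI; first by apply: closedI; apply: closedI; apply: closed_le_cont => //; ccont.
  by apply: closed_bigI => n _; apply: closedI; apply: closedU;
    apply: closed_le_cont; rewrite /slant => //; ccont.
apply/seteqP; split => [c [/andP[a b] /andP[d e] f]|c [[[a b] [d e]] f]].
  by split; [split; split|move=> n n0; have [h1 h2] := f n n0; split; [exact: h1|exact: h2]].
by split; [apply/andP; split|apply/andP; split|move=> n n0; have [h1 h2] := f n n0; split; [exact: h1|exact: h2]].
Qed.

End sine_closed.

Section snake_sequences.
Variables (R : realType) (X : topologicalType) (x : X).
Hypothesis pX : path_connected R X.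
Hypothesis cX : compact [set: X].
Hypothesis hX : hausdorff_space X.

Let tube := @sc_tube R X x.
Let square := @sc_square R X x.

Lemma sc_position : exists2 r : snake_cone R x -> R * R, continuous r &
  (forall y t, r (tube y t) = set_val t) /\ (forall s, r (square s) = set_val s).
Proof. by apply: (@SC_lift R X x _ (fun p => p.2)) => //; ccont. Qed.

Definition sq_pt (c : R * R) : squareT R :=
  exist _ (clamp c.1, clamp c.2) (mem_set (clamp_square c)).

Lemma sq_pt_continuous : continuous sq_pt.
Proof.
move=> c; apply: cvg_subtype.
suff : continuous (fun c : R * R => (clamp c.1, clamp c.2)) by apply.
by ccont.
Qed.

Lemma sq_ptK (s : squareT R) : sq_pt (set_val s) = s.
Proof.
apply: val_inj => /=; have [h1 h2] := square_snd (set_valP s).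
by rewrite !clamp_id// -surjective_pairing.
Qed.

Lemma square_pt_continuous : continuous (fun c => square (sq_pt c)).
Proof.
move=> c; apply: (@continuous_comp _ _ _ sq_pt square); first exact: sq_pt_continuous.
exact: sc_square_continuous.
Qed.

Lemma square_pt_comp (T : topologicalType) (f : T -> R * R) :
  continuous f -> continuous (fun u => square (sq_pt (f u))).
Proof.
move=> cf u; apply: (@cont_at_comp _ _ _ f (fun c => square (sq_pt c))); last exact: cf.
exact: square_pt_continuous.
Qed.

Lemma square_sequences (s : nat -> squareT R) s0 :
  square (s k) @[k --> \oo] --> square s0 ->
  exists w0, track R (square \o s) (square s0) (fun=> w0) w0.
Proof.
move=> ss; have [r cr [_ rE]] := sc_position.
have rr : r (square (s k)) @[k --> \oo] --> r (square s0).
  by apply: cvg_comp ss _; exact: cr.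
exists (square (sq_pt (0, 0))).
have := square_contract square_pt_continuous rr; rewrite rE sq_ptK.
by apply: track_eq; apply: nearW => k //=; rewrite rE sq_ptK.
Qed.

(** Compactness of [X]: over the limit segment, neighbourhoods contain all fibres
    over the nearby points. *)
Lemma sc_fibre_nbhs (s0 : squareT R) (U : set (snake_cone R x)) :
  (set_val s0).1 = 0 -> nbhs (square s0) U ->
  \forall c \near set_val s0,
    (forall y t, set_val t = c -> U (tube y t)) /\ (forall s, set_val s = c -> U (square s)).
Proof.
move=> s01 Us.
have Ls : limit_segment R (set_val s0).
  by apply/limit_segmentP; split => //; have [_ ?] := square_snd (set_valP s0).
have Ts : sine_curve R (set_val s0) by left.
pose t0 : sineT R := exist _ (set_val s0) (mem_set Ts).
have tubeE y : tube y t0 = square s0.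
  by rewrite /tube sc_tube_limit//; congr (sc_square _ _); exact: val_inj.
have near1 : \forall c \near set_val s0, forall y t, set_val t = c -> U (tube y t).
  have /compact_near_coveringP cX' := cX.
  suff H : \forall c \near set_val s0, [set: X] `<=` (fun y => forall t, set_val t = c -> U (tube y t)).
    by apply: filterS H => c Hc y; exact: Hc.
  apply: (cX' _ (nbhs (set_val s0)) (fun c y => forall t, set_val t = c -> U (tube y t))) => y _.
  have Uy : nbhs (y, t0) [set p | U (tube p.1 p.2)].
    by apply: (@sc_tube_continuous R X x (y, t0)); rewrite /= -/(tube y t0) tubeE.
  case: Uy => -[/= V1 V2] [/= V1y V2t] V12.
  have [W Wt WV] := nbhs_subtypeP V2t.
  exists (V1, W) => //= -[y' c] /= [V1y' Wc] t tc.
  by apply: (V12 (y', t)); split => //; apply: WV; rewrite /= tc.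
have near2 : \forall c \near set_val s0, forall s, set_val s = c -> U (square s).
  have [W Wt WV] := nbhs_subtypeP (@sc_square_continuous R X x s0 U Us).
  by apply: filterS Wt => c Wc s sc; apply: WV; rewrite /= sc.
by apply: filterS2 near1 near2 => c h1 h2; split.
Qed.

(** As in the alternating cone: near the limit segment the fibres are small. *)
Lemma sc_sequences_limit (z : nat -> snake_cone R x) s0 :
  (set_val s0).1 = 0 -> z k @[k --> \oo] --> square s0 ->
  exists w0, track R z (square s0) (fun=> w0) w0.
Proof.
move=> s01 zs; have [r cr [rt rs]] := sc_position.
have /choice[g gP] : forall k, exists g : R -> snake_cone R x,
    [/\ continuous g, g 0 = z k, exists s, g 1 = square s & forall u, r (g u) = r (z k)].
  move=> k; have [[y [t zE]]|[s zE]] := sc_cases (z k); last first.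
    by exists (fun=> z k); split => //; [ccont|exists s].
  have [p cp [p0 p1]] := @path_clamp R X y x pX.
  exists (fun u => tube (p u) t); split.
  - move=> u; apply: (@cont_at_comp _ _ _ (fun u => (p u, t)) (fun q : X * sineT R => tube q.1 q.2)).
      exact: sc_tube_continuous.
    by ccont.
  - by rewrite p0 zE.
  - by exists (sine_to_square t); rewrite p1; exact: sc_tube_base.
  - by move=> u; rewrite rt zE rt.
have /choice[s sE] : forall k, exists s, g k 1 = square s by move=> k; case: (gP k).
have tr : track R z (square s0) (square \o s) (square s0).
  exists g, (fun=> square s0); split => //.
  - by apply: nearW => k; have [? ? _ _] := gP k; split.
  - by ccont.
  move=> u U Us.
  have Hc := sc_fibre_nbhs s01 Us.
  have rz : r (z k) @[k --> \oo] --> set_val s0.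
    by rewrite -rs; apply: cvg_comp zs _; exact: cr.
  have [N _ HN] : \forall k \near \oo, (forall y t, set_val t = r (z k) -> U (tube y t)) /\
      (forall s, set_val s = r (z k) -> U (square s)) by exact: rz _ Hc.
  exists ([set k | (N <= k)%N], setT); first by split; [exists N|exact: filterT].
  move=> [k v] /= [Nk _]; have [U1 U2] := HN k Nk; have [_ _ _ gr] := gP k.
  have := gr v; have [[y [t ->]]|[s' ->]] := sc_cases (g k v).
    by rewrite rt; exact: U1.
  by rewrite rs; exact: U2.
have [w0 tw] := square_sequences (track_cvg tr).
by exists w0; exact: track_trans tr tw.
Qed.

Lemma sc_sequences_off_sine (z : nat -> snake_cone R x) s0 :
  ~ sine_curve R (set_val s0) -> z k @[k --> \oo] --> square s0 ->
  exists w0, track R z (square s0) (fun=> w0) w0.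
Proof.
move=> Ts zs; have [r cr [rt rs]] := sc_position.
have : \forall k \near \oo, ~ sine_curve R (r (z k)).
  have rz : r (z k) @[k --> \oo] --> set_val s0.
    by rewrite -rs; apply: cvg_comp zs _; exact: cr.
  have oT : open (~` sine_curve R) by apply: closed_openC; exact: sine_curve_closed.
  exact: rz _ (open_nbhs_nbhs (conj oT Ts)).
move=> [N _ HN].
have sE k : (N <= k)%N -> z k = square (sq_pt (r (z k))).
  move=> Nk; have := HN k Nk; have [[y [t ->]]|[s ->]] := sc_cases (z k).
    by rewrite /= rt => h; exfalso; apply: h; exact: set_valP.
  by rewrite rs sq_ptK.
have zE : \forall k \near \oo, square (sq_pt (r (z k))) = z k.
  by exists N => // k /= Nk; rewrite -sE.
have [|w0 tw] := @square_sequences (fun k => sq_pt (r (z k))) s0.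
  by apply: cvg_trans zs; apply: near_eq_cvg; apply: filterS zE => k.
by exists w0; apply: track_eq zE _ tw; apply: nearW.
Qed.

(** Near a point of a tube off the limit segment, the fibre coordinate varies
    continuously, the square counting as fibre coordinate [x]. *)
Lemma sc_tube_near (z : nat -> snake_cone R x) y (t : sineT R) (N : set X) :
  (set_val t).1 != 0 -> z k @[k --> \oo] --> tube y t -> open N -> N y ->
  \forall k \near \oo, (forall y' t', z k = tube y' t' -> N y') /\
    (forall s, z k = square s -> N x).
Proof.
move=> t0 zt oN Ny.
pose f (b : bool) : (if b then ((X * sineT R)%type : topologicalType) else squareT R) -> Prop :=
  match b return (if b then ((X * sineT R)%type : topologicalType) else squareT R) -> Prop with
  | true => fun p => N p.1 /\ (set_val p.2).1 != 0
  | false => fun s => N x /\ (set_val s).1 != 0 end.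
have [|P PE] := @quotient_lift _ (@SC_glue R X x) Prop (fun a => f (projT1 a) (projT2 a)).
  move=> a b [t' s /= -> //|y' t' s /= ts /limit_segmentP[t1 _]] /=.
  by apply/propext; rewrite -ts t1 eqxx; split => -[].
have Pt y' t' : P (tube y' t') = (N y' /\ (set_val t').1 != 0).
  exact: (PE (topinl (y', t'))).
have Ps s : P (square s) = (N x /\ (set_val s).1 != 0).
  exact: (PE (topinr s)).
have on0 (T : topologicalType) (g : T -> R) : continuous g -> open [set u | g u != 0].
  move=> cg; rewrite (_ : [set _ | _] = ~` [set u | g u <= 0] `|` ~` [set u | 0 <= g u]).
    by apply: openU; apply: closed_openC; apply: closed_le_cont => //; ccont.
  apply/seteqP; split => u /=.
    by rewrite neq_lt => /orP[]; [right|left]; apply/negP; rewrite -ltNge.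
  by rewrite neq_lt => -[/negP|/negP]; rewrite -ltNge => ->; rewrite ?orbT.
have oP : open [set u | P u].
  apply: quotient_openP; apply/sigT_openP => -[].
    rewrite (_ : _ @^-1` _ = [set p : X * sineT R | N p.1] `&` [set p | (set_val p.2).1 != 0]).
      apply: openI; last by apply: on0; ccont.
      by apply: (@open_comp _ _ (fst : X * sineT R -> X)) => // p _; exact: cvg_fst.
    by apply/seteqP; split => -[y' t'] /=; rewrite -/(tube y' t') Pt.
  have [Nx|Nx] := pselect (N x); last first.
    rewrite (_ : _ @^-1` _ = set0); first exact: open0.
    by apply/seteqP; split => s //=; rewrite -/(square s) Ps => -[].
  rewrite (_ : _ @^-1` _ = [set s : squareT R | (set_val s).1 != 0]).
    by apply: on0; ccont.
  by apply/seteqP; split => s /=; rewrite -/(square s) Ps => // -[].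
have : \forall k \near \oo, P (z k).
  have Pz : P (tube y t) by rewrite Pt.
  exact: zt _ (open_nbhs_nbhs (conj oP Pz)).
apply: filterS => k Pk; split => [y' t'|s] zE; move: Pk; rewrite zE.
  by rewrite Pt => -[].
by rewrite Ps => -[].
Qed.

(** All terms lie in the tubes: contract [X] and return along the path that the
    contraction describes. *)
Lemma sc_sequences_tube (G : X * R -> X) v (y : nat -> X) (t : nat -> sineT R) y0 t0 :
  continuous G -> (forall y, G (y, 0) = y) -> (forall y, G (y, 1) = v) ->
  y k @[k --> \oo] --> y0 -> t k @[k --> \oo] --> t0 ->
  exists w0, track R (fun k => tube (y k) (t k)) (tube y0 t0) (fun=> w0) w0.
Proof.
move=> cG G0 G1 yy tt.
have ct := @sc_tube_continuous R X x.
have cH (g : (X * sineT R) * R -> X * sineT R) : continuous g -> continuous (fun u => tube (g u).1 (g u).2).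
  move=> cg; apply: (@continuousE _ _ (fun u => tube (g u).1 (g u).2)) => u.
  apply: (@cont_at_comp _ _ _ g (fun p : X * sineT R => tube p.1 p.2)) => //; exact: cg.
have cH1 : continuous (fun u : (X * sineT R) * R => tube (G (u.1.1, u.2)) u.1.2).
  by apply: (cH (fun u => (G (u.1.1, u.2), u.1.2))); ccont.
have cH2 : continuous (fun u : (X * sineT R) * R => tube (G (x, 1 - u.2)) u.1.2).
  by apply: (cH (fun u => (G (x, 1 - u.2), u.1.2))); ccont.
have yt : (y k, t k) @[k --> \oo] --> (y0, t0) by exact: (@cvg_pair _ _ _ \oo (nbhs y0) (nbhs t0) _ _ _ y t yy tt).
have t1 : track R (fun k => tube (y k) (t k)) (tube y0 t0) (fun k => tube v (t k)) (tube v t0).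
  have := track_flow cH1 yt; rewrite /= G0 G1; apply: track_eq; apply: nearW => k /=.
    by rewrite G0.
  by rewrite G1.
have t2 : track R (fun k => tube v (t k)) (tube v t0) (fun k => tube x (t k)) (tube x t0).
  by have := track_flow cH2 yt; rewrite /= subr0 subrr G0 G1.
have tr : track R (fun k => tube (y k) (t k)) (tube y0 t0) (fun k => tube x (t k)) (tube x t0).
  exact: track_trans t1 t2.
have sE s : tube x s = square (sine_to_square s) by exact: sc_tube_base.
have := track_cvg tr; rewrite sE (_ : (fun k => tube x (t k)) = fun k => square (sine_to_square (t k))).
  move=> /square_sequences[w0 tw]; exists w0; apply: track_trans tr _.
  rewrite sE; apply: track_eq _ _ tw; apply: nearW => k //=; by rewrite sE.
by apply/funext => k; exact: sE.
Qed.

Lemma SC_sequences (G : X * R -> X) v :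
  continuous G -> (forall y, G (y, 0) = y) -> (forall y, G (y, 1) = v) ->
  sequences_contract R (snake_cone R x).
Proof.
move=> cG G0 G1 z z0 zz0.
have onsquare s0 : (set_val s0).1 = 0 \/ ~ sine_curve R (set_val s0) ->
    z0 = square s0 -> exists w0, track R z z0 (fun=> w0) w0.
  move=> h zs; rewrite zs in zz0 *; case: h => h.
    exact: sc_sequences_limit.
  exact: sc_sequences_off_sine.
have ontube y (t : sineT R) : (set_val t).1 != 0 -> z0 = tube y t ->
    exists w0, track R z z0 (fun=> w0) w0.
  move=> t0 zE; rewrite zE in zz0 *.
  have [r cr [rt rs]] := sc_position.
  have rz : r (z k) @[k --> \oo] --> set_val t.
    by rewrite -(rt y); apply: cvg_comp zz0 _; exact: cr.
  pose b k := `[< exists y' t', z k = tube y' t' >].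
  have bs k : ~~ b k -> exists s, z k = square s.
    by move=> /asboolPn nb; have [//|] := sc_cases (z k).
  pose w k := if b k then z k else tube y t.
  (* The terms of the square that approach a point of the tube exist only if it
     lies over the base point; they move straight to this point. *)
  have tw : track R z (tube y t) w (tube y t).
    have [yx|yx] := pselect (y = x); last first.
      have ox : open (~` [set x]) by apply: closed_openC; exact: accessible_closed_set1 (hausdorff_accessible hX) _.
      exists (fun k _ => z k), (fun=> tube y t); split => //.
      + apply: filterS (sc_tube_near t0 zz0 ox yx) => k [_ h]; split => //; first by ccont.
        rewrite /w; case: ifPn => // /bs[s zs]; exfalso.
        exact: (h s zs) erefl.
      + by ccont.
      + move=> u U Ut; exists ([set k | U (z k)], setT); last by move=> [k v1] [].
        by split; [exact: zz0|exact: filterT].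
    pose g k u := square (sq_pt ((1 - u) * (r (z k)).1 + u * (set_val t).1,
                                 (1 - u) * (r (z k)).2 + u * (set_val t).2)).
    have tE : tube y t = square (sq_pt (set_val t)).
      rewrite yx /tube sc_tube_base; congr (sc_square _ _).
      by rewrite -[RHS](_ : sq_pt (set_val (sine_to_square t)) = _)// sq_ptK.
    exists (fun k => if b k then fun=> z k else g k), (fun=> tube y t); split => //.
    + apply: nearW => k; rewrite /w; case: ifPn => [_|/bs[s zs]]; first by split => //; ccont.
      split; rewrite /g.
      * apply: (@square_pt_comp R (fun u : R => ((1 - u) * (r (z k)).1 + u * (set_val t).1,
                                 (1 - u) * (r (z k)).2 + u * (set_val t).2))); ccont.
      * by rewrite !subr0 !mul1r !mul0r !addr0 -surjective_pairing zs rs sq_ptK.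
      * by rewrite !subrr !mul1r !mul0r !add0r -surjective_pairing.
    + by ccont.
    + apply: fcvg_if.
        move=> u U Ut; exists ([set k | U (z k)], setT); last by move=> [k v1] [].
        by split; [exact: zz0|exact: filterT].
      have cg : continuous (fun p : (R * R) * R => square (sq_pt (
          (1 - p.2) * p.1.1 + p.2 * (set_val t).1, (1 - p.2) * p.1.2 + p.2 * (set_val t).2))).
        apply: (@square_pt_comp _ (fun p : (R * R) * R =>
          ((1 - p.2) * p.1.1 + p.2 * (set_val t).1, (1 - p.2) * p.1.2 + p.2 * (set_val t).2))).
        by ccont.
      have := fcvg_flow cg rz.
      rewrite (_ : (fun u => square (sq_pt _)) = fun=> tube y t)//.
      apply/funext => u; rewrite tE; congr (square (sq_pt _)).
      by rewrite [RHS]surjective_pairing; congr (_, _); ring.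
  have /choice[p pE] : forall k, exists p : X * sineT R, w k = tube p.1 p.2.
    move=> k; rewrite /w /b; case: asboolP => [[y' [t' ->]]|_]; first by exists (y', t').
    by exists (y, t).
  have wc := track_cvg tw.
  have yc : (p k).1 @[k --> \oo] --> y.
    move=> U; rewrite nbhsE => -[N [oN Ny] NU].
    have H := sc_tube_near t0 wc oN Ny.
    suff : \forall k \near \oo, U (p k).1 by [].
    by apply: filterS H => k [h _]; apply: NU; apply: h; exact: pE.
  have tc : (p k).2 @[k --> \oo] --> t.
    apply: cvg_subtype; rewrite -(rt y) (_ : (fun k => _) = r \o w).
      by apply: cvg_comp wc _; exact: cr.
    by apply/funext => k /=; rewrite pE rt.
  have [w0 tw0] := sc_sequences_tube cG G0 G1 yc tc.
  exists w0; apply: track_trans tw _; move: tw0; apply: track_eq.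
    by apply: nearW => k; rewrite pE.
  by apply: nearW.
have [[y [t zE]]|[s zE]] := sc_cases z0.
  have [t0|t0] := eqVneq (set_val t).1 0; last exact: ontube zE.
  apply: (onsquare (sine_to_square t)); first by left.
  rewrite zE; apply: sc_tube_limit; apply/limit_segmentP; split => //.
  by have [_] := square_snd (sine_square t).
have [s0|s0] := eqVneq (set_val s).1 0; first by apply: onsquare zE; left.
have [Ts|Ts] := pselect (sine_curve R (set_val s)); last by apply: onsquare zE; right.
pose t : sineT R := exist _ (set_val s) (mem_set Ts).
apply: (ontube x t) => //; rewrite zE /tube sc_tube_base; congr (sc_square _ _).
exact: val_inj.
Qed.

End snake_sequences.

(** * The alternating cone of a contractible space is contractible *)

Section pasted_homotopies.
Variable R : realType.

Definition deformation (A B : topologicalType) (f g : A -> B) : Prop :=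
  exists H : A * R -> B, [/\ continuous H, forall a, H (a, 0) = f a & forall a, H (a, 1) = g a].

Definition contractible (Z : topologicalType) : Prop :=
  exists z0, deformation (@idfun Z) (fun=> z0).

Lemma deformation_trans (A B : topologicalType) (f g h : A -> B) :
  deformation f g -> deformation g h -> deformation f h.
Proof.
move=> [F [cF F0 F1]] [G [cG G0 G1]].
exists (fun u => if u.2 <= 1 / 2 then F (u.1, 2 * u.2) else G (u.1, 2 * u.2 - 1)).
have e1 : 2 * (1 / 2) = 1 :> R by field.
have e2 : 2 * (1 / 2) - 1 = 0 :> R by field.
have e3 : 2 * 1 - 1 = 1 :> R by ring.
have r0 : (0 <= 1 / 2 :> R) = true by lra.
have r1 : (1 <= 1 / 2 :> R) = false by lra.
split.
- have cF' : continuous (fun u : A * R => F (u.1, 2 * u.2)) by ccont.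
  have cG' : continuous (fun u : A * R => G (u.1, 2 * u.2 - 1)) by ccont.
  move=> [a t].
  apply: (@fcvg_paste R _ _ (nbhs a) _ (fun a t => F (a, 2 * t)) (fun a t => G (a, 2 * t - 1))
    (fun t => F (a, 2 * t)) (fun t => G (a, 2 * t - 1)) (1 / 2)).
  + by move=> s; exact: (cF' (a, s)).
  + by move=> s; exact: (cG' (a, s)).
  + by rewrite e2 e1 F1 G0.
- by move=> a /=; rewrite r0 mulr0.
- by move=> a /=; rewrite r1 e3.
Qed.

End pasted_homotopies.

Section windows.
Variable R : realType.

Lemma truncn_pieces (F : nat -> R -> R) (u0 : R) :
  (forall n, continuous (F n)) -> (forall n, F n n.+1%:R = F n.+1 n.+1%:R) ->
  0 < u0 -> cont_at (fun u : R => F (Num.truncn u) u) u0.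
Proof.
move=> cF Fn u00; set n := Num.truncn u0.
have /andP[n1 n2] : n%:R <= u0 < n.+1%:R by apply: truncn_itv; exact: ltW.
have below : \forall u \near u0, u < n.+1%:R by exact: lt_nbhsl.
have trunc_eq m (u : R) : m%:R <= u < m.+1%:R -> Num.truncn u = m by move=> h; exact: truncn_def.
have [n3|n3] := ltrP n%:R u0.
  have above : \forall u \near u0, n%:R < u by exact: lt_nbhsr.
  apply: (@cont_at_near _ _ (F n)); last exact: cF.
  apply: filterS2 below above => u h1 h2; rewrite (trunc_eq n)//.
  by rewrite (ltW h2).
have u0n : u0 = n%:R by apply/eqP; rewrite eq_le n1 n3.
case En : n => [|m]; first by move: u00; rewrite u0n En ltxx.
have above : \forall u \near u0, m%:R < u.
  by apply: lt_nbhsr; rewrite u0n En ltr_nat.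
move=> U; rewrite -/n => HU.
have U1 : \forall u \near u0, U (F n u) by exact: cF HU.
have U2 : \forall u \near u0, U (F m u).
  by apply: cF; rewrite u0n En Fn -En -u0n.
suff : \forall u \near u0, U (F (Num.truncn u) u) by [].
apply: filterS3 (filterI below above) U1 U2 => u [h1 h2] k1 k2.
have [nu|un] := lerP n%:R u; first by rewrite (trunc_eq n)// nu h1.
by rewrite (trunc_eq m)// (ltW h2) -En un.
Qed.

Let Fw (n : nat) (u : R) : R := clamp (1 - 4 * (u - n%:R)) + clamp (4 * (u - n%:R) - 3).
Let Fk (n : nat) (u : R) : R := n%:R + clamp (2 * (u - n%:R) - 1 / 2).

(** In the variable [1/a], the window around [n] has the radius [1/4]. It is
    contracted to [1/n] by [squeeze]; [weight] is [1] at [1/n] and vanishes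
    outside these windows. *)
Definition weight (a : R) : R := Fw (Num.truncn a^-1) a^-1.
Definition squeeze (a : R) : R := (Fk (Num.truncn a^-1) a^-1)^-1.

Let floorP (a : R) : 0 < a -> a <= 1 -> exists n (f : R),
  [/\ (0 < n)%N, Num.truncn a^-1 = n, a^-1 = n%:R + f & 0 <= f < 1].
Proof.
move=> a0 a1; exists (Num.truncn a^-1), (a^-1 - (Num.truncn a^-1)%:R).
have /andP[n1 n2] : (Num.truncn a^-1)%:R <= a^-1 < (Num.truncn a^-1).+1%:R.
  by apply: truncn_itv; rewrite invr_ge0 ltW.
split => //.
- by rewrite -ltnS -(ltr_nat R) (le_lt_trans _ n2)// invf_ge1.
- by rewrite addrC subrK.
- by rewrite subr_ge0 n1 ltrBlDl natr1.
Qed.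

Lemma weight_cont_at (T : topologicalType) (g : T -> R) t :
  cont_at g t -> 0 < g t -> cont_at (fun s => weight (g s)) t.
Proof.
move=> gt g0; have cv : cont_at (fun s => (g s)^-1) t by apply: cont_at_inv => //; rewrite gt_eqF.
apply: (@cvg_comp _ _ _ (fun s => (g s)^-1) (fun u : R => Fw (Num.truncn u) u) _ _ _ cv).
apply: (@truncn_pieces Fw); last by rewrite invr_gt0.
  by move=> n; rewrite /Fw; ccont.
move=> n; rewrite /Fw -[n.+1%:R]natr1 subrr [n%:R + 1]addrC addrK.
rewrite (@clamp_le0 _ (1 - 4 * 1)); last lra.
rewrite (@clamp_ge1 _ (4 * 1 - 3)); last lra.
rewrite (@clamp_ge1 _ (1 - 4 * 0)); last lra.
by rewrite (@clamp_le0 _ (4 * 0 - 3)) ?addr0 ?add0r//; lra.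
Qed.

Lemma squeeze_cont_at (T : topologicalType) (g : T -> R) t :
  cont_at g t -> 0 < g t -> g t <= 1 -> cont_at (fun s => squeeze (g s)) t.
Proof.
move=> gt g0 g1; have cv : cont_at (fun s => (g s)^-1) t by apply: cont_at_inv => //; rewrite gt_eqF.
apply: (@cont_at_inv _ _ (fun s => Fk (Num.truncn (g s)^-1) (g s)^-1)).
  have [n [f [n0 -> _ _]]] := floorP g0 g1; rewrite /Fk gt_eqF// ltr_wpDr ?clamp_ge0 ?ltr0n//.
apply: (@cvg_comp _ _ _ (fun s => (g s)^-1) (fun u : R => Fk (Num.truncn u) u) _ _ _ cv).
apply: (@truncn_pieces Fk); last by rewrite invr_gt0.
  by move=> n; rewrite /Fk; ccont.
move=> n; rewrite /Fk -[n.+1%:R]natr1 subrr [X in X - n%:R]addrC addrK.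
rewrite (@clamp_ge1 _ (2 * 1 - _)); last lra.
by rewrite (@clamp_le0 _ (2 * 0 - _)) ?addr0//; lra.
Qed.

Lemma squeeze0 : squeeze 0 = 0.
Proof.
rewrite /squeeze invr0 (_ : Num.truncn (0 : R) = 0%N); last by apply: truncn_def; rewrite lexx ltr01.
by rewrite /Fk subrr mulr0 clamp_le0 ?addr0 ?invr0//; lra.
Qed.

Lemma squeeze_bounds a : 0 <= a <= 1 -> 0 <= squeeze a <= 1 /\ squeeze a <= 2 * a.
Proof.
move=> /andP[a0 a1]; have [->|an0] := eqVneq a 0; first by rewrite squeeze0 mulr0 lexx ler01.
have {}a0 : 0 < a by rewrite lt_neqAle eq_sym an0.
have [n [f [n0 nE aE /andP[f0 f1]]]] := floorP a0 a1.
rewrite /squeeze nE /Fk; set d := clamp _.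
have d0 : 0 <= d by exact: clamp_ge0.
have nR : 1 <= n%:R :> R by rewrite ler1n.
have k0 : 0 < n%:R + d by lra.
split; first by rewrite invr_ge0 (ltW k0) invf_le1//; lra.
rewrite -[a]invrK -[2]invrK -invfM lef_pV2 ?posrE//; last by rewrite mulr_gt0 ?invr_gt0.
rewrite aE; lra.
Qed.

Lemma window_cases a : 0 < a -> a <= 1 ->
  [/\ 0 <= weight a <= 1 & weight a = 0 \/ exists2 n, (0 < n)%N & squeeze a = n%:R^-1].
Proof.
move=> a0 a1; have [n [f [n0 nE aE /andP[f0 f1]]]] := floorP a0 a1.
rewrite /weight /squeeze nE aE /Fw /Fk (_ : n%:R + f - n%:R = f); last by ring.
have [h1|h1] := lerP f (1 / 4).
  rewrite [clamp (4 * f - 3)]clamp_le0 ?addr0; last lra.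
  split; first by rewrite clamp_ge0 clamp_le1.
  by right; exists n => //; rewrite clamp_le0 ?addr0//; lra.
rewrite [clamp (1 - 4 * f)]clamp_le0 ?add0r; last lra.
split; first by rewrite clamp_ge0 clamp_le1.
have [h2|h2] := lerP f (3 / 4); first by left; rewrite clamp_le0//; lra.
by right; exists n.+1 => //; rewrite clamp_ge1 ?natr1//; lra.
Qed.

Lemma window_center n : (0 < n)%N -> weight n%:R^-1 = 1 /\ squeeze n%:R^-1 = n%:R^-1 :> R.
Proof.
move=> n0; rewrite /weight /squeeze invrK (_ : Num.truncn (n%:R : R) = n); last exact: natrK.
rewrite /Fw /Fk subrr !mulr0 subr0 !sub0r clamp_ge1// !clamp_le0 ?addr0//; lra.
Qed.

Lemma squeeze_cont_at0 (T : topologicalType) (g : T -> R) t :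
  (forall s, 0 <= g s <= 1) -> cont_at g t -> cont_at (fun s => squeeze (g s)) t.
Proof.
move=> g01 gt; have /andP[g0 g1] := g01 t.
have [gt0|gn0] := eqVneq (g t) 0; last first.
  by apply: squeeze_cont_at => //; rewrite lt_neqAle eq_sym gn0.
rewrite /cont_at gt0 squeeze0; apply/cvgrPdist_lt => e e0.
have gte : g t < e / 2 by rewrite gt0 divr_gt0.
have H : \forall s \near t, g s < e / 2 by exact: gt _ (lt_nbhsl gte).
apply: filterS H => s gs; have [/andP[h1 h2] h3] := squeeze_bounds (g01 s).
by rewrite sub0r normrN ger0_norm//; lra.
Qed.

End windows.

Section alternating_contractible.
Variables (R : realType) (X : topologicalType) (x : X) (G : X * R -> X) (v : X).
Hypothesis cX : compact [set: X].
Hypothesis cG : continuous G.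
Hypothesis G0 : forall y, G (y, 0) = y.
Hypothesis G1 : forall y, G (y, 1) = v.

Let acT := @acT R X x.
Let ac := @ac R X x.
Let cp := @pos_continuous R X x.
Let cf := @fibre_continuous R X x.

Let pos1 (p : acT) : 0 <= (pos p).1 <= 1. Proof. by have [] := pos_square p. Qed.

Let conv01 (l a m : R) : 0 <= l -> l <= 1 -> 0 <= a -> a <= 1 -> 0 <= m -> m <= 1 ->
  0 <= (1 - l) * a + l * m <= 1.
Proof. by move=> *; apply/andP; split; nra. Qed.

Let squeeze_in (p : acT) (s : R) : AC_pre x (fibre p,
  ((1 - clamp s) * (pos p).1 + clamp s * squeeze (pos p).1, (pos p).2)).
Proof.
have [[a01 b01] h] := (pos_square p, (acT_inP p).2).
have [/andP[m0 m1] _] := squeeze_bounds a01; have s0 := clamp_ge0 s; have s1 := clamp_le1 s.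
split.
  by split; rewrite /= in_itv //=; case/andP: a01 => a0 a1; exact: conv01.
case: h => [a0|[n n0 an]|]; [apply: Or31|apply: Or32; exists n|exact: Or33] => //=.
  by rewrite a0 squeeze0 !mulr0 addr0.
by rewrite an (window_center _ n0).2; ring.
Qed.

Let squeeze_mv (u : acT * R) : acT := mk_ac (squeeze_in u.1 u.2).

Let pull_in (p : acT) (s : R) : AC_pre x (G (fibre p, clamp s * weight (pos p).1),
  (squeeze (pos p).1, (pos p).2)).
Proof.
have [[a01 b01] h] := (pos_square p, (acT_inP p).2).
have [m01 _] := squeeze_bounds a01.
split; first by split; rewrite /= in_itv.
have [a0|an0] := eqVneq (pos p).1 0; first by apply: Or31; rewrite /= a0 squeeze0.
case/andP: a01 => a0 a1; have {an0}a0 : 0 < (pos p).1 by rewrite lt_neqAle eq_sym an0.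
have [_ [w0|[n n0 m]]] := window_cases a0 a1; last by apply: Or32; exists n.
rewrite w0 mulr0 G0; case: h => [h|[n n0 an]|]; last exact: Or33.
  by move: a0; rewrite h ltxx.
by move: w0; rewrite an (window_center _ n0).1 => /eqP; rewrite oner_eq0.
Qed.

Let pull_mv (u : acT * R) : acT := mk_ac (pull_in u.1 u.2).

Let pull_pos p s : pos (pull_mv (p, s)) = (squeeze (pos p).1, (pos p).2).
Proof. by []. Qed.

Let pull_fibre p s : fibre (pull_mv (p, s)) = G (fibre p, clamp s * weight (pos p).1).
Proof. by []. Qed.

Let squeeze_pos : continuous (fun p : acT => squeeze (pos p).1).
Proof. by move=> p; apply: (@squeeze_cont_at0 _ _ (fun p : acT => (pos p).1)); [exact: pos1|ccont]. Qed.

Let squeeze_deformation : exists2 H : alternating_cone R x * R -> alternating_cone R x,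
  continuous H & forall p t, H (ac p, t) = ac (squeeze_mv (p, t)).
Proof.
apply: (@AC_lift_homotopy R X x _ (fun u => ac (squeeze_mv u))).
  move=> u; apply: (@continuous_comp _ _ _ squeeze_mv ac); last exact: ac_continuous.
  apply: cvg_subtype.
  suff : continuous (fun u : acT * R => (fibre u.1,
     ((1 - clamp u.2) * (pos u.1).1 + clamp u.2 * squeeze (pos u.1).1, (pos u.1).2))) by apply.
  have cs : continuous (fun u : acT * R => squeeze (pos u.1).1).
    move=> w; apply: (@cont_at_comp _ _ _ (fun w : acT * R => w.1) (fun p : acT => squeeze (pos p).1)) => //.
    by ccont.
  by ccont; exact: cs.
move=> p q t pq ap; apply: ac_apex; first by rewrite /pos /= -/(pos p) -/(pos q) pq.
apply/AC_apexP; case/AC_apexP: ap => [[a0 b01]|[n n0 an]]; [left|right].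
  by rewrite /pos /= -/(pos p) a0 squeeze0 !mulr0 addr0.
exists n => //; rewrite /pos /= -/(pos p) an /= (window_center _ n0).2.
by congr (_, _); ring.
Qed.

Let pull_deformation : exists2 H : alternating_cone R x * R -> alternating_cone R x,
  continuous H & forall p t, H (ac p, t) = ac (pull_mv (p, t)).
Proof.
have cpp : continuous (fun u : acT * R => (squeeze (pos u.1).1, (pos u.1).2)).
  have cs : continuous (fun u : acT * R => squeeze (pos u.1).1).
    move=> w; apply: (@cont_at_comp _ _ _ (fun w : acT * R => w.1) (fun p : acT => squeeze (pos p).1)) => //.
    by ccont.
  by ccont; exact: cs.
apply: (@AC_lift_homotopy R X x _ (fun u => ac (pull_mv u))).
  apply: ac_flow_continuous => //.
  - exact: ac_continuous.
  - by move=> p q; exact: ac_limit.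
  - move=> p t an0; have /andP[a0 a1] := pos1 p.
    have {an0}a0 : 0 < (pos p).1 by rewrite lt_neqAle eq_sym an0.
    apply: cvg_subtype.
    have cw : cont_at (fun u : acT * R => weight (pos u.1).1) (p, t).
      by apply: weight_cont_at => //; ccont.
    have cu : cont_at (fun u : acT * R => (squeeze (pos u.1).1, (pos u.1).2)) (p, t) by exact: cpp.
    suff : cont_at (fun u : acT * R => (G (fibre u.1, clamp u.2 * weight (pos u.1).1),
      (squeeze (pos u.1).1, (pos u.1).2))) (p, t) by [].
    apply: cont_at_pair => //.
    apply: (@cont_at_comp _ _ _ (fun u : acT * R => (fibre u.1, clamp u.2 * weight (pos u.1).1)) G) => //.
    by ccont.
  - move=> p t a0; split; first exact: cpp.
    by rewrite /pos /= -/(pos p) a0 squeeze0.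
move=> p q t pq ap; apply: ac_apex; first by rewrite /pos /= -/(pos p) -/(pos q) pq.
apply/AC_apexP; case/AC_apexP: ap => [[a0 b01]|[n n0 an]]; [left|right].
  by rewrite /pos /= -/(pos p) a0 squeeze0.
by exists n => //; rewrite /pos /= -/(pos p) an /= (window_center _ n0).2.
Qed.

(** A contraction of [X] may move the base point. In the square there is room to
    follow it: near the tube over [1/n] the square is first squeezed onto the
    tube, then pulled into the fibres together with the base point. The width of
    the windows tends to [0], so that nothing moves along the limit segment. *)
Lemma AC_contractible : contractible R (alternating_cone R x).
Proof.
have [H1 cH1 H1E] := squeeze_deformation; have [H2 cH2 H2E] := pull_deformation.
have [r cr rE] := @ac_position R X x.
pose e (c : R * R) := ac (pull_mv (ac_base x c, 1)).
have ce : continuous e.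
  rewrite (_ : e = fun c => H2 (ac (ac_base x c), 1)); last first.
    by apply/funext => c; rewrite H2E.
  have cb : continuous (fun c => ac (ac_base x c)).
    move=> c; apply: (@continuous_comp _ _ _ (ac_base x) ac); last exact: ac_continuous.
    exact: ac_base_continuous.
  by ccont; exact: cb.
have d1 : deformation R (@idfun (alternating_cone R x)) (fun z => H1 (z, 1)).
  exists H1; split => // z; have [p <-] := ac_surj z; rewrite H1E; congr ac.
  apply: acT_eq => //; rewrite /pos /= -/(pos p) clamp_le0// subr0 mul1r mul0r addr0.
  by rewrite -surjective_pairing.
have d2 : deformation R (fun z => H1 (z, 1)) (fun z => H2 (z, 1)).
  exists H2; split => // z; have [p <-] := ac_surj z; rewrite H1E H2E; congr ac.
  apply: acT_eq; rewrite /fibre /pos /=; first by rewrite clamp_le0// mul0r G0.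
  by rewrite clamp_ge1// subrr mul0r add0r mul1r.
(* After both deformations a point is determined by its position in the square:
   the fibre coordinate has been contracted in the tubes. *)
have d3 : deformation R (fun z => H2 (z, 1)) (fun=> e (0, 0)).
  exists (fun u => e ((1 - u.2) * (r u.1).1, (1 - u.2) * (r u.1).2)); split.
  - have := ce; move=> ce'.
    move=> u; apply: (@cont_at_comp _ _ _
      (fun u : alternating_cone R x * R => ((1 - u.2) * (r u.1).1, (1 - u.2) * (r u.1).2)) e) => //.
    by ccont.
  - move=> z; have [p <-] := ac_surj z; rewrite rE /= subr0 !mul1r -surjective_pairing.
    rewrite H2E /e.
    have pE : pos (pull_mv (ac_base x (pos p), 1)) = pos (pull_mv (p, 1)).
      by rewrite !pull_pos pos_base_pos.
    case: (tube_cases p) => [a0|[n n0 an]|px].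
    + by apply: ac_limit => //; rewrite pE pull_pos a0 squeeze0.
    + congr ac; apply: acT_eq => //; rewrite !pull_fibre pos_base_pos an.
      by rewrite (window_center _ n0).1 clamp_ge1// mulr1 !G1.
    + by rewrite -(ac_baseE px).
  - by move=> z; rewrite /= subrr !mul0r.
by exists (e (0, 0)); exact: deformation_trans d1 (deformation_trans d2 d3).
Qed.

End alternating_contractible.

(** * The collapsed alternating cone of the comb is not contractible *)

Section hex.

(** Along the row [0] the number of edges that join a corner with [o] false to a
    corner where both hold is odd, while the boundary of a cell and the other
    sides of the grid contain an even number of them. *)
Lemma grid_parity (N : nat) (o e : nat -> nat -> bool) :
  (1 < N)%N ->
  (forall i j, (i < N)%N -> (j < N)%N ->
    (o i.+1 j = o i j /\ o i j.+1 = o i j /\ o i.+1 j.+1 = o i j) \/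
    (e i.+1 j = e i j /\ e i j.+1 = e i j /\ e i.+1 j.+1 = e i j)) ->
  (forall j, o 0%N j = false) -> (forall j, e N j = false) ->
  (forall i, o i N = false) ->
  (forall i, (0 < i <= N)%N -> o i 0%N) -> (forall i, (i < N)%N -> e i 0%N) -> False.
Proof.
case: N => [//|N] N1 cell left right top bo be.
pose edge (o1 e1 o2 e2 : bool) := (~~ o1 && (o2 && e2)) || (~~ o2 && (o1 && e1)).
pose row j n := \big[addb/false]_(i < n) edge (o i j) (e i j) (o i.+1 j) (e i.+1 j).
pose side i j := edge (o i j) (e i j) (o i j.+1) (e i j.+1).
have step j n : (j < N.+1)%N -> (n <= N.+1)%N ->
    row j n (+) row j.+1 n = side 0%N j (+) side n j.
  move=> jN; elim: n => [|n IH] nN; first by rewrite /row !big_ord0 !addbb.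
  have {IH} := IH (ltnW nN); rewrite /row !big_ord_recr /= -/(row j n) -/(row j.+1 n).
  move: (side 0%N j) (row j n) (row j.+1 n) => s r1 r2; rewrite /side /edge.
  case: (cell n j nN jN) => [[-> [-> ->]]|[-> [-> ->]]].
    move: (o n j) (e n j) (e n.+1 j) (e n j.+1) (e n.+1 j.+1) s r1 r2.
    by do 8!case.
  move: (e n j) (o n j) (o n.+1 j) (o n j.+1) (o n.+1 j.+1) s r1 r2.
  by do 8!case.
have row_const j : (j <= N.+1)%N -> row j N.+1 = row 0%N N.+1.
  elim: j => [//|j IH] jN; rewrite -IH ?(ltnW jN)//.
  have := step j N.+1 jN (leqnn N.+1).
  rewrite /side !left !right /edge /= !andbF /=.
  by case: (row j N.+1) (row j.+1 N.+1) => [] [].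
have := row_const N.+1 (leqnn N.+1); rewrite /row.
rewrite big1 => [|i _]; last by rewrite /edge !top.
rewrite big_ord_recl big1 => [|i _]; last first.
  have iN := ltn_ord i; rewrite /edge /= /bump /=.
  by rewrite (bo (1 + i)%N) ?(bo (1 + i).+1)//; lia.
by rewrite /edge left bo// be.
Qed.

End hex.

Section weighted_tubes.
Variables (R : realType) (X : topologicalType) (x : X).

Lemma cac_height : exists2 h : collapsed_alternating_cone R x -> R,
  continuous h & forall p, h (cac p) = (pos p).2.
Proof.
apply: (@CAC_lift_continuous R X x R (fun p => (pos p).2)).
- by have cp := @pos_continuous R X x; ccont.
- by move=> p q ->.
- by move=> c d /= ->.
Qed.

(** Multiplying by the height above the apex of the tube extends a function of
    the fibre by [0] to the rest of the cone. *)
Lemma cac_weighted (f : X -> R) (m : nat) : continuous f -> f x = 0 -> (0 < m)%N ->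
  exists2 F : collapsed_alternating_cone R x -> R, continuous F &
    forall p, F (cac p) = `|(pos p).2 - apex_height R m| * f (fibre p) * tent m (pos p).1.
Proof.
move=> cf fx m0; have cp := @pos_continuous R X x; have cfi := @fibre_continuous R X x.
apply: (@CAC_lift_continuous R X x R
  (fun p => `|(pos p).2 - apex_height R m| * f (fibre p) * tent m (pos p).1)).
- by rewrite /tent; ccont.
- move=> p q <- /AC_apexP[[a0 _]|[n n0 ->]]; first by rewrite a0 tent0// !mulr0.
  have [->|nm] := eqVneq n m; first by rewrite subrr normr0 !mul0r.
  by rewrite tent_other// !mulr0.
- by move=> c d _ /=; rewrite fx !mulr0 !mul0r.
Qed.

Lemma cac_tube_in (m : nat) (y : X) (b : R) : (0 < m)%N -> AC_pre x (y, (m%:R^-1, clamp b)).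
Proof.
move=> m0; split; last by apply: Or32; exists m.
split; rewrite /= in_itv /= ?clamp_ge0 ?clamp_le1//.
by rewrite invr_ge0 ler0n invf_le1 ?ltr0n// ler1n.
Qed.

Definition cac_tube (m : nat) (m0 : (0 < m)%N) (y : X) (b : R) :=
  cac (mk_ac (@cac_tube_in m y b m0)).

Lemma cac_tube_continuous m (m0 : (0 < m)%N) :
  continuous (fun u : X * R => cac_tube m0 u.1 u.2).
Proof.
move=> u; apply: (@continuous_comp _ _ _
  (fun u : X * R => mk_ac (cac_tube_in u.1 u.2 m0)) (@cac R X x)); last exact: cac_continuous.
apply: cvg_subtype.
by suff : cont_at (fun u : X * R => (u.1, (m%:R^-1 : R, clamp u.2))) u by []; ccont.
Qed.

Definition spine (b : R) := cac (ac_base x (0, b)).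

Lemma cac_tube_base m (m0 : (0 < m)%N) b : cac_tube m0 x b = spine b.
Proof.
apply: cac_spine; [by left|by left|].
by rewrite pos_base.
Qed.

Lemma cac_tube_apex m (m0 : (0 < m)%N) y : cac_tube m0 y (apex_height R m) = spine (apex_height R m).
Proof.
apply: cac_spine; last by rewrite pos_base.
  right; apply/AC_apexP; right; exists m => //.
  by rewrite /pos /= clamp_id// apex_height01.
by left.
Qed.

End weighted_tubes.

Lemma unif_near (R : realType) (Y T : topologicalType) (g : Y * T -> R) (K : set T) y0 e :
  continuous g -> compact K -> 0 < e ->
  \forall y \near y0, forall c, K c -> `|g (y, c) - g (y0, c)| < e.
Proof.
move=> cg /compact_near_coveringP cK e0.
apply: (cK _ _ (fun y c => `|g (y, c) - g (y0, c)| < e)) => c Kc.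
have c1 : cont_at (fun u : T * Y => g (u.2, u.1) - g (y0, u.1)) (c, y0) by ccont.
have := c1 _ (nbhsx_ballx _ _ e0).
rewrite /= subrr => H.
have {H}K1 : \forall u \near (c, y0), ball (0 : R) e (g (u.2, u.1) - g (y0, u.1)).
  exact: H.
by apply: filterS K1 => -[a b]; rewrite /ball /= sub0r normrN.
Qed.

Section comb_tubes.
Variable R : realType.
Notation Z := (collapsed_alternating_cone R (comb_base R)).
Implicit Types (m n k : nat) (u : Z).

Let q (y : comb R) : R := (set_val y).2.
Let cut k (y : comb R) : R := tooth_cut k.+1 (set_val y).1.

Let cq : continuous q. Proof. by rewrite /q; ccont. Qed.
Let ccut k : continuous (cut k). Proof. by rewrite /cut /tooth_cut; ccont. Qed.
Let cut_base k : cut k (comb_base R) = 0. Proof. exact: tooth_cut0. Qed.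

Let tube_function m (f : comb R -> R) (F : Z -> R) := forall p,
  F (cac p) = `|(pos p).2 - apex_height R m| * f (fibre p) * tent m (pos p).1.

Let tube_function_other m n f F p : (0 < m)%N -> (0 < n)%N -> m != n ->
  tube_function n f F -> (pos p).1 = m%:R^-1 -> F (cac p) = 0.
Proof. by move=> m0 n0 mn -> ->; rewrite tent_other// mulr0. Qed.

(** Below the middle of a tooth that is not cut off, the weighted indicator of
    the tooth is the height above the apex. *)
Let leaf_height m k A K u : (0 < m)%N ->
  tube_function m (cut k) A -> tube_function m q K -> 0 < A u -> 2 * K u <= A u ->
  exists p, [/\ u = cac p, (pos p).1 = m%:R^-1 & A u = `|(pos p).2 - apex_height R m|].
Proof.
move=> m0 AE KE; have [p <-] := cac_surj u; rewrite AE KE => A0 KA; exists p.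
set w := `|_| in A0 KA *; have w0 : 0 <= w by rewrite normr_ge0.
set e := tent _ _ in A0 KA *; have e0 : 0 <= e by exact: clamp_ge0.
have c0 : 0 < cut k (fibre p).
  rewrite lt_neqAle clamp_ge0 andbT eq_sym; apply: contraTneq A0 => ->.
  by rewrite mulr0 mul0r ltxx.
have we0 : 0 < w * e by move: A0; rewrite mulrAC pmulr_lgt0.
have q1 : q (fibre p) < 1.
  have : 2 * q (fibre p) <= cut k (fibre p).
    by rewrite -(ler_pM2l we0); move: KA; rewrite mulrAC [w * cut _ _ * e]mulrAC mulrCA.
  have := clamp_le1 ((k.+2%:R * (set_val (fibre p)).1 - 1) * k.+1%:R).
  rewrite -/(tooth_cut k.+1 _) -/(cut k _); lra.
have tp : teeth (set_val (fibre p)).1.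
  have [_ _ [q1'|//]] := set_valP (fibre p).
  by move: q1; rewrite /q q1' ltxx.
have cE : cut k (fibre p) = 1.
  by have [h|//] := tooth_cut01 tp (ltn0Sn k); move: c0; rewrite /cut h ltxx.
have pm : (pos p).1 = m%:R^-1.
  have [_ [a0|[n n0 an]|px]] := acT_inP p.
  - by move: we0; rewrite /e a0 tent0// mulr0 ltxx.
  - have [<-//|nm] := eqVneq n m.
    by move: we0; rewrite /e an tent_other// mulr0 ltxx.
  - by rewrite /= in px; move: c0; rewrite px cut_base ltxx.
by split => //; rewrite cE /e pm tent_self !mulr1.
Qed.

Let unit2 := (`[0, 1] `*` `[0, 1] : set (R * R)).
Let line (c c' : R * R) (s : R) : R * R :=
  ((1 - s) * c.1 + s * c'.1, (1 - s) * c.2 + s * c'.2).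

(** Two tubes with apices at the same height. As long as the trace of the
    spine stays away from this height, a leaf over one of them and a leaf over
    the other, both close to the spine, cannot be left: halfway up its tooth the
    first point would be far from the spine, hence from the second point as well,
    which is over the other tube. *)
Lemma tube_pair_states (H : Z * R -> Z) (h : Z -> R) m n z1 :
  continuous H -> (forall z, H (z, 0) = z) -> (forall z, H (z, 1) = z1) ->
  continuous h -> (forall p, h (cac p) = (pos p).2) ->
  (0 < m)%N -> (0 < n)%N -> m != n -> apex_height R m = apex_height R n ->
  exists I : R * R -> Prop, [/\
    forall c c', unit2 c -> unit2 c' ->
      (forall s, 0 <= s <= 1 ->
         3 / 8 <= `|h (H (spine (comb_base R) (line c c' s).1, (line c c' s).2)) -
                    apex_height R m|) ->
      I c -> I c',
    forall t, ~ I (apex_height R m, t),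
    forall b, ~ I (b, 1) &
    forall b, 0 <= b <= 1 -> b != apex_height R m -> I (b, 0)].
Proof.
move=> cH H0 H1 ch hE m0 n0 mn amn.
have [Km cKm KmE] := cac_weighted cq (erefl : q (comb_base R) = 0) m0.
have [Kn cKn KnE] := cac_weighted cq (erefl : q (comb_base R) = 0) n0.
have cunit : compact unit2 by exact: compact_setX (@segment_compact R 0 1) (@segment_compact R 0 1).
have close (g : Z -> R) l (l0 : (0 < l)%N) : continuous g -> \forall k \near \oo,
    forall c, unit2 c ->
    `|g (H (cac_tube _ l0 (comb_tip R k) c.1, c.2)) - g (H (spine (comb_base R) c.1, c.2))| < 1 / 16.
  move=> cg; have ct := @cac_tube_continuous R _ (comb_base R) l l0.
  pose G (u : comb R * (R * R)) := g (H (cac_tube (comb_base R) l0 u.1 u.2.1, u.2.2)).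
  have cG : continuous G.
    have ct' : continuous (fun u : comb R * (R * R) => cac_tube (comb_base R) l0 u.1 u.2.1).
      move=> u; apply: (@cont_at_comp _ _ _ (fun u : comb R * (R * R) => (u.1, u.2.1))
        (fun u : comb R * R => cac_tube (comb_base R) l0 u.1 u.2)) => //.
      by ccont.
    by rewrite /G; ccont.
  have e0 : 0 < 1 / 16 :> R by lra.
  have U := unif_near (comb_base R) cG cunit e0.
  have V : \forall k \near \oo, forall c, unit2 c -> `|G (comb_tip R k, c) - G (comb_base R, c)| < 1 / 16.
    exact: (@comb_tip_cvg R _ U).
  apply: filterS V => k hk c Kc; rewrite -(cac_tube_base (comb_base R) l0 c.1).
  exact: (hk c Kc).
have [k [hm [hn [Kmm [Kmn [Knm Knn]]]]]] := filter_ex (filterI (close h m m0 ch)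
  (filterI (close h n n0 ch) (filterI (close Km m m0 cKm) (filterI (close Km n n0 cKm)
  (filterI (close Kn m m0 cKn) (close Kn n n0 cKn)))))).
have [Am cAm AmE] := cac_weighted (@ccut k) (cut_base k) m0.
have [An cAn AnE] := cac_weighted (@ccut k) (cut_base k) n0.
pose fm c := H (cac_tube (comb_base R) m0 (comb_tip R k) c.1, c.2).
pose fn c := H (cac_tube (comb_base R) n0 (comb_tip R k) c.1, c.2).
have leafm u : 0 < Am u -> 2 * Km u <= Am u ->
    [/\ Am u = `|h u - apex_height R m|, Kn u = 0 & An u = 0].
  move=> A0 KA; have [p [up pm AE]] := leaf_height m0 AmE KmE A0 KA.
  by split; rewrite ?AE up ?hE//; [exact: tube_function_other KnE pm|exact: tube_function_other AnE pm].
have leafn u : 0 < An u -> 2 * Kn u <= An u -> An u = `|h u - apex_height R m| /\ Km u = 0.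
  move=> A0 KA; have [p [up pm AE]] := leaf_height n0 AnE KnE A0 KA.
  split; first by rewrite AE up hE amn.
  by rewrite up; apply: tube_function_other KmE pm => //; rewrite eq_sym.
have apart c : fm c = fn c -> ~ ((0 < Am (fm c) /\ 2 * Km (fm c) < Am (fm c)) /\
    (0 < An (fn c) /\ 2 * Kn (fn c) < An (fn c))).
  move=> -> [[a1 a2] [a3 _]]; have [_ _ a4] := leafm _ a1 (ltW a2).
  by move: a3; rewrite a4 ltxx.
have ct l (l0 : (0 < l)%N) c c' : continuous (fun s =>
    H (cac_tube (comb_base R) l0 (comb_tip R k) (line c c' s).1, (line c c' s).2)).
  have ct' : continuous (fun s => cac_tube (comb_base R) l0 (comb_tip R k) (line c c' s).1).
    move=> s; apply: (@cont_at_comp _ _ _ (fun s => (comb_tip R k, (line c c' s).1))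
        (fun u : comb R * R => cac_tube (comb_base R) l0 u.1 u.2)).
      exact: cac_tube_continuous.
    by rewrite /line /=; ccont.
  have cl : continuous (fun s => (line c c' s).2) by rewrite /line /=; ccont.
  move=> s; apply: (@cont_at_comp _ _ _ (fun s =>
    (cac_tube (comb_base R) l0 (comb_tip R k) (line c c' s).1, (line c c' s).2)) H) => //.
  by apply: cont_at_pair; [exact: ct'|exact: cl].
exists (fun c => (0 < Am (fm c) /\ 2 * Km (fm c) < Am (fm c)) /\
    (0 < An (fn c) /\ 2 * Kn (fn c) < An (fn c))); split.
- move=> c c' uc uc' far Ic.
  have cfm : continuous (fun s => fm (line c c' s)) by exact: ct.
  have cfn : continuous (fun s => fn (line c c' s)) by exact: ct.
  have line_in s : `[0, 1]%classic s -> unit2 (line c c' s).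
    rewrite /= in_itv /= => /andP[s0 s1]; move: uc uc'.
    rewrite /unit2 /line /= !in_itv /= => -[/andP[? ?] /andP[? ?]] [/andP[? ?] /andP[? ?]].
    by split; apply/andP; split; nra.
  have line0 : line c c' 0 = c by rewrite /line subr0 !mul1r !mul0r !addr0 -surjective_pairing.
  have line1 : line c c' 1 = c' by rewrite /line subrr !mul1r !mul0r !add0r -surjective_pairing.
  (* The height above the apex is at least [3/8 - 1/16 = 5/16] at both points. If
     one of them reached the middle of its tooth, [K] would be at least [5/32]
     there, but [K] differs by less than [1/8] from its value [0] at the other point. *)
  pose O := [set s | (0 < Am (fm (line c c' s)) /\ 2 * Km (fm (line c c' s)) < Am (fm (line c c' s)))
     /\ (0 < An (fn (line c c' s)) /\ 2 * Kn (fn (line c c' s)) < An (fn (line c c' s)))].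
  pose C := [set s | (5 / 16 <= Am (fm (line c c' s)) /\ 2 * Km (fm (line c c' s)) <= Am (fm (line c c' s)))
     /\ (5 / 16 <= An (fn (line c c' s)) /\ 2 * Kn (fn (line c c' s)) <= An (fn (line c c' s)))].
  have oO : open O.
    by apply: openI; apply: openI; apply: open_lt_cont; ccont.
  have cC : closed C.
    by apply: closedI; apply: closedI; apply: closed_le_cont; ccont.
  suff : O 1 by rewrite /O /= line1.
  have I0 : `[0, 1]%classic (0 : R) by rewrite /= in_itv /= lexx ler01.
  have I1 : `[0, 1]%classic (1 : R) by rewrite /= in_itv /= lexx ler01.
  have CO s : `[0, 1]%classic s -> C s -> O s.
    move=> Is [[a1 a2] [b1 b2]]; have us := line_in s Is.
    have a0 : 0 < Am (fm (line c c' s)) by apply: lt_le_trans a1; lra.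
    have b0 : 0 < An (fn (line c c' s)) by apply: lt_le_trans b1; lra.
    have [_ e1 _] := leafm _ a0 a2; have [_ e2] := leafn _ b0 b2.
    have h1 := Kmn _ us; rewrite -/(fn (line c c' s)) e2 in h1.
    have h2 := Knm _ us; rewrite -/(fm (line c c' s)) e1 in h2.
    have block (a K1 K2 : R) : 5 / 16 <= a -> `|K1 - K2| < 1 / 16 -> `|0 - K2| < 1 / 16 -> 2 * K1 < a.
      rewrite !ltr_norml; lra.
    split; split => //; [exact: block a1 (Kmm _ us) h1|exact: block b1 (Knn _ us) h2].
  have OC s : `[0, 1]%classic s -> O s -> C s.
    move=> Is [[a1 a2] [b1 b2]]; have us := line_in s Is.
    have [e1 _ _] := leafm _ a1 (ltW a2); have [e2 _] := leafn _ b1 (ltW b2).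
    have fs : 3 / 8 <= `|h (H (spine (comb_base R) (line c c' s).1, (line c c' s).2)) -
                    apex_height R m| by apply: far; move: Is; rewrite /= in_itv.
    have tri (a b d : R) : `|a - b| < 1 / 16 -> 3 / 8 <= `|b - d| -> 5 / 16 <= `|a - d|.
      move=> ab bd; have := ler_distD a b d; rewrite [`|b - a|]distrC; lra.
    have h1 : 5 / 16 <= Am (fm (line c c' s)) by rewrite e1; exact: tri (hm _ us) fs.
    have h2 : 5 / 16 <= An (fn (line c c' s)) by rewrite e2; exact: tri (hn _ us) fs.
    by split; split; [|exact: ltW| |exact: ltW].
  have O0 : O 0 by rewrite /O /= line0.
  have {}OC := connected_clopen (@segment_connected R 0 1) cC oO CO OC I0 O0.
  exact: OC I1.
- move=> t; apply: apart.
  have ap : cac_tube (comb_base R) m0 (comb_tip R k) (apex_height R m) =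
      cac_tube (comb_base R) n0 (comb_tip R k) (apex_height R m).
    by rewrite cac_tube_apex amn; exact/esym/cac_tube_apex.
  exact: (congr1 (fun z => H (z, t)) ap).
- by move=> b; apply: apart; exact: etrans (H1 _) (esym (H1 _)).
- move=> b b01 ba.
  have w0 : 0 < `|b - apex_height R m| by rewrite normr_gt0 subr_eq0.
  have e l (l0 : (0 < l)%N) A K : apex_height R l = apex_height R m ->
      tube_function l (cut k) A -> tube_function l q K ->
      0 < A (H (cac_tube (comb_base R) l0 (comb_tip R k) b, 0)) /\
      2 * K (H (cac_tube (comb_base R) l0 (comb_tip R k) b, 0)) <
        A (H (cac_tube (comb_base R) l0 (comb_tip R k) b, 0)).
    move=> lm AE KE; rewrite H0 AE KE -[pos _]/(l%:R^-1, clamp b) -[fibre _]/(comb_tip R k).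
    rewrite -[q _]/(0 : R) -[cut _ _]/(tooth_cut k.+1 (k.+1%:R^-1 : R)) -[(_, _).1]/(l%:R^-1).
    rewrite -[(_, _).2]/(clamp b) tooth_cutV tent_self clamp_id// lm.
    by rewrite !mulr1 !mulr0.
  by split; [exact: e AmE KmE|exact: e AnE KnE].
Qed.

Let line_near (c c' : R * R) (s e : R) : 0 <= s <= 1 -> `|c.1 - c'.1| < e -> `|c.2 - c'.2| < e ->
  ball c e (line c c' s) /\ ball c e (line c' c s).
Proof.
have near (a b : R) r : 0 <= r <= 1 -> `|a - b| < e -> `|a - ((1 - r) * a + r * b)| < e.
  move=> /andP[r0 r1] ab.
  have -> : a - ((1 - r) * a + r * b) = r * (a - b) by ring.
  rewrite normrM ger0_norm//; apply: le_lt_trans ab.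
  by rewrite ler_piMl.
move=> s01 e1 e2; have s01' : 0 <= 1 - s <= 1 by lra.
have h1 := near _ _ _ s01' e1; have h2 := near _ _ _ s01' e2.
have flip (a b : R) : (1 - (1 - s)) * a + (1 - s) * b = (1 - s) * b + s * a by ring.
rewrite flip in h1; rewrite flip in h2.
by split; split; rewrite /ball /=; [exact: near|exact: near|exact: h1|exact: h2].
Qed.

(** The states of two odd tubes are locally constant where the spine is high,
    those of two even tubes where it is low. At time [0] both pairs are in their
    leaves away from the ends, at time [1] none is. *)
Lemma CAC_not_contractible : ~ contractible R Z.
Proof.
move=> [z1 [H [cH H0 H1]]]; have [h ch hE] := @cac_height R _ (comb_base R).
have [I1 [L1 E1 T1 B1]] := @tube_pair_states H h 1 3 z1 cH H0 H1 ch hE isT isT isT erefl.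
have [I2 [L2 E2 T2 B2]] := @tube_pair_states H h 2 4 z1 cH H0 H1 ch hE isT isT isT erefl.
have a1 : apex_height R 1 = 0 by []. have a2 : apex_height R 2 = 1 by [].
have cunit : compact unit2 by exact: compact_setX (@segment_compact R 0 1) (@segment_compact R 0 1).
pose eta (c : R * R) := h (H (spine (comb_base R) c.1, c.2)).
have ceta : continuous eta.
  have cs : continuous (fun c : R * R => spine (comb_base R) c.1).
    move=> c; apply: (@cont_at_comp _ _ _ (fun c : R * R => ac_base (comb_base R) (0, c.1))
      (@cac R _ (comb_base R))); first exact: cac_continuous.
    apply: (@cont_at_comp _ _ _ (fun c : R * R => (0, c.1)) (ac_base (comb_base R))).
      exact: ac_base_continuous.
    by ccont.
  by rewrite /eta; ccont.
have e0 : 0 < 1 / 8 :> R by lra.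
have [M _ /(_ M (leqnn M)) HM] := unif_cont ceta cunit e0.
pose N := M.+2; have NR : 0 < N%:R :> R by rewrite ltr0n.
pose pt i j : R * R := (i%:R / N%:R, j%:R / N%:R).
have pt_in i j : (i <= N)%N -> (j <= N)%N -> unit2 (pt i j).
  have frac k : (k <= N)%N -> 0 <= (k%:R / N%:R : R) <= 1.
    by move=> kN; rewrite divr_ge0//= ler_pdivrMr// mul1r ler_nat.
  by move=> /frac iN /frac jN; split; rewrite /= in_itv.
have pt_near i (d : bool) : `|i%:R / N%:R - (i + d)%N%:R / N%:R| < M.+1%:R^-1 :> R.
  rewrite natrD mulrDl opprD addrA subrr sub0r normrN ger0_norm ?divr_ge0//.
  apply: (@le_lt_trans _ _ (1 / N%:R)).
    by rewrite ler_pM2r ?invr_gt0//; case: d.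
  by rewrite mul1r ltf_pV2 ?posrE ?ltr0n// ltr_nat.
have same i j (d1 d2 : bool) : (i < N)%N -> (j < N)%N ->
    (1 / 2 <= eta (pt i j) -> `[< I1 (pt (i + d1)%N (j + d2)%N) >] = `[< I1 (pt i j) >]) /\
    (eta (pt i j) < 1 / 2 -> `[< I2 (pt (i + d1)%N (j + d2)%N) >] = `[< I2 (pt i j) >]).
  move=> iN jN; have u := pt_in i j (ltnW iN) (ltnW jN).
  have u' : unit2 (pt (i + d1)%N (j + d2)%N) by apply: pt_in; case: (d1) (d2) => [] []; lia.
  have l s : 0 <= s <= 1 -> `|eta (pt i j) - eta (line (pt i j) (pt (i + d1)%N (j + d2)%N) s)| < 1 / 8 /\
      `|eta (pt i j) - eta (line (pt (i + d1)%N (j + d2)%N) (pt i j) s)| < 1 / 8.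
    move=> s01; have [b1 b2] := @line_near (pt i j) (pt (i + d1)%N (j + d2)%N) s _ s01 (pt_near i d1) (pt_near j d2).
    by split; apply: HM.
  have far1 (a b : R) : 1 / 2 <= a -> `|a - b| < 1 / 8 -> 3 / 8 <= `|b - apex_height R 1|.
    by move=> ha; rewrite a1 subr0 ltr_norml => hb; rewrite ger0_norm; lra.
  have far2 (a b : R) : a < 1 / 2 -> `|a - b| < 1 / 8 -> 3 / 8 <= `|b - apex_height R 2|.
    move=> ha; rewrite a2 [`|b - 1|]distrC ltr_norml => hb; rewrite ger0_norm; lra.
  split=> he; apply/asboolP/asboolP.
  - by apply: L1 => // s s01; apply: far1 he _; have [] := l s s01.
  - by apply: L1 => // s s01; apply: far1 he _; have [] := l s s01.
  - by apply: L2 => // s s01; apply: far2 he _; have [] := l s s01.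
  - by apply: L2 => // s s01; apply: far2 he _; have [] := l s s01.
apply: (@grid_parity N (fun i j => `[< I1 (pt i j) >]) (fun i j => `[< I2 (pt i j) >])) => //.
- move=> i j iN jN; have S d1 d2 := same i j d1 d2 iN jN.
  have := (S true false, S false true, S true true).
  rewrite -[nat_of_bool true]/1%N -[nat_of_bool false]/0%N.
  rewrite !addn0 !addn1.
  by have [he|he] := leP (1 / 2) (eta (pt i j)) => -[[[s1 t1] [s2 t2]] [s3 t3]]; [left|right];
    split; auto.
- by move=> j; apply/asboolPn; rewrite /pt mul0r -a1; exact: E1.
- by move=> j; apply/asboolPn; rewrite /pt mulfV ?gt_eqF// -a2; exact: E2.
- by move=> i; apply/asboolPn; rewrite /pt mulfV ?gt_eqF//; exact: T1.
- move=> i /andP[i0 iN]; apply/asboolP; rewrite /pt mul0r; apply: B1.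
    by have [+ _] := pt_in i 0%N iN isT; rewrite /= in_itv.
  by rewrite a1 mulf_eq0 negb_or invr_eq0 !pnatr_eq0 -lt0n i0.
- move=> i iN; apply/asboolP; rewrite /pt mul0r; apply: B2.
    by have [+ _] := pt_in i 0%N (ltnW iN) isT; rewrite /= in_itv.
  by rewrite a2 lt_eqF// ltr_pdivrMr// mul1r ltr_nat.
Qed.

End comb_tubes.

(** * Homotopy types of the four cones *)

Lemma contractible_homotopy_equivalent (R : realType) (A B : topologicalType) :
  homotopy_equivalent R A B -> contractible R A -> contractible R B.
Proof.
move=> [f [g [cf cg _ /homotopic_clamp[K [cK K0 K1]]]]] [a0 [H [cH H0 H1]]].
exists (f a0); apply: (@deformation_trans _ _ _ _ (f \o g)).
  exists (fun u => K (u.1, 1 - u.2)); split; first by ccont.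
    by move=> b /=; rewrite subr0 K1.
  by move=> b /=; rewrite subrr K0.
exists (fun u => f (H (g u.1, u.2))); split; first by ccont.
  by move=> b /=; rewrite H0.
by move=> b /=; rewrite H1.
Qed.

Section comb_homotopy.
Variable R : realType.

Let comb_retract (z : R * R) (s : R) : R * R :=
  (z.1 * clamp (2 - 2 * s), clamp (z.2 + 2 * clamp s)).

Let comb_retract_in z s : comb_set z -> comb_set (comb_retract z s).
Proof.
move=> [/andP[a b] /andP[c d] zc]; have s0 := clamp_ge0 s; split => /=.
- by rewrite mulr_ge0 ?clamp_ge0//= mulr_ile1 ?clamp_ge0 ?clamp_le1.
- by rewrite clamp_ge0 clamp_le1.
- have [s1|s1] := lerP s (1 / 2).
    rewrite (clamp_ge1 (_ : 1 <= 2 - 2 * s)) ?mulr1; last lra.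
    case: zc => [->|]; [left|by right].
    by apply: clamp_ge1; lra.
  left; apply: clamp_ge1; have [s2|s2] := lerP s 1; last by rewrite clamp_ge1; lra.
  by rewrite clamp_id; lra.
Qed.

(** Up the teeth, then along the bar; the base point moves as well. *)
Lemma comb_contraction : exists (G : comb R * R -> comb R) v,
  [/\ continuous G, forall y, G (y, 0) = y & forall y, G (y, 1) = v].
Proof.
have v_in : comb_set (0 : R, 1) by split => /=; rewrite ?lexx ?ler01//; left.
exists (fun u => exist _ (comb_retract (set_val u.1) u.2)
    (mem_set (comb_retract_in u.2 (set_valP u.1)))), (exist _ (0, 1) (mem_set v_in)); split.
- move=> u; apply: cvg_subtype.
  suff : continuous (fun u : comb R * R => comb_retract (set_val u.1) u.2) by apply.
  by rewrite /comb_retract; ccont.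
- move=> y; apply: val_inj; rewrite /= /comb_retract mulr0 subr0 [clamp 2]clamp_ge1 ?ler1n// mulr1.
  rewrite [clamp 0]clamp_le0// mulr0 addr0 clamp_id; last by have [] := set_valP y.
  by rewrite -surjective_pairing.
- move=> y; apply: val_inj; rewrite /= /comb_retract mulr1 subrr [clamp 0]clamp_le0// mulr0.
  rewrite [clamp 1]clamp_ge1// mulr1 clamp_ge1//.
  have [_ /andP[q0 _] _] := set_valP y.
  have : 0 <= (set_val y).2 by []. lra.
Qed.

Lemma comb_path_connected : path_connected R (comb R).
Proof.
apply: (@star_path_connected _ _ (comb_base R)) => y.
exists (fun t => exist _ (comb_path (set_val y) t) (mem_set (comb_path_in t (set_valP y)))).
  by move=> t; apply: cvg_subtype; exact: comb_path_continuous.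
split; apply: val_inj => /=; last exact: comb_path1.
by apply: comb_path0; exact: set_valP.
Qed.

Lemma double_comb_path_connected : path_connected R (double_comb R).
Proof.
apply: (@star_path_connected _ _ (double_comb_base R)) => y.
have [yc|yc] := set_valP y.
  have p t : double_comb_set (comb_path (set_val y) t) by left; exact: comb_path_in.
  exists (fun t => exist _ (comb_path (set_val y) t) (mem_set (p t))).
    by move=> t; apply: cvg_subtype; exact: comb_path_continuous.
  by split; apply: val_inj => /=; [exact: comb_path0|exact: comb_path1].
pose g t := comb_path (- (set_val y).1, - (set_val y).2) t.
have cg : continuous g by exact: comb_path_continuous.
have p t : double_comb_set (- (g t).1, - (g t).2).
  right; suff : comb_set (- - (g t).1, - - (g t).2) by [].
  by rewrite !opprK -surjective_pairing; exact: comb_path_in.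
exists (fun t => exist _ (- (g t).1, - (g t).2) (mem_set (p t))).
  move=> t; apply: cvg_subtype.
  have cg' : continuous (fun t => (- (g t).1, - (g t).2)) by ccont.
  exact: cg'.
have g0 : g 0 = (- (set_val y).1, - (set_val y).2) by exact: comb_path0.
have g1 : g 1 = (0, 0) by exact: comb_path1.
split; apply: val_inj.
  by rewrite -[LHS]/(- (g 0).1, - (g 0).2) g0 /= !opprK -surjective_pairing.
by rewrite -[LHS]/(- (g 1).1, - (g 1).2) g1 /= oppr0.
Qed.

End comb_homotopy.

Theorem corollary1p5 (R : realType) (F G : cone_functor) :
  F <> G ->
  exists (X : topologicalType) (x : X),
    [/\ path_connected R X, compact [set: X]%classic, hausdorff_space X
      & ~ homotopy_equivalent R (cone R F x) (cone R G x)].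
Proof.
have via_comb A B : ~ homotopy_equivalent R (cone R A (comb_base R)) (cone R B (comb_base R)) ->
    exists (X : topologicalType) (x : X),
    [/\ path_connected R X, compact [set: X]%classic, hausdorff_space X
      & ~ homotopy_equivalent R (cone R A x) (cone R B x)].
  exists (comb R), (comb_base R); split => //; [exact: comb_path_connected|
    exact: compact_comb|exact: hausdorff_comb].
have via_double A B :
    ~ homotopy_equivalent R (cone R A (double_comb_base R)) (cone R B (double_comb_base R)) ->
    exists (X : topologicalType) (x : X),
    [/\ path_connected R X, compact [set: X]%classic, hausdorff_space X
      & ~ homotopy_equivalent R (cone R A x) (cone R B x)].
  exists (double_comb R), (double_comb_base R); split => //;
    [exact: double_comb_path_connected|exact: compact_double_comb|exact: hausdorff_double_comb].
have sym A B : (exists (X : topologicalType) (x : X),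
    [/\ path_connected R X, compact [set: X]%classic, hausdorff_space X
      & ~ homotopy_equivalent R (cone R A x) (cone R B x)]) ->
    exists (X : topologicalType) (x : X),
    [/\ path_connected R X, compact [set: X]%classic, hausdorff_space X
      & ~ homotopy_equivalent R (cone R B x) (cone R A x)].
  move=> [X [x [pX cX hX AB]]]; exists X, x; split => // BA; apply: AB.
  exact: homotopy_equivalent_sym.
have pC := @comb_path_connected R; have cC := @compact_comb R; have hC := @hausdorff_comb R.
have pD := @double_comb_path_connected R; have cD := @compact_double_comb R.
have hD := @hausdorff_double_comb R.
have [H [v [cH H0 H1]]] := comb_contraction R.
have sc_ac := via_double SCf ACf (fun h => sc_double_comb_sequences
  (homotopy_equivalent_sequences h (AC_sequences pD cD))).
have sc_cac := via_double SCf CACf (fun h => sc_double_comb_sequences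
  (homotopy_equivalent_sequences h (CAC_sequences cD hD))).
have csc_ac := via_comb CSCf ACf (fun h => csc_comb_sequences
  (homotopy_equivalent_sequences h (AC_sequences pC cC))).
have csc_cac := via_comb CSCf CACf (fun h => csc_comb_sequences
  (homotopy_equivalent_sequences h (CAC_sequences cC hC))).
have csc_sc := via_comb CSCf SCf (fun h => csc_comb_sequences
  (homotopy_equivalent_sequences h (SC_sequences pC cC hC cH H0 H1))).
have ac_cac := via_comb ACf CACf (fun h => @CAC_not_contractible R
  (contractible_homotopy_equivalent h (AC_contractible (comb_base R) cC cH H0 H1))).
by case: F; case: G => // _; auto.
Qed.
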